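(* Consider site percolation on the triangular lattice. Then $$\lim_{p\downarrow p_c} L(p)\,\varphi_p = 2\sqrt{\pi}\,\nu,$$ and the normalized Wulff crystal $\widehat W_p$ converges in the Hausdorff metric to the Euclidean disk $\mathbb{D}_{1/\sqrt{\pi}}=\{x\in\mathbb{R}^2:\|x\|_2\le 1/\sqrt{\pi}\}$ as $p\downarrow p_c$.
   Context: Let $\mathbb{T}$ be the triangular lattice in $\mathbb{C}\cong\mathbb{R}^2$: vertex set $\{x+ye^{\pi i/3}:x,y\in\mathbb{Z}\}$, edges between vertices at Euclidean distance $1$. Site percolation: $\mathbf{P}_p$ is the product measure on $\{0,1\}^{V(\mathbb{T})}$ with $\mathbf{P}_p(\omega(v)=1)=p$; $v$ is open if $\omega(v)=1$, closed otherwise; $p_c=1/2$. For $p>p_c$, $\mathcal{C}_p^\infty$ is the a.s. unique infinite open cluster. Correlation length: for a box $\Lambda=[x_1,x_2]\times[y_1,y_2]$, a self-avoiding path $(v_0,\dots,v_k)$ is a left-right crossing of $\Lambda$ if $v_1,\dots,v_{k-1}\in\Lambda$ and the segments $\overline{v_0v_1}$, $\overline{v_{k-1}v_k}$ intersect the left and right sides of $\Lambda$ respectively; it is closed if all its vertices are closed. Fix $\epsilon_0\in(0,1/2)$ and set $L(p)=\inf\{n\ge1:\mathbf{P}_p[\exists\text{ a closed left-right crossing of }[0,n]^2]\le\epsilon_0\}$. First-passage percolation: for a path $\gamma$ (sequence of vertices with consecutive ones adjacent), $T(\gamma)=\sum_{v\in\gamma}\omega(v)$; for vertices $x,y$, $T(x,y)=\inf\{T(\gamma):\gamma\text{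 path from }x\text{ to }y\}$; for $x,y\in\mathbb{C}$, $T(x,y)=T(x',y')$ with $x',y'$ the nearest vertices (ties broken by a fixed ordering). The time constant $\mu_p(z)=\lim_n T(0,nz)/n$ exists a.s. and in $L^1$, and is a norm for $p>p_c$. It is known that there is a constant $\nu>0$ with $\lim_{p\downarrow p_c}L(p)\mu_p(z)=\nu$ uniformly in $|z|=1$; $\nu$ denotes this constant. Right-most paths and the boundary norm: a path $\gamma=(v_0,\dots,v_n)$ is simple if it traverses each oriented edge $\langle u,v\rangle$ (head $v$) at most once; if $v_0=v_n$ it is a circuit with indices mod $n$. When $v_{i-1},v_{i+1}$ are defined, the right-boundary edges at $v_i$ are the oriented edges out of $v_i$ listed counterclockwise strictly after $\langle v_i,v_{i-1}\rangle$ and strictly before $\langle v_i,v_{i+1}\rangle$ (otherwise none); their heads are the right-boundary vertices of $v_i$, and $\partial^+\gamma$ is the set of all of them. $\gamma$ is right-most if it is simple, uses no vertex of $\partial^+\gamma$, and each $v_i$ with $v_{i-1},v_{i+1}$ defined has at least one right-boundary vertex. $\mathbf{b}(\gamma)$ is the number of open vertices in $\partial^+\gamma$; for $x,y$ in the same open cluster, $b(x,y)$ is the infimum of $\mathbf{b}(\gamma)$ over open right-most paths from $x$ to $y$. $\widetilde x$ is the vertex of $\mathcal{C}_p^\infty$ nearest to $x\in\mathbb{R}^2$ in $\ell^\infty$ (lexicographic tie-break). For $p>p_c$, $\beta_p$ is the norm with $\beta_p(x)=\lim_n b(\widetilde0,\widetilde{nx})/n$ a.s. For a norm $\rho$ and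 curve $\gamma:[0,1]\to\mathbb{R}^2$, $\mathrm{len}_\rho(\gamma)=\sup_N\sup_{0\le t_0\le\dots\le t_N\le1}\sum_{i=1}^N\rho(\gamma(t_i)-\gamma(t_{i-1}))$. $\varphi_p=\inf\{\mathrm{len}_{\beta_p}(\gamma):\gamma\text{ Jordan curve},\ \mathrm{Leb}(\mathrm{int}\gamma)=1\}$, where $\mathrm{int}\gamma$ is the bounded complementary component. $W_p=\bigcap_{\|u\|_2=1}\{x\in\mathbb{R}^2:u\cdot x\le\beta_p(u)\}$, $\widehat W_p=W_p/\sqrt{\mathrm{Leb}(W_p)}$. Hausdorff metric uses the $\ell^\infty$ norm. *)

(* Defs.v *)
From HB Require Import structures.
From mathcomp Require Import all_boot all_order all_algebra.
From mathcomp Require Import all_classical all_reals all_analysis.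
Set Implicit Arguments. Unset Strict Implicit. Unset Printing Implicit Defensive.
Import Order.TTheory GRing.Theory Num.Theory.
Import numFieldNormedType.Exports.
Local Open Scope classical_set_scope.
Local Open Scope ring_scope.

(* vertex (a,b) stands for a + b e^{i pi/3} *)
Definition V := (int * int)%type.

Definition vadd (u v : V) : V := (u.1 + v.1, u.2 + v.2)%R.

(* the six unit directions, in counterclockwise order (angle 60 k degrees) *)
Definition dirv (k : nat) : V :=
  match (k %% 6)%N with
  | 0 => (1, 0) | 1 => (0, 1) | 2 => (-1, 1)
  | 3 => (-1, 0) | 4 => (0, -1) | _ => (1, -1) end%R.

Definition adjb (u v : V) : bool := has (fun k => v == vadd u (dirv k)) (iota 0 6).

Definition dir_index (u v : V) : nat := find (fun k => v == vadd u (dirv k)) (iota 0 6).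

Section Geometry.
Variable R : realType.

Definition emb (v : V) : R * R :=
  (v.1%:~R + v.2%:~R / 2, v.2%:~R * Num.sqrt 3 / 2).

Definition eucl (x : R * R) : R := Num.sqrt (x.1 ^+ 2 + x.2 ^+ 2).
Definition linf (x : R * R) : R := Num.max `|x.1| `|x.2|.
Definition sub2 (x y : R * R) : R * R := (x.1 - y.1, x.2 - y.2).
Definition scal2 (a : R) (x : R * R) : R * R := (a * x.1, a * x.2).

Definition lexle (a b : R * R) : Prop := a.1 < b.1 \/ (a.1 = b.1 /\ a.2 <= b.2).

End Geometry.

Definition lat_path (g : seq V) : Prop :=
  match g with [::] => False | v0 :: s => path adjb v0 s end.

Definition path_from_to (g : seq V) (x y : V) : Prop :=
  lat_path g /\ head x g = x /\ last x g = y.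

Definition plen (g : seq V) : nat := (size g).-1.

Definition oedges (g : seq V) : seq (V * V) := zip g (behead g).

Definition simple_path (g : seq V) : bool := uniq (oedges g).

Definition is_circuit (g : seq V) : bool :=
  (0 < plen g)%N && (nth (0,0)%R g 0 == nth (0,0)%R g (plen g)).

(* the indices i for which v_{i-1}, v_{i+1} are defined (indices mod n for circuits) *)
Definition inner_idx (g : seq V) : seq nat :=
  if is_circuit g then iota 0 (plen g) else iota 1 (plen g).-1.

Definition pprev (g : seq V) (i : nat) : V :=
  if is_circuit g then nth (0,0)%R g ((i + plen g).-1 %% plen g)
  else nth (0,0)%R g i.-1.

Definition pnext (g : seq V) (i : nat) : V :=
  if is_circuit g then nth (0,0)%R g (i.+1 %% plen g)
  else nth (0,0)%R g i.+1.

(* right-boundary vertices at v_i: heads of the oriented edges out of v_i listed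
   counterclockwise strictly after <v_i,v_{i-1}> and strictly before <v_i,v_{i+1}> *)
Definition rb_at (g : seq V) (i : nat) : seq V :=
  let v := nth (0,0)%R g i in
  let a := dir_index v (pprev g i) in
  let c := dir_index v (pnext g i) in
  [seq vadd v (dirv (a + k)) | k <- iota 1 ((c + 11 - a) %% 6)].

Definition rbound (g : seq V) : seq V := flatten [seq rb_at g i | i <- inner_idx g].

Definition rightmost (g : seq V) : bool :=
  [&& simple_path g,
      all (fun u => u \notin g) (rbound g)
    & all (fun i => (0 < size (rb_at g i))%N) (inner_idx g)].

Definition bcount (w : V -> bool) (g : seq V) : nat := size (undup (seq.filter w (rbound g))).

Section Percolation.
Variable R : realType.

Definition bdist (w : V -> bool) (x y : V) : R :=
  inf [set (bcount w g)%:R | g in [set g | path_from_to g x y /\ all w g /\ rightmost g]].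

Definition open_conn (w : V -> bool) (u v : V) : Prop :=
  exists g, path_from_to g u v /\ all w g.

Definition Cinf (w : V -> bool) : set V :=
  [set v | w v /\ ~ finite_set [set u | open_conn w v u]].

Definition tildeC (w : V -> bool) (x : R * R) : V :=
  xget (0,0)%R [set v | Cinf w v /\ forall u, Cinf w u ->
     linf (sub2 x (emb R v)) < linf (sub2 x (emb R u)) \/
     (linf (sub2 x (emb R v)) = linf (sub2 x (emb R u)) /\ lexle (emb R v) (emb R u))].

Definition nearest (x : R * R) : V :=
  xget (0,0)%R [set v | forall u,
     eucl (sub2 x (emb R v)) < eucl (sub2 x (emb R u)) \/
     (eucl (sub2 x (emb R v)) = eucl (sub2 x (emb R u)) /\ lexle (emb R v) (emb R u))].

Definition Tpath (w : V -> bool) (g : seq V) : nat := (\sum_(v <- g) (w v : nat))%N.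

Definition Tvert (w : V -> bool) (u v : V) : R :=
  inf [set (Tpath w g)%:R | g in [set g | path_from_to g u v]].

Definition Tpt (w : V -> bool) (x y : R * R) : R := Tvert w (nearest x) (nearest y).

Definition seg_meets (a b : R * R) (S : set (R * R)) : Prop :=
  exists t : R, 0 <= t <= 1 /\ S ((1 - t) * a.1 + t * b.1, (1 - t) * a.2 + t * b.2).

Definition closed_LR_crossing (w : V -> bool) (n : nat) : Prop :=
  exists g : seq V, lat_path g /\ uniq g /\ (1 < size g)%N /\
    (forall i, (0 < i < plen g)%N ->
       let z := emb R (nth (0,0)%R g i) in 0 <= z.1 <= n%:R /\ 0 <= z.2 <= n%:R) /\
    seg_meets (emb R (nth (0,0)%R g 0)) (emb R (nth (0,0)%R g 1))
       [set z | z.1 = 0 /\ 0 <= z.2 <= n%:R] /\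
    seg_meets (emb R (nth (0,0)%R g (plen g).-1)) (emb R (nth (0,0)%R g (plen g)))
       [set z | z.1 = n%:R /\ 0 <= z.2 <= n%:R] /\
    all (fun v => ~~ w v) g.

Context {d : measure_display} {Om : measurableType d}.

(* under P, the coordinates of X are i.i.d. Bernoulli(p) (law = product measure P_p) *)
Definition site_percolation (P : probability Om R) (X : Om -> V -> bool) (p : R) : Prop :=
  (forall v, measurable [set om | X om v]) /\
  forall (s : seq V) (a : V -> bool), uniq s ->
    P [set om | forall v, v \in s -> X om v = a v] =
    (\prod_(v <- s) (if a v then p else 1 - p))%:E.

Definition Lcorr (P : R -> probability Om R) (X : Om -> V -> bool) (eps0 : R) (p : R) : R :=
  inf [set n%:R | n in [set n : nat | (1 <= n)%N /\
         (P p [set om | closed_LR_crossing (X om) n] <= eps0%:E)%E]].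

End Percolation.

Section Continuum.
Variable R : realType.

Definition unit01 : set R := [set t | 0 <= t <= 1].

Definition len_rho (rho : R * R -> R) (gam : R -> R * R) : \bar R :=
  ereal_sup [set r | exists (N : nat) (t : nat -> R),
     [/\ 0 <= t 0, (forall i, (i < N)%N -> t i <= t i.+1), t N <= 1 &
          r = (\sum_(0 <= i < N) rho (sub2 (gam (t i.+1)) (gam (t i))))%:E]].

Definition jordan_curve (gam : R -> R * R) : Prop :=
  {within unit01, continuous gam} /\ gam 0 = gam 1 /\
  (forall s t, 0 <= s < 1 -> 0 <= t < 1 -> gam s = gam t -> s = t).

Definition bounded2 (S : set (R * R)) : Prop :=
  exists M : R, forall z, S z -> `|z.1| <= M /\ `|z.2| <= M.

Definition jordan_int (gam : R -> R * R) : set (R * R) :=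
  [set z | ~ (gam @` unit01) z /\
           bounded2 (connected_component (~` (gam @` unit01)) z)].

Definition leb2 : set (R * R) -> \bar R :=
  ((@lebesgue_measure R) \x (@lebesgue_measure R))%E.

Definition phi (beta : R * R -> R) : \bar R :=
  ereal_inf [set len_rho beta gam | gam in
     [set gam | jordan_curve gam /\ leb2 (jordan_int gam) = 1%E]].

Definition wulff (beta : R * R -> R) : set (R * R) :=
  [set x | forall u, eucl u = 1 -> u.1 * x.1 + u.2 * x.2 <= beta u].

Definition wulff_hat (beta : R * R -> R) : set (R * R) :=
  scal2 (Num.sqrt (fine (leb2 (wulff beta))))^-1 @` wulff beta.

Definition hausdorff (A B : set (R * R)) : \bar R :=
  Order.max
    (ereal_sup [set ereal_inf [set (linf (sub2 a b))%:E | b in B] | a in A])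
    (ereal_sup [set ereal_inf [set (linf (sub2 a b))%:E | a in A] | b in B]).

Definition disk (r : R) : set (R * R) := [set x | eucl x <= r].

End Continuum.

(* Main.v *)
(** The boundary norm equals the time constant: [beta_p = mu_p].  The right-boundary
    vertices of an open right-most path form a lattice walk between its end points up
    to two vertices, whence [T <= b + 2].  Conversely, let two open vertices have infinite
    open arms avoiding the interior of a path [g] that joins them.  If closed clusters
    are finite, the union [A] of that interior with the closed clusters it meets is finite,
    and walking around [A] gives an open right-most path whose open right-boundary vertices
    lie on [g], so [b <= T(g)].  Such configurations have probability bounded below:
    [mu_p > 0] makes closed crossings of annuli unlikely, which yields half-plane arms,
    and an optimal path can be confined to the strip between the two half-planes, where
    it is independent of the arms.

    Hence [L(p) beta_p(u) -> nu] uniformly on the unit circle, and [L(p) beta_p] is squeezed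
    between two multiples of the Euclidean norm that both tend to [nu].  The first
    limit is then the isoperimetric inequality for Jordan curves: if [G] is the
    [t]-neighbourhood of a curve of length [l] enclosing area 1, then [|G| <= pi t^2 + 2 t l],
    whereas the Brunn-Minkowski inequality, used outside and inside, gives
    [|G| >= 4 t sqrt pi].  The second is the inclusion of the Wulff crystal between two
    concentric disks whose radii have ratio tending to 1. *)
Require Import Defs.
From HB Require Import structures.
From mathcomp Require Import all_boot all_order all_algebra.
From mathcomp Require Import zify ring lra.
From mathcomp Require Import all_classical all_reals all_analysis measurable_realfun.
Set Implicit Arguments. Unset Strict Implicit. Unset Printing Implicit Defensive.
Import Order.TTheory GRing.Theory Num.Theory.
Import numFieldNormedType.Exports.
Local Open Scope classical_set_scope.
Local Open Scope ring_scope.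

(** * Interfaces on the triangular lattice *)

(** Only a lower bound on the probability of a good configuration is available, so b <= T is reached
    for infinitely many n at one sample point, at which both almost sure limits hold as well. As
    these limits exist, a subsequence identifies them.

    The arms at fixed p come from the linear growth T(0,x) >= |x| / K, which sends the probability
    of a closed crossing of an annulus to 0. A quadratic recursion from scale r to scale 6r makes
    the decay geometric, so the bad events can be summed over all scales.

    Planar topology enters only through the exactness of mod 2 cochains on the triangulated plane: a
    property of the edges between a connected set and a component of its complement that passes
    across each triangle holds for all these edges or for none.

    [mu] and [beta] are given as pointwise limits, so homogeneity has to be derived. The strip
    construction needs a direction whose first lattice coordinate is positive; symmetries of the
    lattice supply the others. *)

Lemma vaddA : associative vadd.
Proof. by move=> x y z; rewrite /vadd /= !addrA. Qed.

Lemma dirv_mod k : dirv (k %% 6) = dirv k.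
Proof. by rewrite /dirv modn_mod. Qed.

Lemma dirv_modD k j : dirv (k %% 6 + j) = dirv (k + j).
Proof. by rewrite /dirv modnDml. Qed.

Ltac dirv_cases k := move: (ltn_pmod k (isT : (0 < 6)%N)); case: (k %% 6)%N => [|[|[|[|[|[|?]]]]]] // _.

Lemma dirvD6 k : dirv (k + 6) = dirv k.
Proof. by rewrite /dirv modnDr. Qed.

Lemma dirvD3 k : dirv (k + 3) = (- (dirv k).1, - (dirv k).2).
Proof. rewrite -dirv_modD -(dirv_mod k); dirv_cases k. Qed.

Lemma dirvSS k : dirv (k + 1) = vadd (dirv k) (dirv (k + 2)).
Proof. rewrite -!(dirv_modD k) -(dirv_mod k); dirv_cases k. Qed.

Lemma dirv_eq i j : (dirv i == dirv j) = (i == j %[mod 6])%N.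
Proof.
rewrite -(dirv_mod i) -(dirv_mod j).
move: (ltn_pmod i (isT : (0 < 6)%N)) (ltn_pmod j (isT : (0 < 6)%N)).
by case: (i %% 6)%N => [|[|[|[|[|[|?]]]]]] // _; case: (j %% 6)%N => [|[|[|[|[|[|?]]]]]].
Qed.

Lemma adjbP u v : reflect (exists k, v = vadd u (dirv k)) (adjb u v).
Proof.
apply: (iffP hasP) => [[k _ /eqP ->]|[k ->]]; first by exists k.
exists (k %% 6)%N; last by rewrite dirv_mod.
by rewrite mem_iota /= ltn_pmod.
Qed.

Lemma adjb_dirv u k : adjb u (vadd u (dirv k)).
Proof. by apply/adjbP; exists k. Qed.

Lemma adjbE u v : adjb u v =
  [|| (v.1 == u.1 + 1) && (v.2 == u.2), (v.1 == u.1) && (v.2 == u.2 + 1),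
      (v.1 == u.1 - 1) && (v.2 == u.2 + 1), (v.1 == u.1 - 1) && (v.2 == u.2),
      (v.1 == u.1) && (v.2 == u.2 - 1) | (v.1 == u.1 + 1) && (v.2 == u.2 - 1)].
Proof.
case: u v => a b [c d]; rewrite /adjb /= /vadd /= !xpair_eqE !addr0 !orbF.
by [].
Qed.

Lemma adjb_sym u v : adjb u v = adjb v u.
Proof. rewrite !adjbE; lia. Qed.

Lemma dir_indexE v k : dir_index v (vadd v (dirv k)) = (k %% 6)%N.
Proof.
case: v => a b; rewrite /dir_index.
under eq_find => j.
  have -> : (vadd (a, b) (dirv k) == vadd (a, b) (dirv j)) = (dirv k == dirv j).
    by rewrite /vadd /= xpair_eqE !(inj_eq (addrI _)) -xpair_eqE -!surjective_pairing.
  rewrite dirv_eq; over.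
move: (ltn_pmod k (isT : (0 < 6)%N)).
by case: (k %% 6)%N => [|[|[|[|[|[|?]]]]]] //.
Qed.

Definition conn (S : V -> Prop) (u v : V) : Prop :=
  exists g, path_from_to g u v /\ forall x, x \in g -> S x.

Lemma path_from_toP g x y :
  path_from_to g x y <-> exists s, [/\ g = x :: s, path adjb x s & last x s = y].
Proof.
split=> [[]|[s [-> p l]]]; last by split.
case: g => [|v0 s] //= p [e l]; subst v0.
by exists s; split.
Qed.

Lemma connP S u v : conn S u v <->
  exists s, [/\ path adjb u s, last u s = v & forall x, x \in u :: s -> S x].
Proof.
split=> [[g [/path_from_toP[s [-> p l]] h]]|[s [p l h]]]; first by exists s.
by exists (u :: s); split=> //; apply/path_from_toP; exists s.
Qed.

Lemma conn_refl (S : V -> Prop) u : S u -> conn S u u.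
Proof. by move=> Su; apply/connP; exists [::]; split=> // x; rewrite inE => /eqP ->. Qed.

Lemma conn_trans S v u w : conn S u v -> conn S v w -> conn S u w.
Proof.
move=> /connP[s [p l h]] /connP[t [q m k]]; apply/connP; exists (s ++ t).
rewrite cat_path last_cat l p q m; split=> // x.
rewrite -cat_cons mem_cat => /orP[/h//|xt]; apply: k.
by rewrite inE xt orbT.
Qed.

Lemma conn_sub (S S' : V -> Prop) u v :
  (forall x, S x -> S' x) -> conn S u v -> conn S' u v.
Proof. by move=> h [g [p q]]; exists g; split=> // x /q /h. Qed.

Lemma conn_sym S u v : conn S u v -> conn S v u.
Proof.
move=> /connP[s [p l h]]; apply/connP; exists (rev (belast u s)).
have := rev_path adjb u s; rewrite l => e.
split; first by rewrite e; apply: sub_path p => x y; rewrite adjb_sym.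
  by rewrite -l; case: (s) => //= a s' ; rewrite rev_cons last_rcons.
move=> x xi; apply: h; rewrite lastI mem_rcons l.
by move: xi; rewrite !inE mem_rev.
Qed.

Lemma conn_in S u v : conn S u v -> S u /\ S v.
Proof.
move=> /connP[s [p <- h]]; split; apply: h; first by rewrite mem_head.
by rewrite mem_last.
Qed.

Lemma conn_adj (S : V -> Prop) u v : S u -> S v -> adjb u v -> conn S u v.
Proof.
move=> su sv a; apply/connP; exists [:: v]; split=> //=; first by rewrite a.
by move=> x; rewrite !inE => /orP[] /eqP ->.
Qed.

Lemma conn_step S u v w : conn S u v -> S w -> adjb v w -> conn S u w.
Proof.
by move=> c Sw a; apply: (conn_trans c); apply: conn_adj => //; case: (conn_in c).
Qed.

Lemma conn_ind S (P : V -> Prop) u v : P u ->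
  (forall x y, P x -> S x -> S y -> adjb x y -> P y) -> conn S u v -> P v.
Proof.
move=> Pu h /connP[s [p <- k]]; elim: s u Pu p k => //= a s IH u Pu /andP[ua p] k.
apply: IH => //; last by move=> x xs; apply: k; rewrite inE xs orbT.
by apply: (h u) => //; apply: k; rewrite !inE eqxx ?orbT.
Qed.

Lemma open_connE w u v : open_conn w u v <-> conn w u v.
Proof.
split=> -[g [p h]]; exists g; split=> //; first by move=> x; apply/allP.
by apply/allP => x /h.
Qed.

(** A discrete antiderivative mod 2: partial sums of h from 0, run backwards on the negative
    integers. *)
Lemma bool_sumZ (h : int -> bool) : exists g : int -> bool, forall n, g (n + 1) = g n (+) h n.
Proof.
pose gp n := \big[addb/false]_(i < n) h i.
pose gn n := \big[addb/false]_(i < n) h (- (i.+1%:Z)).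
exists (fun z => match z with Posz n => gp n | Negz n => gn n.+1 end).
case=> [n|[|n]].
- by rewrite addrC -intS /gp big_ord_recr.
- by rewrite /= /gp big_ord0 /gn big_ord_recr big_ord0 /= addbb.
- have -> : Negz n.+1 + 1 = Negz n by lia.
  rewrite /gn [in RHS]big_ord_recr /=.
  have -> : Negz n.+1 = - (n.+2%:Z) by [].
  by rewrite -addbA addbb addbF.
Qed.

(** The triangles fill every cycle of the lattice. The potential is integrated along the row of
    second coordinate 0 ([g0]) and up each column ([G]); exactness passes to the other rows through
    the two triangles between consecutive horizontal edges. *)
Lemma cochain_exact (c : V -> V -> bool) :
  (forall u v, c u v = c v u) ->
  (forall u v w, adjb u v -> adjb v w -> adjb u w -> c u v (+) c v w = c u w) ->
  exists f : V -> bool, forall u v, adjb u v -> c u v = f u (+) f v.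
Proof.
move=> csym ctri.
have [G GP] : {G : int -> int -> bool | forall a b, G a (b + 1) = G a b (+) c (a, b) (a, b + 1)}.
  pose G0 a := cid (bool_sumZ (fun b => c (a, b) (a, b + 1))).
  by exists (fun a => sval (G0 a)) => a b; rewrite (svalP (G0 a)).
have [g0 g0P] := bool_sumZ (fun a => c (a, 0) (a + 1, 0) (+) (G a 0 (+) G (a + 1) 0)).
pose f (v : V) := g0 v.1 (+) G v.1 v.2.
have ver a b : c (a, b) (a, b + 1) = f (a, b) (+) f (a, b + 1).
  by rewrite /f /= GP; case: (g0 a); case: (G a b); case: (c _ _).
have dia a b : c (a, b) (a + 1, b) = f (a, b) (+) f (a + 1, b) <->
    c (a + 1, b) (a, b + 1) = f (a + 1, b) (+) f (a, b + 1).
  have := ctri (a, b) (a + 1, b) (a, b + 1); rewrite !adjbE /= ver => H.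
  have {H} := H ltac:(lia) ltac:(lia) ltac:(lia).
  by case: (c _ _); case: (c _ _); case: (f _); case: (f _); case: (f _).
have hor1 a b : c (a + 1, b) (a, b + 1) = f (a + 1, b) (+) f (a, b + 1) <->
    c (a, b + 1) (a + 1, b + 1) = f (a, b + 1) (+) f (a + 1, b + 1).
  have := ctri (a + 1, b) (a, b + 1) (a + 1, b + 1); rewrite !adjbE /= ver => H.
  have {H} := H ltac:(lia) ltac:(lia) ltac:(lia).
  by case: (c _ _); case: (c _ _); case: (f _); case: (f _); case: (f _).
have hor a b : c (a, b) (a + 1, b) = f (a, b) (+) f (a + 1, b).
  have step b' : c (a, b') (a + 1, b') = f (a, b') (+) f (a + 1, b') <->
    c (a, b' + 1) (a + 1, b' + 1) = f (a, b' + 1) (+) f (a + 1, b' + 1).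
    exact: iff_trans (dia a b') (hor1 a b').
  have h0 : c (a, 0) (a + 1, 0) = f (a, 0) (+) f (a + 1, 0).
    rewrite /f /= g0P; by case: (c (a, 0) (a + 1, 0)); case: (g0 a); case: (G a 0); case: (G (a + 1) 0).
  case: b => n.
    elim: n => [//|n IH]; rewrite -[n.+1]addn1 PoszD.
    exact: (step _).1.
  elim: n => [|n IH]; apply: (step _).2; first by rewrite (_ : Negz 0 + 1 = 0).
  by rewrite (_ : Negz n.+1 + 1 = Negz n) //; lia.
exists f => u v /adjbP[k ->]; rewrite -(dirv_mod k).
case: u => a b; dirv_cases k; rewrite /vadd /= ?addr0.
- exact: hor.
- exact: ver.
- by have := (dia (a - 1) b).1 (hor _ _); rewrite !subrK.
- by have := hor (a - 1) b; rewrite csym addbC !subrK.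
- by have := ver a (b - 1); rewrite csym addbC !subrK.
- by have := (dia a (b - 1)).1 (hor _ _); rewrite csym addbC !subrK.
Qed.

Section Cut.
Variables (A D : V -> Prop).
Hypothesis DA : forall v, D v -> A v -> False.
Hypothesis Dcl : forall v w, D v -> adjb v w -> ~ A w -> D w.
Hypothesis Dconn : forall u v, D u -> D v -> conn D u v.
Hypothesis Aconn : forall u v, A u -> A v -> conn A u v.

(* The indicator of the oriented cut edges satisfying O is a cochain mod 2 summing to 0
   around triangles, hence exact, so it is constant on the connected sets A and D. *)
Lemma cut_invariant (O : V -> V -> Prop) :
  (forall v u u', D v -> A u -> A u' -> adjb v u -> adjb v u' -> adjb u u' -> O v u -> O v u') ->
  (forall v v' u, D v -> D v' -> A u -> adjb v u -> adjb v' u -> adjb v v' -> O v u -> O v' u) ->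
  forall v u v' u', D v -> A u -> adjb v u -> D v' -> A u' -> adjb v' u' -> O v u -> O v' u'.
Proof.
move=> Orot Omov.
pose cd u v := `[< D u /\ A v /\ O u v >].
pose c u v := cd u v || cd v u.
have cdP u v : cd u v -> [/\ D u, A v & O u v] by move/asboolP => [? [? ?]].
(* The third vertex of a triangle containing a marked cut edge lies in [A] or, by [Dcl], in [D].
   Either way exactly one of the other two edges is marked, so a triangle has 0 or 2 marked
   edges. *)
have ctri u v w : adjb u v -> adjb v w -> adjb u w -> c u v (+) c v w = c u w.
  have H x y z : adjb x y -> adjb y z -> adjb x z -> cd x y -> c x z != c y z.
    move=> xy yz xz /cdP [Dx Ay Oxy].
    have cxy : cd y x = false by apply/negP => /cdP[/DA h _ _]; exact: h.
    have czx : cd z x = false by apply/negP => /cdP[_ /(DA Dx)].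
    have cyz : cd y z = false by apply/negP => /cdP[/DA h _ _]; exact: h.
    rewrite /c czx cyz orbF /=; case: (pselect (A z)) => Az.
      have -> : cd x z by apply/asboolP; split=> //; split=> //; apply: (Orot x y z).
      have -> // : cd z y = false by apply/negP => /cdP[/DA h _ _]; exact: h.
    have Dz : D z by apply: (Dcl Dx xz).
    have -> : cd x z = false by apply/negP => /cdP[_ /Az].
    suff -> : cd z y by [].
    by apply/asboolP; split=> //; split=> //; apply: (Omov x z y) => //; rewrite adjb_sym.
  have H' x y z : adjb x y -> adjb y z -> adjb x z -> c x y -> c x z != c y z.
    move=> xy yz xz /orP[|h]; first exact: H.
    by rewrite eq_sym; apply: H => //; rewrite adjb_sym.
  have cs x y : c x y = c y x by rewrite /c orbC.
  move=> uv vw uw.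
  have h1 : c u v -> c u w != c v w by apply: H'.
  have h2 : c v w -> c u v != c u w.
    by rewrite (cs u v) (cs u w); apply: H'; rewrite // adjb_sym.
  have h3 : c u w -> c u v != c v w.
    by rewrite (cs v w); apply: H'; rewrite // adjb_sym.
  move: h1 h2 h3; case: (c u v); case: (c v w); case: (c u w) => // h1 h2 h3;
  by [move: (h1 isT)|move: (h2 isT)|move: (h3 isT)].
have [|f fP] := @cochain_exact c _ ctri; first by move=> x y; rewrite /c orbC.
have fD u v : D u -> D v -> f u = f v.
  move=> Du Dv; apply: (conn_ind (P := fun v => f u = f v) _ _ (Dconn Du Dv)) => //.
  move=> x y -> Dx Dy /fP; have -> : c x y = false.
    by apply/negP => /orP[] /cdP[_ h _]; [exact: (DA Dy h)|exact: (DA Dx h)].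
  by case: (f x); case: (f y).
have fA u v : A u -> A v -> f u = f v.
  move=> Du Dv; apply: (conn_ind (P := fun v => f u = f v) _ _ (Aconn Du Dv)) => //.
  move=> x y -> Dx Dy /fP; have -> : c x y = false.
    by apply/negP => /orP[] /cdP[/DA h _ _]; exact: h.
  by case: (f x); case: (f y).
move=> v u v' u' Dv Au vu Dv' Au' vu' Ovu.
have : c v u by apply/orP; left; apply/asboolP.
rewrite fP // (fD _ _ Dv Dv') (fA _ _ Au Au') -fP // => /orP[/cdP[]//|/cdP[_ h _]].
by case: (DA Dv' h).
Qed.
End Cut.

Lemma adjb_vadd v a b : adjb (vadd v a) (vadd v b) = adjb a b.
Proof. by case: v a b => ? ? [? ?] [? ?]; rewrite !adjbE /=; lia. Qed.

Lemma adjb_dirv2 k k' : adjb (dirv k) (dirv k') -> dirv k' = dirv (k + 1) \/ dirv k' = dirv (k + 5).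
Proof.
rewrite -!(dirv_modD k) -(dirv_mod k) -(dirv_mod k') adjbE; move: (ltn_pmod k' (isT : (0 < 6)%N)).
by dirv_cases k; case: (k' %% 6)%N => [|[|[|[|[|[|?]]]]]] // _ /= h; by [left|right|].
Qed.

Lemma dirv_turn v k : vadd (vadd v (dirv (k + 1))) (dirv (k + 5)) = vadd v (dirv k).
Proof.
rewrite -vaddA; congr vadd; rewrite -!(dirv_modD k) -(dirv_mod k); by dirv_cases k.
Qed.

Lemma dirv_back v k : vadd (vadd v (dirv k)) (dirv (k + 3)) = v.
Proof. by case: v => a b; rewrite dirvD3 /vadd /= !addrK. Qed.

Section Interface.
Variables (A D : V -> Prop).
Hypothesis DA : forall v, D v -> A v -> False.
Hypothesis Dcl : forall v w, D v -> adjb v w -> ~ A w -> D w.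
Hypothesis Dconn : forall u v, D u -> D v -> conn D u v.
Hypothesis Aconn : forall u v, A u -> A v -> conn A u v.

Definition inner_bd x := D x /\ exists2 u, A u & adjb x u.

(** [cut_invariant] for the cut edges whose end in [D] is joined to x inside the inner boundary: a
    rotation keeps that end, and a move replaces it by an adjacent boundary vertex. *)
Lemma inner_bd_conn x y : inner_bd x -> inner_bd y -> conn inner_bd x y.
Proof.
move=> bx by_; case: (bx) (by_) => Dx [u Au xu] [Dy [u' Au' yu']].
have Omov v v' w : D v -> D v' -> A w -> adjb v w -> adjb v' w -> adjb v v' ->
    conn inner_bd x v -> conn inner_bd x v'.
  by move=> Dv Dv' Aw vw v'w vv' c; apply: (conn_step c) => //; split=> //; exists w.
apply: (cut_invariant DA Dcl Dconn Aconn (O := fun v _ => conn inner_bd x v)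
  _ Omov Dx Au xu Dy Au' yu') => //.
exact: conn_refl.
Qed.

(* A state (v, k) stands for the cut edge from v in D to its neighbour in A in direction k;
   nx turns counterclockwise along the cut. *)
Definition rot (s : V * nat) : bool := `[< A (vadd s.1 (dirv (s.2 + 1))) >].

Definition nx (s : V * nat) : V * nat :=
  if rot s then (s.1, (s.2 + 1) %% 6)%N else (vadd s.1 (dirv (s.2 + 1)), (s.2 + 5) %% 6)%N.

Definition valid (s : V * nat) := [/\ D s.1, A (vadd s.1 (dirv s.2)) & (s.2 < 6)%N].

Lemma nx_valid s : valid s -> valid (nx s).
Proof.
case: s => v k [/= Dv Au k6]; rewrite /nx /rot; case: asboolP => /= h; split=> //=.
- by rewrite dirv_mod.
- by rewrite ltn_pmod.
- by apply: (Dcl Dv) => //; exact: adjb_dirv.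
- by rewrite dirv_mod dirv_turn.
- by rewrite ltn_pmod.
Qed.

(** The clockwise rule, which undoes [nx] on valid states. *)
Definition pv (s : V * nat) : V * nat :=
  if `[< A (vadd s.1 (dirv (s.2 + 5))) >] then (s.1, (s.2 + 5) %% 6)%N
  else (vadd s.1 (dirv (s.2 + 5)), (s.2 + 1) %% 6)%N.

Lemma nxK s : valid s -> pv (nx s) = s.
Proof.
case: s => v k [/= Dv Au k6]; rewrite /nx /rot; case: asboolP => /= h; rewrite /pv /=.
  rewrite dirv_modD -addnA /= dirvD6 asboolT //; congr pair.
  by rewrite modnDml -addnA modnDr modn_small.
rewrite dirv_modD.
have -> : vadd (vadd v (dirv (k + 1))) (dirv (k + 5 + 5)) = v.
  by rewrite -[RHS](dirv_back _ (k + 1)) -addnA (_ : (k + (5 + 5) = k + 1 + 3 + 6)%N) ?dirvD6 //; lia.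
rewrite asboolF; last by move/(DA Dv).
by rewrite modnDml -addnA modnDr modn_small.
Qed.

Lemma nx_inj s t : valid s -> valid t -> nx s = nx t -> s = t.
Proof. by move=> vs vt e; rewrite -(nxK vs) e nxK. Qed.

Lemma iter_valid s i : valid s -> valid (iter i nx s).
Proof. by move=> vs; elim: i => //= i; exact: nx_valid. Qed.

Lemma iter_nx_inj s i t : valid s -> valid t -> iter i nx s = iter i nx t -> s = t.
Proof.
move=> vs vt; elim: i => //= i IH e; apply: IH; apply: nx_inj e; exact: iter_valid.
Qed.

Variable sA : seq V.
Hypothesis AsA : forall v, A v -> v \in sA.

(** A state is determined by its end in the finite set [A] and a direction, so valid states are
    finitely many; since [nx] is injective on them, the orbit closes up at s itself. *)
Lemma nx_periodic s : valid s -> exists m, iter m.+1 nx s = s.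
Proof.
move=> vs.
pose l := allpairs (fun (u : V * nat) (i : nat) => (vadd u.1 (dirv u.2), i))
  (allpairs pair sA (iota 0 6)) (iota 0 6).
have sub t : valid t -> t \in l.
  case: t => v k [/= Dv Au k6]; apply/allpairsP.
  exists ((vadd v (dirv k), (k + 3) %% 6)%N, k); split.
  - apply/allpairsP; exists (vadd v (dirv k), (k + 3) %% 6)%N; split=> //; first exact: AsA.
    by rewrite mem_iota ltn_pmod.
  - by rewrite mem_iota.
  - by rewrite /= dirv_mod dirv_back.
have : looping nx s (size l).
  rewrite -[looping _ _ _]negbK -looping_uniq; apply/negP => /uniq_leq_size-/(_ l).
  rewrite size_traject ltnn => h; suff : false by [].
  apply: h => t /trajectP[i _ ->]; apply: sub; exact: iter_valid.
rewrite /looping => /trajectP[i il e]; exists (size l - i).-1.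
rewrite prednK ?subn_gt0 //; apply: (@iter_nx_inj _ i) => //; first exact: iter_valid.
by rewrite -iterD subnKC // ltnW.
Qed.

Lemma iter_pred s t i : valid s -> valid t -> nx t = iter i nx s -> exists j, t = iter j nx s.
Proof.
move=> vs vt; case: i => [/= e|i /= e]; last first.
  by exists i; apply: nx_inj => //; exact: iter_valid.
have [m em] := nx_periodic vs; exists m; apply: nx_inj => //; first exact: iter_valid.
by rewrite e -[LHS]em.
Qed.

(** [cut_invariant] with [O] the edges visited by the orbit. The two triangles at a cut edge lead to
    its successor and to its predecessor, and the latter is on the orbit by periodicity. *)
Lemma orbit_full s v : valid s -> inner_bd v -> exists j, (iter j nx s).1 = v.
Proof.
case: s => x k vs [Dv [u Au vu]].
pose O v u := exists i, let s := iter i nx (x, k) in s.1 = v /\ vadd s.1 (dirv s.2) = u.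
suff [i [/= e _]] : O v u by exists i.
have [Dx Ax k6] := vs.
apply: (cut_invariant DA Dcl Dconn Aconn (O := O) _ _ Dx Ax (adjb_dirv _ _) Dv Au vu); last first.
- by exists 0%N.
- move=> v0 v1 w D0 D1 Aw a0w a1w a01 [i]; have := iter_valid i vs.
  case ei: (iter i nx (x, k)) => [v2 j] [/= D2 A2 j6] [e2 ew]; subst v2 w.
  case/adjbP: a01 => j' e1; subst v1.
  move: a1w; rewrite adjb_sym adjb_vadd => /adjb_dirv2[] ej; rewrite ej in D1 *.
    exists i.+1; rewrite /= ei /nx /rot /= asboolF /=; last by move/(DA D1).
    by rewrite dirv_mod dirv_turn.
  have vt : valid (vadd v0 (dirv (j + 5)), ((j + 1) %% 6)%N).
    split=> //=; last by rewrite ltn_pmod.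
    by rewrite dirv_mod -vaddA [vadd (dirv (j + 5)) _]/vadd addrC [_.2 + _]addrC -/(vadd _ _) vaddA dirv_turn.
  have := @iter_pred (x, k) _ i vs vt; rewrite ei => h.
  have [|i' ei'] := h; last first.
    exists i'; rewrite -ei' /=; split=> //.
    by rewrite dirv_mod -vaddA [vadd (dirv (j + 5)) _]/vadd addrC [_.2 + _]addrC -/(vadd _ _) vaddA dirv_turn.
  have e : vadd (vadd v0 (dirv (j + 5))) (dirv (j + 2)) = v0.
    by rewrite -[RHS](dirv_back _ (j + 5)) (_ : (j + 5 + 3 = j + 2 + 6)%N) ?dirvD6 //; lia.
  rewrite /nx /rot /= dirv_modD -addnA e asboolF /=; last by move/(DA D0).
  by rewrite modnDml -addnA modnDr modn_small.
- move=> v0 w w' D0 Aw Aw' a0w a0w' aww [i]; have := iter_valid i vs.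
  case ei: (iter i nx (x, k)) => [v2 j] [/= D2 A2 j6] [e2 ew]; subst v2 w.
  case/adjbP: a0w' => j' ew'; subst w'.
  move: aww; rewrite adjb_vadd => /adjb_dirv2[] ej; rewrite ej in Aw' *.
    exists i.+1; rewrite /= ei /nx /rot /= asboolT //=.
    by rewrite dirv_mod.
  have vt : valid (v0, ((j + 5) %% 6)%N).
    by split=> //=; [rewrite dirv_mod | rewrite ltn_pmod].
  have := @iter_pred (x, k) _ i vs vt; rewrite ei => h.
  have [|i' ei'] := h; last first.
    by exists i'; rewrite -ei' /= dirv_mod.
  rewrite /nx /rot /= dirv_modD -addnA dirvD6 asboolT //=.
  by rewrite modnDml -addnA modnDr modn_small.
Qed.

Definition mv (s : V * nat) : V := vadd s.1 (dirv (s.2 + 1)).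

(** Rotations of the cut edge about its end in [D] leave no trace; only moves append a vertex. *)
Definition ipath s j : seq V := s.1 :: [seq mv t | t <- traject nx s j & ~~ rot t].

Lemma ipathS s j : ipath s j.+1 =
  if rot (iter j nx s) then ipath s j else rcons (ipath s j) (mv (iter j nx s)).
Proof.
by rewrite /ipath trajectSr filter_rcons; case: rot => //=; rewrite map_rcons.
Qed.

Lemma ipath_last x s j : last x (ipath s j) = (iter j nx s).1.
Proof.
elim: j => //= j IH; rewrite -[last _ _]/(last x (ipath s j.+1)) ipathS /nx.
by case: ifP => _ //; rewrite last_rcons.
Qed.

Lemma ipath_bd s j : valid s -> forall v, v \in ipath s j -> inner_bd v.
Proof.
move=> vs; elim: j => [|j IH] v.
  rewrite /ipath /= inE => /eqP ->; case: vs => D1 A1 _; split=> //.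
  by exists (vadd s.1 (dirv s.2)) => //; exact: adjb_dirv.
rewrite ipathS; case: ifP => h; first exact: IH.
rewrite mem_rcons inE => /orP[/eqP ->|]; last exact: IH.
have := nx_valid (iter_valid j vs); rewrite /nx h => -[/= D1 A1 _]; split=> //.
by rewrite dirv_mod in A1; eexists; first exact: A1; exact: adjb_dirv.
Qed.

Lemma ipath_lat s j : lat_path (ipath s j).
Proof.
elim: j => // j; rewrite ipathS; case: ifP => // _ IH.
rewrite /= rcons_path; apply/andP; split=> //.
by have /= := ipath_last s.1 s j => ->; exact: adjb_dirv.
Qed.

Lemma oedges_rcons x g z : oedges (rcons (x :: g) z) = rcons (oedges (x :: g)) (last x g, z).
Proof.
by elim: g x => // y g IH x; have := IH y; rewrite /oedges /= => ->.
Qed.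

Lemma oedges_ipath s j :
  oedges (ipath s j) = [seq (t.1, mv t) | t <- traject nx s j & ~~ rot t].
Proof.
elim: j => // j IH; rewrite ipathS trajectSr filter_rcons; case: ifP => _ //=.
by rewrite map_rcons -IH -rcons_cons oedges_rcons; have /= := ipath_last s.1 s j => ->.
Qed.

(* A path arriving at v from u and leaving towards w has all its right-boundary
   vertices at v in A; the direction of w is k + r + 1. *)
Definition turn u v w := exists k r, [/\ u = vadd v (dirv (k + 5)),
  w = vadd v (dirv (k + r + 1)), (r <= 4)%N & forall t, (t <= r)%N -> A (vadd v (dirv (k + t)))].

(** A [turn] in progress at the last vertex: since the arrival from u the cut edge has rotated from
    direction k to k + r, and the next move completes the turn. *)
Definition halfturn u (s : V * nat) := exists k r, [/\ u = vadd s.1 (dirv (k + 5)),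
  s.2 = (k + r) %% 6, (r <= 4)%N & forall t, (t <= r)%N -> A (vadd s.1 (dirv (k + t)))]%N.

Lemma ipath_turn s j : valid s ->
  (forall i, (i.+2 < size (ipath s j))%N -> turn (nth (0, 0) (ipath s j) i)
     (nth (0, 0) (ipath s j) i.+1) (nth (0, 0) (ipath s j) i.+2)) /\
  ((1 < size (ipath s j))%N -> halfturn (nth (0, 0) (ipath s j) (size (ipath s j)).-2) (iter j nx s)).
Proof.
move=> vs; elim: j => [|j [IH1 IH2]]; first by [].
have vj := iter_valid j vs; have lj := ipath_last (0, 0) s j.
have bj := ipath_bd (j := j) vs.
have vj1 := nx_valid vj.
rewrite ipathS iterS; set g := ipath s j in IH1 IH2 lj bj *; case: ifP => h.
  split=> // g1; have [k [r [e1 e2 r4 hA]]] := IH2 g1.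
  rewrite /nx h; exists k, r.+1; rewrite /= e2 modnDml -addnA addn1.
  have A1 : A (vadd (iter j nx s).1 (dirv (k + r.+1))).
    by move/asboolP: h; rewrite e2 dirv_modD -addnA addn1.
  split=> //.
    (* A fifth rotation would point back to the previous vertex of the path, which lies in [D]. *)
    rewrite ltn_neqAle r4 andbT; apply/eqP => r5; subst r.
    have /bj[] : nth (0, 0) g (size g).-2 \in g by apply: mem_nth; case: (size g) g1 => [|[|n]] //= _; lia.
    by rewrite e1 => Du _; exact: (DA Du A1).
  by move=> t; rewrite leq_eqVlt => /orP[/eqP -> //|]; rewrite ltnS => /hA.
have g0 : (0 < size g)%N by [].
rewrite size_rcons; split=> [i|].
  rewrite ltnS => ig; rewrite !nth_rcons.
  have -> : (i < size g)%N by lia.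
  have -> : (i.+1 < size g)%N by lia.
  case: ltnP => [/IH1 //|gi].
  have e : i.+2 = size g by apply/eqP; rewrite eqn_leq ig gi.
  rewrite e eqxx.
  have g1 : (1 < size g)%N by rewrite -e.
  have [k [r [e1 e2 r4 hA]]] := IH2 g1.
  have -> : nth (0, 0) g i.+1 = (iter j nx s).1 by rewrite -lj -nth_last -e.
  have -> : nth (0, 0) g i = nth (0, 0) g (size g).-2 by rewrite -e.
  by exists k, r; split=> //; rewrite /mv e2 dirv_modD.
move=> g2; rewrite nth_rcons [X in if X then _ else _](_ : _ = true); last by rewrite -[(size g).+1.-2]/((size g).-1) ltn_predL.
rewrite nth_last lj /nx h.
move: vj1; rewrite /nx h => -[/= D1 A1 k1].
exists ((iter j nx s).2 + 5)%N, 0%N; rewrite addn0; split=> //=.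
  by rewrite (_ : _ + 5 + 5 = (iter j nx s).2 + 1 + 3 + 6)%N ?dirvD6 ?dirv_back //; lia.
by move=> t; rewrite leqn0 => /eqP ->; rewrite addn0; rewrite dirv_mod in A1.
Qed.

(** Counterclockwise strictly between the backward direction k + 5 and the forward direction k + r +
    1 lie exactly k, ..., k + r, and these point into [A]. *)
Lemma rb_at_turn g i : ~~ is_circuit g ->
  turn (nth (0, 0) g i.-1) (nth (0, 0) g i) (nth (0, 0) g i.+1) ->
  (0 < size (rb_at g i))%N /\ forall u, u \in rb_at g i -> A u.
Proof.
move=> /negbTE nc [k [r [e1 e2 r4 hA]]]; rewrite /rb_at /pprev /pnext nc e1 e2 !dir_indexE.
have -> : (((k + r + 1) %% 6 + 11 - (k + 5) %% 6) %% 6 = r.+1)%N.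
  rewrite -[in X in (X + _)%N]addnA -modnDml -[X in (_ - X)%N]modnDml.
  move: (ltn_pmod k (isT : (0 < 6)%N)) r4.
  by case: (k %% 6)%N => [|[|[|[|[|[|?]]]]]] // _; case: r {e2 hA} => [|[|[|[|[|?]]]]].
rewrite size_map size_iota; split=> // u /mapP[j]; rewrite mem_iota => /andP[j1 j2] ->.
rewrite dirv_modD (_ : (k + 5 + j = k + j.-1 + 6)%N); last by lia.
by rewrite dirvD6; apply: hA; lia.
Qed.

(** The interface started at x and stopped at its first visit to y, with [A] on its right.
    Right-boundary vertices are in [A] and path vertices in [D], so the two are disjoint. *)
Lemma interface_path x y : inner_bd x -> inner_bd y -> x != y ->
  exists g, [/\ path_from_to g x y, forall v, v \in g -> inner_bd v, rightmost g
    & forall u, u \in rbound g -> A u].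
Proof.
move=> bx by_ xy; have [Dx [u Au /adjbP[k0 eu]]] := bx.
pose s := (x, k0 %% 6)%N.
have vs : valid s by split=> //=; [rewrite dirv_mod -eu|rewrite ltn_pmod].
have ex : exists j, (iter j nx s).1 == y by have [j <-] := orbit_full vs by_; exists j.
case: (ex_minnP ex) => j /eqP ej jmin.
have jmin' i : (i < j)%N -> (iter i nx s).1 != y.
  by move=> ij; apply/negP => /jmin; rewrite leqNgt ij.
(* A repeated state would give an earlier visit to y. *)
have uj : uniq (traject nx s j).
  case: j jmin' ej {jmin} => // j jmin' ej; rewrite looping_uniq; apply/negP.
  move=> /trajectP[i ij e]; have := jmin' i.+1 ij.
  by rewrite /= -e -iterS ej eqxx.
set g := ipath s j.
have gp : path_from_to g x y by split; [exact: ipath_lat|rewrite -ej -(ipath_last x)].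
have nc : is_circuit g = false.
  rewrite /is_circuit; apply/negP => /andP[_].
  by rewrite /plen nth_last ipath_last ej (negbTE xy).
have ginn : inner_idx g = iota 1 (plen g).-1 by rewrite /inner_idx nc.
have rbg i : i \in inner_idx g -> (0 < size (rb_at g i))%N /\ forall u, u \in rb_at g i -> A u.
  rewrite ginn mem_iota => /andP[i1 i2]; apply: rb_at_turn; first by rewrite nc.
  have [+ _] := ipath_turn j vs; move=> /(_ i.-1); rewrite prednK //; apply.
  by rewrite -/g; move: i2; rewrite /plen; lia.
have rbA v : v \in rbound g -> A v.
  by move=> /flattenP[l /mapP[i /rbg[_ h] ->]]; exact: h.
exists g; split=> //; first exact: ipath_bd.
apply/and3P; split; last by apply/allP => i /rbg[].
- rewrite /simple_path oedges_ipath map_inj_in_uniq ?filter_uniq // => t t'.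
  rewrite !mem_filter => /andP[_ /trajectP[i _ ->]] /andP[_ /trajectP[i' _ ->]].
  have [_ _ +] := iter_valid i vs; have [_ _ +] := iter_valid i' vs.
  case: (iter i nx s) => v k; case: (iter i' nx s) => v' k' /= k6 k6' [->].
  move=> /addrI e1 /addrI e2.
  have /eqP : dirv (k + 1) = dirv (k' + 1).
    by rewrite [LHS]surjective_pairing e1 e2 -surjective_pairing.
  by rewrite dirv_eq -[(_ == _ %[mod _])%N]/((_ %% _)%N == _) eqn_modDr !modn_small // => /eqP ->.
- apply/allP => v /rbA Av; apply/negP => /(ipath_bd vs)[] /DA; exact.
Qed.

End Interface.

(** * Max-norm balls and L-shaped paths *)

Definition vnorm (v : V) : nat := maxn `|v.1|%N `|v.2|%N.

Definition vopp (v : V) : V := (- v.1, - v.2).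

Definition vsub (u v : V) : V := (u.1 - v.1, u.2 - v.2).

Lemma adjb_bounds u v : adjb u v ->
  [/\ u.1 - 1 <= v.1, v.1 <= u.1 + 1, u.2 - 1 <= v.2 & v.2 <= u.2 + 1].
Proof. by case: u v => a b [c d]; rewrite adjbE /= => h; split; lia. Qed.

Lemma adjb_vnorm u v : adjb u v -> (vnorm v <= (vnorm u).+1)%N.
Proof. by case: u v => a b [c d]; rewrite adjbE /vnorm /=; lia. Qed.

Lemma line_path u k n : exists s, [/\ path adjb u s,
  last u s = (u.1 + n%:Z * (dirv k).1, u.2 + n%:Z * (dirv k).2), size s = n
  & forall x, x \in u :: s -> exists2 i, (i <= n)%N &
      x = (u.1 + i%:Z * (dirv k).1, u.2 + i%:Z * (dirv k).2)].
Proof.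
elim: n => [|n [s [p l sz h]]].
  exists [::]; split=> //=; first by case: u => a b; rewrite !mul0r !addr0.
  move=> x; rewrite inE => /eqP ->; exists 0%N => //.
  by case: u => a b; rewrite !mul0r !addr0.
set z := (u.1 + n.+1%:Z * (dirv k).1, u.2 + n.+1%:Z * (dirv k).2).
exists (rcons s z); split.
- rewrite rcons_path p l /=; apply/adjbP; exists k; rewrite /z /vadd /=.
  by congr pair; rewrite intS mulrDl mul1r addrA addrAC.
- by rewrite last_rcons.
- by rewrite size_rcons sz.
- move=> x; rewrite -rcons_cons mem_rcons inE => /orP[/eqP ->|/h[i i1 ->]].
    by exists n.+1.
  by exists i => //; exact: leqW.
Qed.

Definition between (a b c : int) := (a <= c <= b) || (b <= c <= a).

(** The L-shaped path, second coordinate first. Its explicit trace reduces membership in boxes,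
    half-planes and strips to linear arithmetic. *)
Lemma lpath (u v : V) : exists s, [/\ path adjb u s, last u s = v,
  size s = (`|u.1 - v.1| + `|u.2 - v.2|)%N
  & forall x, x \in u :: s -> (x.1 = u.1 /\ between u.2 v.2 x.2) \/
                              (x.2 = v.2 /\ between u.1 v.1 x.1)].
Proof.
case: u v => a b [c d]; rewrite /between.
pose k1 := if b <= d then 1%N else 4%N; pose k2 := if a <= c then 0%N else 3%N.
have [s [p l sz h]] := line_path (a, b) k1 `|b - d|%N.
have el : last (a, b) s = (a, d).
  by rewrite l /k1; case: ifP => bd /=; congr pair; lia.
have [t [q m tz k]] := line_path (a, d) k2 `|a - c|%N.
have em : last (a, d) t = (c, d).
  by rewrite m /k2; case: ifP => bd /=; congr pair; lia.
exists (s ++ t); rewrite cat_path last_cat size_cat p el q em sz tz addnC; split=> //= x.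
rewrite -cat_cons mem_cat => /orP[/h|xt].
  case=> i i1 ->; left; rewrite /= /k1; case: ifP => bd /=; split; lia.
have /k [i i1 ->] : x \in (a, d) :: t by rewrite inE xt orbT.
right; rewrite /= /k2; case: ifP => bd /=; split; lia.
Qed.

Lemma lpath_conn (S : V -> Prop) u v :
  (forall x, (x.1 = u.1 /\ between u.2 v.2 x.2) \/ (x.2 = v.2 /\ between u.1 v.1 x.1) -> S x) ->
  conn S u v.
Proof.
by move=> h; have [s [p l _ k]] := lpath u v; apply/connP; exists s; split=> // x /k /h.
Qed.

Lemma outside_conn (r : nat) u v : (r < vnorm u)%N -> (r < vnorm v)%N ->
  conn (fun z => (r < vnorm z)%N) u v.
Proof.
have H z : (r < vnorm z)%N -> conn (fun z => (r < vnorm z)%N) z (r.+1%:Z, r.+1%:Z).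
  case: z => a b; rewrite /vnorm /= => ab.
  case: (ltnP r `|a|%N) => ra; first by apply: lpath_conn => -[c d]; rewrite /between /=; lia.
  apply: (@conn_trans _ (r.+1%:Z, b)); apply: lpath_conn => -[c d]; rewrite /between /=; lia.
by move=> /H hu /H hv; apply: (conn_trans hu); exact: conn_sym.
Qed.

Lemma Tpath_count w g : Tpath w g = count w g.
Proof. by rewrite /Tpath; elim: g => [|a g IH]; rewrite ?big_nil ?big_cons //= IH. Qed.

Lemma conn_uniq S u v : conn S u v -> exists s,
  [/\ path adjb u s, last u s = v, uniq (u :: s) & forall x, x \in u :: s -> S x].
Proof.
move=> /connP[s [p l h]].
case/shortenP: p l h => s' p' us' sub l h; exists s'; split=> // x.
by rewrite inE => /orP[/eqP ->|/sub xs]; apply: h; rewrite inE ?eqxx // xs orbT.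
Qed.

Lemma count_sub_undup (T : eqType) (w : T -> bool) (g l : seq T) :
  uniq g -> {subset g <= l} -> (count w g <= size (undup (seq.filter w l)))%N.
Proof.
move=> ug sub; rewrite -size_filter; apply: uniq_leq_size; first exact: filter_uniq.
by move=> x; rewrite mem_undup !mem_filter => /andP[-> /sub].
Qed.

Lemma path_conn (S : V -> Prop) a l : path adjb a l -> (forall z, z \in a :: l -> S z) ->
  forall u, u \in a :: l -> conn S a u.
Proof.
elim: l a => [|b l IH] a /=.
  by move=> _ h u; rewrite inE => /eqP ->; apply: conn_refl; apply: h; exact: mem_head.
move=> /andP[ab pl] h u; rewrite inE => /orP[/eqP ->|ul].
  by apply: conn_refl; apply: h; exact: mem_head.
apply: (@conn_trans _ b); last by apply: IH => // z zl; apply: h; rewrite inE zl orbT.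
by apply: conn_adj => //; apply: h; rewrite !inE eqxx ?orbT.
Qed.

Lemma dirv_turn_back k : vadd (dirv k) (dirv (k + 3 + 1)) = dirv (k + 5).
Proof. by rewrite -addnA -!(dirv_modD k) -(dirv_mod k); dirv_cases k. Qed.

Lemma rightmost_lower w g x y : path_from_to g x y -> rightmost g ->
  exists2 g', path_from_to g' x y & (Tpath w g' <= bcount w g + 2)%N.
Proof.
move=> pg rg; have /path_from_toP [s [eg p l]] := pg.
have w1 z : (w z <= 1)%N by case: (w z).
case: (eqVneq x y) => [exy|xy].
  exists [:: x]; first by apply/path_from_toP; exists [::].
  by rewrite Tpath_count /= addn0 addn2 (leq_trans (w1 x)).
have nc : is_circuit g = false.
  by rewrite /is_circuit; apply/negP => /andP[_]; rewrite /plen nth_last eg /= l (negbTE xy).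
pose G i := nth (0, 0) g i; pose n := plen g.
have Gn : G n = y by rewrite /G /n /plen nth_last eg.
have G0 : G 0%N = x by rewrite /G eg.
have sn : n = size s by rewrite /n /plen eg.
case: (leqP n 1) => n1.
  exists g => //; rewrite Tpath_count (leq_trans (count_size _ _)) // eg /= -sn; lia.
have Gadj i : (i < n)%N -> adjb (G i) (G i.+1).
  by move=> i_n; rewrite /G eg; apply: (pathP (0, 0) p); rewrite -sn.
pose c i := dir_index (G i) (G i.+1).
have cP i : (i < n)%N -> G i.+1 = vadd (G i) (dirv (c i)).
  move=> /Gadj /adjbP[k e]; rewrite /c e dir_indexE dirv_mod.
  by [].
(* [q i] is the common neighbour of v_i and v_(i+1) to the right of the edge: the first
   right-boundary vertex at v_(i+1), and [q i.+1] is the last one there. *)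
pose q i := vadd (G i) (dirv (c i + 5)).
pose RB v := v \in rbound g.
have inn : inner_idx g = iota 1 n.-1 by rewrite /inner_idx nc.
have qq i : (i.+1 < n)%N -> conn RB (q i) (q i.+1).
  move=> i_n; have i_n' : (i < n)%N by apply: ltnW.
  have ii : i.+1 \in inner_idx g by rewrite inn mem_iota /=; lia.
  have sz : (0 < size (rb_at g i.+1))%N by case/and3P: rg => _ _ /allP /(_ _ ii).
  have sub u : u \in rb_at g i.+1 -> RB u.
    by move=> ui; apply/flattenP; exists (rb_at g i.+1) => //; apply/mapP; exists i.+1.
  move: sz sub; rewrite /rb_at /pprev /pnext nc -!/(G _) /= -/(c i.+1).
  have -> : dir_index (G i.+1) (G i) = ((c i + 3) %% 6)%N.
    by rewrite -[in X in dir_index _ X](dirv_back (G i) (c i)) -cP // dir_indexE.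
  set m := ((c i.+1 + 11 - (c i + 3) %% 6) %% 6)%N; rewrite size_map size_iota => m0 sub.
  have hm j : (0 < j <= m)%N -> RB (vadd (G i.+1) (dirv (c i + 3 + j))).
    move=> /andP[j0 jm]; apply: sub; apply/mapP; exists j; first by rewrite mem_iota add1n ltnS j0 jm.
    by rewrite dirv_modD.
  have q1 : q i = vadd (G i.+1) (dirv (c i + 3 + 1)).
    by rewrite (cP i) // /q -vaddA dirv_turn_back.
  have qm : q i.+1 = vadd (G i.+1) (dirv (c i + 3 + m)).
    rewrite /q; congr vadd; apply/eqP; rewrite dirv_eq /m modnDmr.
    have := ltn_pmod (c i + 3) (isT : (0 < 6)%N) => h6.
    rewrite -(modnDml (c i + 3)) (_ : (_ + (_ - _) = c i.+1 + 5 + 6)%N); last by lia.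
    by rewrite modnDr.
  have : conn RB (vadd (G i.+1) (dirv (c i + 3 + 1))) (vadd (G i.+1) (dirv (c i + 3 + m))).
    elim: (m) m0 hm => // -[|m'] IH _ hm; first by apply: conn_refl; exact: hm.
    apply: conn_step; first by apply: IH => // j jm; apply: hm; lia.
      by apply: hm; lia.
    rewrite adjb_vadd; apply/adjbP; exists (c i + 3 + m'.+1 + 2)%N.
    by rewrite -dirvSS; congr dirv; lia.
  by rewrite -q1 -qm.
have n1' : (n.-1 < n)%N by lia.
have qall : conn RB (q 0%N) (q n.-1).
  elim: (n.-1) n1' => [_|j IH jn]; first by have [h _] := conn_in (qq 0%N n1); exact: conn_refl.
  by apply: (conn_trans (IH (ltnW jn))); exact: qq.
(* [bcount] counts a vertex once however often it occurs, so the walk is made self-avoiding before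
   its open vertices are counted. *)
have [t [pt lt ut ht]] := conn_uniq qall.
have aq k : adjb (dirv (k + 5)) (dirv k).
  apply/adjbP; exists (k + 5 + 2)%N; rewrite -dirvSS (_ : (k + 5 + 1 = k + 6)%N) ?dirvD6 //; lia.
exists (x :: rcons (q 0%N :: t) y).
  apply/path_from_toP; exists (rcons (q 0%N :: t) y); split=> //; last by rewrite last_rcons.
  rewrite /= rcons_path pt lt /= -{1}G0 {1}/q adjb_dirv /=.
  by rewrite -Gn -(prednK (ltnW n1)) /= cP // /q adjb_vadd aq.
rewrite Tpath_count /= -cats1 count_cat /= addn0.
have H := count_sub_undup w ut ht; rewrite -/(bcount w g) /= in H.
have E (a1 a2 a3 a4 e : nat) : (a2 + a3 <= e)%N -> (a1 <= 1)%N -> (a4 <= 1)%N -> (a1 + (a2 + (a3 + a4)) <= e + 2)%N by lia.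
exact: (E _ _ _ _ _ H (w1 x) (w1 y)).
Qed.

(** The interface between [A] and the component [D] of its complement containing x is open because a
    closed vertex next to [A] would belong to [A]. Its cost is at most [count w I] because all open
    vertices of [A] lie on I. *)
Lemma interface_upper (w : V -> bool) (x y : V) (I : seq V) :
  x != y -> w x -> w y -> x \notin I -> y \notin I -> (0 < size I)%N ->
  path adjb x (rcons I y) ->
  (forall v, ~~ w v -> exists l : seq V, forall u, conn (fun z => ~~ w z) v u -> u \in l) ->
  (forall z r, z = x \/ z = y -> exists2 u, conn (fun v => w v /\ v \notin I) z u & (r < vnorm u)%N) ->
  exists g, [/\ path_from_to g x y, all w g, rightmost g & (bcount w g <= count w I)%N].
Proof.
move=> xy wx wy; case: I => [//|a l] xI yI _ pI fin arm.
(* Paths in [S u] go from u through closed vertices, so [A] also absorbs the closed clusters that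
   are merely adjacent to I. *)
pose S u z := z = u \/ ~~ w z.
pose A v := exists2 u, u \in a :: l & conn (S u) u v.
have AI u : u \in a :: l -> A u by move=> uI; exists u => //; apply: conn_refl; left.
have Aopen v : A v -> w v -> v \in a :: l.
  by move=> Av; case: Av => u uI cu; have [_ +] := conn_in cu; rewrite /S => -[-> //|/negbTE ->].
have AconnI u v : u \in a :: l -> conn (S u) u v -> A v /\ conn A u v.
  move=> uI h; suff [] : conn (S u) u v /\ conn A u v by move=> h1 h2; split=> //; exists u.
  apply: (conn_ind (P := fun v => conn (S u) u v /\ conn A u v) _ _ h).
    by split; apply: conn_refl; [left|exact: AI].
  move=> a1 b1 [c1 c2] Sa Sb ab; have c3 := conn_step c1 Sb ab.
  by split=> //; apply: conn_step ab => //; exists u.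
move: pI => /= /andP[xa]; rewrite rcons_path => /andP[pl ly].
have Aa u : u \in a :: l -> conn A a u.
  by apply: path_conn => // z; exact: AI.
have Aconn u v : A u -> A v -> conn A u v.
  move=> [u0 u0I /AconnI cu] [v0 v0I /AconnI cv].
  have [_ cu'] := cu u0I; have [_ cv'] := cv v0I.
  apply: conn_trans (conn_sym cu') _; apply: conn_trans (conn_sym (Aa _ u0I)) _.
  exact: conn_trans (Aa _ v0I) cv'.
have [v|cl clP] := @choice V (seq V) (fun v l => ~~ w v ->
    forall u, conn (fun z => ~~ w z) v u -> u \in l).
  by case: (boolP (w v)) => wv; [exists [::]|have [l' hl] := fin v wv; exists l'].
pose sA := (a :: l) ++ flatten [seq flatten [seq cl (vadd u (dirv k)) | k <- iota 0 6] | u <- a :: l].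
have AsA v : A v -> v \in sA.
  move=> [u uI h]; rewrite mem_cat.
  suff [->|[k wk ck]] : v = u \/ exists2 k, ~~ w (vadd u (dirv k)) & conn (fun z => ~~ w z) (vadd u (dirv k)) v.
  - by rewrite uI.
  - apply/orP; right; apply/flattenP; exists (flatten [seq cl (vadd u (dirv k)) | k <- iota 0 6]).
      by apply/mapP; exists u.
    apply/flattenP; exists (cl (vadd u (dirv k))); last exact: clP.
    by apply/mapP; exists (k %% 6)%N; rewrite ?dirv_mod // mem_iota ltn_pmod.
  apply: (conn_ind (P := fun v => v = u \/ exists2 k, ~~ w (vadd u (dirv k)) & conn (fun z => ~~ w z) (vadd u (dirv k)) v) _ _ h).
    by left.
  move=> z z' Pz Sz [->|wz'] zz'; first by left.
  case: Pz => [ez|[k wk ck]].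
    right; move: zz'; rewrite ez => /adjbP[k ek]; subst z'; exists k => //.
    exact: conn_refl.
  by right; exists k => //; exact: conn_step zz'.
pose D v := conn (fun z => ~ A z) x v.
have DA v : D v -> A v -> False by move=> cv; case: (conn_in cv).
have Dcl u v : D u -> adjb u v -> ~ A v -> D v by move=> Du uv nv; exact: conn_step uv.
have nA z : w z -> z \notin a :: l -> ~ A z by move=> wz zI /Aopen /(_ wz); rewrite (negbTE zI).
have Dx : D x by apply: conn_refl; exact: nA.
have Dconn u v : D u -> D v -> conn D u v.
  have H z : D z -> conn D x z.
    move=> h; suff [] : D z /\ conn D x z by [].
    apply: (conn_ind (P := fun z => D z /\ conn D x z) _ _ h); first by split=> //; exact: conn_refl.
    move=> z1 z2 [D1 c1] A1 A2 z12; have D2 := Dcl _ _ D1 z12 A2.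
    by split=> //; exact: conn_step z12.
  by move=> /H hu /H hv; exact: conn_trans (conn_sym hu) hv.
(* Past radius r there is nothing of [A], and the arms of x and y can be joined there; this puts y
   in [D]. *)
pose r := \max_(v <- sA) vnorm v.
have Ar v : (r < vnorm v)%N -> ~ A v.
  by move=> rv /AsA vs; move: rv; rewrite ltnNge => /negP; apply; apply: leq_bigmax_seq.
have sub v : w v /\ v \notin a :: l -> ~ A v by case; exact: nA.
have Dy : D y.
  have [z1 /(conn_sub sub) c1 r1] := arm x r (or_introl erefl).
  have [z2 /(conn_sub sub) c2 r2] := arm y r (or_intror erefl).
  apply: conn_trans c1 _; apply: conn_trans (conn_sym c2).
  exact: conn_sub Ar (outside_conn r1 r2).
have bx : inner_bd A D x by split=> //; exists a => //; apply: AI; exact: mem_head.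
have by_ : inner_bd A D y.
  by split=> //; exists (last a l); [apply: AI; exact: mem_last|rewrite adjb_sym].
have [g [pg hg rg rbg]] := interface_path DA Dcl Dconn Aconn AsA bx by_ xy.
exists g; split=> //.
  apply/allP => v /hg[Dv [u [u0 u0I cu] vu]]; apply/negP => /negP nw; apply: (DA _ Dv).
  by exists u0 => //; apply: conn_step cu _ _; [right|rewrite adjb_sym].
rewrite -[X in (_ <= X)%N]/(count w (a :: l)) /bcount -size_filter; apply: uniq_leq_size; first exact: undup_uniq.
by move=> v; rewrite mem_undup !mem_filter => /andP[wv /rbg /Aopen -> //]; rewrite wv.
Qed.

(** Let [C] be the right half-plane together with the trapped cluster [Q]. The boundary of the
    component of its complement containing (-1, r) is connected and also contains (-1, -r). Off the
    line of first coordinate -1 it touches [Q], hence is closed; on that line it avoids the heights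
    of absolute value at most K. An excursion from the upper half-line to the lower one gives the
    closed path. *)
Lemma halfplane_dual (w : V -> bool) (K r : nat) : (0 < K < r)%N ->
  (forall v, conn (fun v => v.1 < 0 /\ (w v || (vnorm v <= K)%N)) (-1, 0) v -> (vnorm v < r)%N) ->
  exists (j : nat) (z z' : V), [/\ (K < j <= r.+1)%N, adjb (-1, j%:Z) z, z'.2 <= 0
    & conn (fun v => ~~ w v) z z'].
Proof.
move=> /andP[K0 Kr] Qr.
set Q := conn _ (-1, 0) in Qr *.
have Q0 (j : int) : (`|j| <= K)%N -> Q (-1, j).
  by move=> jK; apply: lpath_conn => -[a b]; rewrite /between /vnorm /=; lia.
pose C v := 0 <= v.1 \/ Q v.
pose D v := conn (fun z => ~ C z) (-1, r%:Z) v.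
have nC v : v.1 < 0 -> (r <= vnorm v)%N -> ~ C v.
  by move=> v0 vr [|/Qr]; [rewrite leNgt v0|rewrite ltnNge vr].
have D1 : D (-1, r%:Z) by apply: conn_refl; apply: nC => //; rewrite /vnorm /=; lia.
have D2 : D (-1, - r%:Z).
  apply: (@conn_trans _ (- r%:Z, r%:Z)).
    by apply: lpath_conn => -[a b] h; apply: nC; move: h; rewrite /between /vnorm /=; lia.
  apply: (@conn_trans _ (- r%:Z, - r%:Z)).
    by apply: lpath_conn => -[a b] h; apply: nC; move: h; rewrite /between /vnorm /=; lia.
  by apply: lpath_conn => -[a b] h; apply: nC; move: h; rewrite /between /vnorm /=; lia.
have DC v : D v -> C v -> False by move=> h; case: (conn_in h).
have Dcl u v : D u -> adjb u v -> ~ C v -> D v by move=> Du uv nv; exact: conn_step uv.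
have Dconn u v : D u -> D v -> conn D u v.
  have H z : D z -> conn D (-1, r%:Z) z.
    move=> h; suff [] : D z /\ conn D (-1, r%:Z) z by [].
    apply: (conn_ind (P := fun z => D z /\ conn D (-1, r%:Z) z) _ _ h).
      by split=> //; exact: conn_refl.
    move=> z1 z2 [E1 c1] A1 A2 z12; have E2 := Dcl _ _ E1 z12 A2.
    by split=> //; exact: conn_step z12.
  by move=> /H hu /H hv; exact: conn_trans (conn_sym hu) hv.
have Cconn u v : C u -> C v -> conn C u v.
  have H z : C z -> conn C (0, 0) z.
    case=> [z0|h].
      case: z z0 => z1 z2 /= z0; apply: lpath_conn => -[a b] h; left; move: h; rewrite /between /=; lia.
    suff [] : Q z /\ conn C (0, 0) z by [].
    apply: (conn_ind (P := fun z => Q z /\ conn C (0, 0) z) _ _ h).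
      split; first exact: Q0.
      apply: conn_adj; [by left|right; exact: Q0|by rewrite adjbE].
    move=> z1 z2 [E1 c1] A1 A2 z12; have E2 := conn_step E1 A2 z12.
    by split=> //; apply: conn_step z12 => //; right.
  by move=> /H hu /H hv; exact: conn_trans (conn_sym hu) hv.
have b1 : inner_bd C D (-1, r%:Z).
  by split=> //; exists (0, r%:Z); [left|rewrite adjbE /=; lia].
have b2 : inner_bd C D (-1, - r%:Z).
  by split=> //; exists (0, - r%:Z); [left|rewrite adjbE /=; lia].
have neg v : inner_bd C D v -> v.1 < 0.
  by case=> Dv _; rewrite ltNge; apply/negP => v0; apply: (DC v Dv); left.
have line v : inner_bd C D v -> v.1 = -1 -> (K < `|v.2|)%N.
  case: v => a b [Dv _] /= ea; rewrite ltnNge; apply/negP => bK; apply: (DC _ Dv).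
  by right; rewrite ea; exact: Q0.
have far v : inner_bd C D v -> v.1 < -1 -> ~~ w v /\ (vnorm v <= r)%N.
  case=> Dv [u Cu vu] v1.
  have Qu : Q u by case: Cu => // u0; have [_ h _ _] := adjb_bounds vu; move: (le_trans u0 h); lia.
  split; last by rewrite adjb_sym in vu; exact: leq_trans (adjb_vnorm vu) (Qr _ Qu).
  apply/negP => wv; apply: (DC _ Dv); right; apply: conn_step Qu _ _.
    by rewrite wv; split=> //; lia.
  by rewrite adjb_sym.
set goal := exists j z z', _.
have := inner_bd_conn DC Dcl Dconn Cconn b1 b2.
(* A boundary walk is on the upper half-line ([top]) or on a closed excursion that left it ([clo]).
   An excursion that comes back at a negative height does so from a vertex of height at most 0,
   which is the goal. *)
pose top (v : V) := exists2 j : nat, (K < j)%N & v = (-1, j%:Z).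
pose clo (v : V) := exists (j : nat) z, [/\ (K < j <= r.+1)%N, adjb (-1, j%:Z) z
  & conn (fun v => ~~ w v) z v].
move=> h; suff [//|[[j jK [] ]|[j [z [jK zj c]]]]] : goal \/ top (-1, - r%:Z) \/ clo (-1, - r%:Z).
- lia.
- by exists j, z, (-1, - r%:Z); split=> //=; lia.
apply: (conn_ind (P := fun v => goal \/ top v \/ clo v) _ _ h).
  by right; left; exists r.
move=> z y + bz by_ zy; case=> [|[[j jK ez]|[j [z0 [jK z0j c]]]]]; first by left.
  subst z; case: (ltP y.1 (-1)) => y1.
    right; right; have [wy yr] := far _ by_ y1; exists j, y; split=> //; last exact: conn_refl.
    rewrite jK /=; case: y {by_ y1 wy} zy yr => a b; rewrite adjbE /vnorm /=; lia.
  have e : y.1 = -1 by have := neg _ by_; lia.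
  right; left; exists `|y.2|%N; first exact: line.
  have := line _ by_ e; move: zy; case: y {by_ y1} e => a b /= -> ; rewrite adjbE /= => zy yK.
  by congr pair; lia.
case: (ltP y.1 (-1)) => y1.
  right; right; have [wy yr] := far _ by_ y1; exists j, z0; split=> //.
  exact: conn_step zy.
have e : y.1 = -1 by have := neg _ by_; lia.
have lK := line _ by_ e.
case: (leP 0 y.2) => y2.
  right; left; exists `|y.2|%N => //; case: y e y2 {zy by_ y1 lK} => a b /= -> b0.
  by congr pair; lia.
left; exists j, z0, z; split=> //; have [_ _ h1 _] := adjb_bounds zy; lia.
Qed.

(** * Finite-range events of Bernoulli site percolation *)

Definition dep (S : V -> Prop) (Q : (V -> bool) -> Prop) : Prop :=
  forall w w', (forall v, S v -> w v = w' v) -> Q w -> Q w'.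

Definition bdd (S : V -> Prop) : Prop := exists r, forall v, S v -> (vnorm v <= r)%N.

Definition upd (w : V -> bool) (v : V) (b : bool) : V -> bool :=
  fun u => if u == v then b else w u.

Definition int_range (r : nat) : seq int := [seq (i%:Z - r%:Z) | i <- iota 0 (r.*2.+1)].

Lemma mem_int_range r a : (a \in int_range r) = (`|a| <= r)%N.
Proof.
apply/mapP/idP => [[i]|ar]; first by rewrite mem_iota => ? ->; lia.
by exists (absz (a + r%:Z)); [rewrite mem_iota; lia|lia].
Qed.

Definition box (r : nat) : seq V := allpairs pair (int_range r) (int_range r).

Lemma mem_box r v : (v \in box r) = (vnorm v <= r)%N.
Proof.
case: v => a b; apply/allpairsP/idP => [[[c d] /= [+ + [-> ->]]]|h].
  by rewrite !mem_int_range /vnorm /=; lia.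
by exists (a, b); split=> //; rewrite mem_int_range; move: h; rewrite /vnorm /=; lia.
Qed.

Lemma bdd_seq S : bdd S -> exists2 s : seq V, uniq s & forall v, S v <-> v \in s.
Proof.
move=> [r h]; exists (seq.filter (fun v => `[< S v >]) (undup (box r))).
  exact: filter_uniq (undup_uniq _).
move=> v; rewrite mem_filter mem_undup mem_box; split=> [Sv|/andP[/asboolP//]].
by rewrite asboolT //= h.
Qed.

Section FiniteEvents.
Context {R : realType} (p : R).

(* Probability of Q when the sites of s are resampled and all others are as in w. *)
Fixpoint pr (s : seq V) (Q : (V -> bool) -> Prop) (w : V -> bool) : R :=
  if s is v :: s' then p * pr s' Q (upd w v true) + (1 - p) * pr s' Q (upd w v false)
  else (`[< Q w >])%:R.

Lemma pr_agree s (S : V -> Prop) Q w w' : dep S Q ->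
  (forall v, S v -> v \notin s -> w v = w' v) -> pr s Q w = pr s Q w'.
Proof.
move=> dQ; elim: s w w' => [|v s IH] w w' /= h.
  have e : Q w <-> Q w' by split; apply: dQ => u Su; [rewrite h|rewrite -h].
  by rewrite (asbool_equiv_eq e).
have H b : pr s Q (upd w v b) = pr s Q (upd w' v b).
  apply: IH => u Su us; rewrite /upd; case: eqP => // /eqP uv.
  by apply: h; rewrite // inE negb_or uv us.
by rewrite !H.
Qed.

Lemma pr_and0 s S Q1 Q2 w : dep S Q1 -> (forall v, S v -> v \notin s) ->
  pr s (fun w => Q1 w /\ Q2 w) w = (`[< Q1 w >])%:R * pr s Q2 w.
Proof.
move=> dQ h; elim: s h w => [|v s IH] h w /=.
  by rewrite asbool_and; case: `[< Q1 w >]; rewrite ?mul1r ?mul0r.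
have H b : `[< Q1 (upd w v b) >] = `[< Q1 w >].
  apply: asbool_equiv_eq; split; apply: dQ => u /h; rewrite inE negb_or /upd => /andP[/negbTE ->//].
have h' u : S u -> u \notin s by move=> /h; rewrite inE negb_or => /andP[].
by rewrite !IH // !H; ring.
Qed.

Lemma pr_and s1 s2 S1 S2 Q1 Q2 w : dep S1 Q1 -> dep S2 Q2 ->
  (forall v, S1 v -> v \notin s2) -> (forall v, S2 v -> v \notin s1) ->
  pr (s1 ++ s2) (fun w => Q1 w /\ Q2 w) w = pr s1 Q1 w * pr s2 Q2 w.
Proof.
move=> d1 d2 h1; elim: s1 w => [|v s IH] w h2 /=; first exact: pr_and0 d1 _.
have h u : S2 u -> u \notin s by move=> /h2; rewrite inE negb_or => /andP[].
have H b : pr s2 Q2 (upd w v b) = pr s2 Q2 w.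
  apply: pr_agree d2 _ => u /h2; rewrite inE negb_or /upd => /andP[/negbTE -> //].
by rewrite !IH // !H; ring.
Qed.

Context {d : measure_display} {Om : measurableType d} (P : probability Om R) (X : Om -> V -> bool).
Hypothesis perc : site_percolation P X p.

Lemma measurable_coord v b : measurable [set om | X om v = b].
Proof.
have [m _] := perc; case: b; first exact: m.
rewrite (_ : [set om | _] = ~` [set om | X om v]); first exact/measurableC/m.
by apply/seteqP; split=> om /= ; case: (X om v).
Qed.

Lemma measurable_cyl (t : seq V) (a : V -> bool) : measurable [set om | forall v, v \in t -> X om v = a v].
Proof.
elim: t => [|v t IH].
  by rewrite (_ : [set om | _] = setT) //; apply/seteqP; split.
rewrite (_ : [set om | _] = [set om | X om v = a v] `&` [set om | forall v, v \in t -> X om v = a v]).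
  exact: measurableI (measurable_coord _ _) IH.
apply/seteqP; split=> om /= h.
  by split=> [|u ut]; apply: h; rewrite inE ?eqxx // ut orbT.
by move=> u; rewrite inE => /orP[/eqP ->|]; case: h => // h1; apply.
Qed.

(** By induction on s, the next site joins the prescribed sites t with each of its two values. For
    empty t this identifies the probability of Q with the recursive expression [pr], so that
    independence becomes algebra. *)
Lemma cyl_event (s t : seq V) (S : V -> Prop) (Q : (V -> bool) -> Prop) (a : V -> bool) : dep S Q -> uniq (t ++ s) ->
  (forall v, S v -> v \in t ++ s) ->
  let E := [set om | (forall v, v \in t -> X om v = a v) /\ Q (X om)] in
  measurable E /\ P E = (\prod_(v <- t) (if a v then p else 1 - p) * pr s Q a)%:E.
Proof.
move=> dQ; elim: s t a => [|v s IH] t a u h E /=.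
  rewrite cats0 in u h.
  case: (pselect (Q a)) => Qa.
    have -> : E = [set om | forall v, v \in t -> X om v = a v].
      apply/seteqP; split=> om /=; first by case.
      by move=> H; split=> //; apply: dQ Qa => v /h /H.
    by rewrite asboolT // mulr1; split; [exact: measurable_cyl|exact: (perc.2)].
  have -> : E = set0.
    apply/seteqP; split=> om //= -[H Qom]; apply: Qa; apply: dQ Qom => v /h /H //.
  by rewrite asboolF // mulr0 measure0.
pose F b := [set om | (forall u, u \in rcons t v -> X om u = upd a v b u) /\ Q (X om)].
have u' : uniq (rcons t v ++ s) by rewrite cat_rcons.
have h' w : S w -> w \in rcons t v ++ s by rewrite cat_rcons; exact: h.
have vt : v \notin t by move: u; rewrite -cat_rcons cat_uniq rcons_uniq -andbA => /andP[].
have HF b : measurable (F b) /\ P (F b) =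
    (\prod_(v <- t) (if a v then p else 1 - p) * ((if b then p else 1 - p) * pr s Q (upd a v b)))%:E.
  have [m1 m2] := IH (rcons t v) (upd a v b) u' h'; split=> //; rewrite m2; congr EFin.
  rewrite -cats1 big_cat big_seq1 /= {2}/upd eqxx -mulrA; congr (_ * _).
  rewrite big_seq [RHS]big_seq; apply: eq_bigr => x xt; rewrite /upd; case: eqP => // e.
  by rewrite -e xt in vt.
have -> : E = F true `|` F false.
  apply/seteqP; split=> om /=.
    case=> H Qom; case e: (X om v); [left|right]; split=> // x; rewrite mem_rcons inE /upd;
      by case: eqP => [-> //|_ /H].
  by case=> -[H Qom]; split=> // x xt; have := H x; rewrite mem_rcons inE xt orbT /upd;
    case: eqP => [e|_ ->//]; rewrite -e xt in vt.
have [mT PT] := HF true; have [mF PF] := HF false; split; first exact: measurableU.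
have dis : F true `&` F false = set0.
  apply/seteqP; split=> om //= -[[H1 _] [H2 _]].
  have := H1 v; have := H2 v; rewrite mem_rcons inE eqxx /upd eqxx => e1 e2.
  by rewrite (e1 isT) in e2; have := e2 isT.
rewrite measureU // [X in (X + _)%E]PT [X in (_ + X)%E]PF -EFinD -mulrDr //.
Qed.

Definition ev (Q : (V -> bool) -> Prop) : set Om := [set om | Q (X om)].

Lemma ev_pr (s : seq V) S Q w : dep S Q -> uniq s -> (forall v, S v -> v \in s) ->
  measurable (ev Q) /\ P (ev Q) = (pr s Q w)%:E.
Proof.
move=> dQ us h; have [m e] := cyl_event (s := s) (t := [::]) w dQ us h.
have E : ev Q = [set om | (forall v, v \in [::] -> X om v = w v) /\ Q (X om)].
  by apply/seteqP; split=> om /=; [split|case].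
by rewrite E e big_nil mul1r; split.
Qed.

Lemma ev_measurable S Q : bdd S -> dep S Q -> measurable (ev Q).
Proof.
move=> /bdd_seq[s us h] dQ.
by have [] := ev_pr (s := s) (fun=> true) dQ us (fun v => proj1 (h v)).
Qed.

Lemma ev_indep S1 S2 Q1 Q2 : bdd S1 -> bdd S2 -> dep S1 Q1 -> dep S2 Q2 ->
  (forall v, S1 v -> S2 v -> False) ->
  P (ev (fun w => Q1 w /\ Q2 w)) = (P (ev Q1) * P (ev Q2))%E.
Proof.
move=> /bdd_seq[s1 u1 h1] /bdd_seq[s2 u2 h2] d1 d2 dis.
have [_ ->] := ev_pr (s := s1) (fun=> true) d1 u1 (fun v => proj1 (h1 v)).
have [_ ->] := ev_pr (s := s2) (fun=> true) d2 u2 (fun v => proj1 (h2 v)).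
have d12 : dep (fun v => S1 v \/ S2 v) (fun w => Q1 w /\ Q2 w).
  move=> w w' h [q1 q2]; split; first by apply: d1 q1 => v Sv; apply: h; left.
  by apply: d2 q2 => v Sv; apply: h; right.
have [||_ ->] := ev_pr (s := s1 ++ s2) (fun=> true) d12.
- rewrite cat_uniq u1 u2 andbT /=; apply/hasPn => v /h2 S2v; apply/negP => /h1 S1v.
  exact: dis S1v S2v.
- by move=> v; rewrite mem_cat => -[/h1 ->|/h2 ->]; rewrite ?orbT.
rewrite -EFinM; congr EFin; apply: pr_and d1 d2 _ _ => v Sv; apply/negP.
  by move=> /h2 /(dis v Sv).
by move=> /h1 h; exact: (dis v h Sv).
Qed.

End FiniteEvents.

(** Together with [percolation_relabel], this yields invariance under translations and
    reflections. *)
Lemma ev_law (R : realType) (p : R) d (Om : measurableType d) (P : probability Om R) X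
  d' (Om' : measurableType d') (P' : probability Om' R) X' S Q :
  site_percolation P X p -> site_percolation P' X' p -> bdd S -> dep S Q ->
  P (ev X Q) = P' (ev X' Q).
Proof.
move=> h h' /bdd_seq[s u1 h1] dQ.
have [_ ->] := ev_pr h (s := s) (fun=> true) dQ u1 (fun v => proj1 (h1 v)).
by have [_ ->] := ev_pr h' (s := s) (fun=> true) dQ u1 (fun v => proj1 (h1 v)).
Qed.

Lemma percolation_relabel (R : realType) (p : R) d (Om : measurableType d) (P : probability Om R) X
  (f f' : V -> V) : cancel f f' -> site_percolation P X p ->
  site_percolation P (fun om v => X om (f v)) p.
Proof.
move=> fK [m h]; split=> [v|s a us]; first exact: m.
have := h [seq f v | v <- s] (fun v => a (f' v)).
rewrite map_inj_uniq; last exact: can_inj fK.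
move=> /(_ us); rewrite big_map; under eq_bigr do rewrite fK; move=> <-; congr (P _).
apply/seteqP; split=> om /= H v; first by move=> /mapP[u us' ->]; rewrite fK; exact: H.
by move=> vs; rewrite H ?fK //; apply: map_f.
Qed.

(** * Events that occur infinitely often *)

Section LimSup.
Context {R : realType} {d : measure_display} {Om : measurableType d} (P : probability Om R).
Variable E : nat -> set Om.
Hypothesis mE : forall n, measurable (E n).

Let lscvg : P (\bigcup_(k >= n) E k) @[n --> \oo] --> P (lim_sup_set E).
Proof.
apply: lim_sup_set_cvg => //; apply: (le_lt_trans (y := 1%E)); last exact: ltry.
by apply: probability_le1; exact: bigcup_measurable.
Qed.

Let mcup n : measurable (\bigcup_(k in [set k | (n <= k)%N]) E k).
Proof. by apply: bigcup_measurable. Qed.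

Let mls : measurable (lim_sup_set E).
Proof. by apply: bigcapT_measurable => n; exact: mcup. Qed.

(** Events of probability at least c occur infinitely often with probability at least c, so this set
    cannot avoid a set of full measure. *)
Lemma limsup_ae_witness (c : R) (Q : Om -> Prop) : 0 < c ->
  (\forall n \near \oo, (c%:E <= P (E n))%E) ->
  {ae P, forall om, Q om} -> exists om, Q om /\ forall N, exists2 n, (N <= n)%N & E n om.
Proof.
move=> c0 Ec aeQ; apply: contrapT => H.
have N0 : P (lim_sup_set E) = 0%E.
  apply/(negligibleP P mls); apply: negligibleS aeQ => om Lom /= Qom; apply: H; exists om; split=> // N.
  by have [n /= Nn En] := Lom N I; exists n.
have : (c%:E <= P (lim_sup_set E))%E.
  apply: (@closed_cvg _ _ \oo _ (fun n => P (\bigcup_(k in [set k | (n <= k)%N]) E k)) (fun x => (c%:E <= x)%E)) lscvg.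
    exact: closed_ereal_le_ereal.
  near=> n; apply: (@le_trans _ _ (P (E n))); first by near: n.
  apply: le_measure; rewrite ?inE; [exact: mE|exact: mcup|].
  by move=> om Eom; exists n => /=.
by rewrite N0 lee_fin leNgt c0.
Unshelve. all: by end_near.
Qed.

Lemma ae_eventually_not (e : R) : 0 < e ->
  {ae P, forall om, exists N, forall n, (N <= n)%N -> ~ E n om} ->
  exists N, forall n, (N <= n)%N -> (P (E n) <= e%:E)%E.
Proof.
move=> e0 ae; have N0 : P (lim_sup_set E) = 0%E.
  apply/(negligibleP P mls); apply: negligibleS ae => om Lom /= [N HN].
  by have [n /= Nn En] := Lom N I; exact: (HN n Nn En).
have := lscvg; rewrite N0 => /fine_cvgP[fin cv].
have /cvgrPdist_le /(_ _ e0) := cv; case=> N1 _ H1.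
case: fin => N2 _ H2.
exists (maxn N1 N2) => n; rewrite geq_max => /andP[n1 n2].
apply: (@le_trans _ _ (P (\bigcup_(k in [set k | (n <= k)%N]) E k))).
  apply: le_measure; rewrite ?inE; [exact: mE|exact: mcup|].
  by move=> om Eom; exists n => /=.
have := H2 n n2 => /= f2; rewrite -(fineK f2) lee_fin.
have := H1 n n1; rewrite /= sub0r normrN => h; exact: le_trans (ler_norm _) h.
Qed.

End LimSup.

(** * Passage times as natural numbers *)

Section PassageTime.
Variable w : V -> bool.

Lemma Tn_ex u v : exists k, `[< exists2 g, path_from_to g u v & Tpath w g = k >].
Proof.
have [s [p l _ _]] := lpath u v; exists (Tpath w (u :: s)); apply/asboolP; by exists (u :: s).
Qed.

Definition Tn u v : nat := ex_minn (Tn_ex u v).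

Lemma Tn_attain u v : exists2 g, path_from_to g u v & Tpath w g = Tn u v.
Proof. by rewrite /Tn; case: ex_minnP => k /asboolP. Qed.

Lemma Tn_le u v g : path_from_to g u v -> (Tn u v <= Tpath w g)%N.
Proof. by move=> pg; rewrite /Tn; case: ex_minnP => k _; apply; apply/asboolP; exists g. Qed.

Lemma Tvert_Tn (R : realType) u v : Tvert R w u v = (Tn u v)%:R.
Proof.
apply/eqP; rewrite eq_le; apply/andP; split.
  apply: ge_inf; first by exists 0 => _ [g _ <-].
  by have [g pg eg] := Tn_attain u v; exists g => //; rewrite eg.
apply: lb_le_inf.
  by have [g pg eg] := Tn_attain u v; exists (Tpath w g)%:R; exists g.
by move=> _ [g pg <-]; rewrite ler_nat; exact: Tn_le.
Qed.

Lemma Tn_tri v u x : (Tn u x <= Tn u v + Tn v x)%N.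
Proof.
have [g pg <-] := Tn_attain u v; have [g' pg' <-] := Tn_attain v x.
have /path_from_toP[s [eg p l]] := pg; have /path_from_toP[t [eg' q m]] := pg'.
have : path_from_to (u :: s ++ t) u x.
  by apply/path_from_toP; exists (s ++ t); rewrite cat_path p last_cat l q m.
move=> /Tn_le /leq_trans; apply; rewrite !Tpath_count eg eg' -cat_cons count_cat leq_add2l.
exact: leq_addl.
Qed.

Lemma Tn_dist u v : (Tn u v <= (`|u.1 - v.1| + `|u.2 - v.2|).+1)%N.
Proof.
have [s [p l sz _]] := lpath u v.
have h : path_from_to (u :: s) u v by apply/path_from_toP; exists s.
apply: leq_trans (Tn_le h) _; rewrite Tpath_count (leq_trans (count_size _ _)) //= sz.
by [].
Qed.

Lemma Tn_closed u v : conn (fun z => ~~ w z) u v -> Tn u v = 0%N.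
Proof.
move=> [g [pg h]]; apply/eqP; rewrite -leqn0; apply: leq_trans (Tn_le pg) _.
rewrite Tpath_count leqn0 -leqn0 leqNgt -has_count; apply/hasPn => z /h //.
Qed.

End PassageTime.

Lemma Tn_relabel w (f f' : V -> V) u v : cancel f f' -> cancel f' f ->
  (forall u v, adjb (f u) (f v) = adjb u v) ->
  Tn (fun z => w (f z)) u v = Tn w (f u) (f v).
Proof.
move=> fK fK' fa.
have H (h : V -> V) w' a b g : (forall u v, adjb (h u) (h v) = adjb u v) ->
    path_from_to g a b -> path_from_to (map h g) (h a) (h b) /\
    Tpath w' (map h g) = Tpath (fun z => w' (h z)) g.
  move=> ha /path_from_toP[s [-> p l]]; split.
    apply/path_from_toP; exists (map h s); split=> //; last by rewrite last_map l.
    by elim: s a p {l} => //= c s IH a /andP[ac /IH ->]; rewrite ha ac.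
  by rewrite !Tpath_count count_map.
apply/eqP; rewrite eqn_leq; apply/andP; split.
  have [g pg <-] := Tn_attain w (f u) (f v).
  have fa' a b : adjb (f' a) (f' b) = adjb a b by rewrite -fa !fK'.
  have [pg' eg'] := H f' (fun z => w (f z)) _ _ _ fa' pg.
  rewrite !fK in pg'; apply: leq_trans (Tn_le _ pg') _; rewrite eg' !Tpath_count.
  by rewrite (eq_count (a2 := w)) // => z; rewrite /= fK'.
have [g pg <-] := Tn_attain (fun z => w (f z)) u v.
have [pg' eg'] := H f w _ _ _ fa pg.
by apply: leq_trans (Tn_le _ pg') _; rewrite eg'.
Qed.

Lemma ev_exists_measurable d (Om : measurableType d) (X : Om -> V -> bool) (I : countType) (Q : I -> (V -> bool) -> Prop) :
  (forall i, measurable (ev X (Q i))) -> measurable (ev X (fun w => exists i, Q i w)).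
Proof.
move=> h; rewrite (_ : ev X _ = \bigcup_i ev X (Q i)).
  exact: countable_bigcupT_measurable.
by apply/seteqP; split=> om; [case=> i ?; exists i|case=> i _ ?; exists i].
Qed.

Lemma dep_Tpath (g : seq V) (Q : nat -> Prop) : dep (fun v => v \in g) (fun w => Q (Tpath w g)).
Proof.
move=> w w' h; rewrite !Tpath_count (eq_in_count (a2 := w')) // => v /h //.
Qed.

Lemma bdd_mem (g : seq V) : bdd (fun v => v \in g).
Proof. by exists (\max_(v <- g) vnorm v)%N => v vg; apply: leq_bigmax_seq. Qed.

(** * Renormalization and half-plane arms *)

Lemma conn_map (S S' : V -> Prop) (f : V -> V) u v :
  (forall u v, adjb u v -> adjb (f u) (f v)) -> (forall u, S u -> S' (f u)) ->
  conn S u v -> conn S' (f u) (f v).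
Proof.
move=> fa fS h; have [Su _] := conn_in h.
apply: (conn_ind (P := fun v => conn S' (f u) (f v)) _ _ h).
  exact: conn_refl (fS _ Su).
by move=> x y c _ Sy xy; apply: conn_step c (fS _ Sy) (fa _ _ xy).
Qed.

Lemma conn_trunc (S : V -> Prop) (f : V -> nat) n u v :
  (forall u v, adjb u v -> (f v <= (f u).+1)%N) -> conn S u v -> (f u <= n <= f v)%N ->
  exists z, conn (fun x => S x /\ (f x <= n)%N) u z /\ f z = n.
Proof.
move=> fa h /andP[un nv]; have [Su _] := conn_in h.
set goal := exists z, _.
suff [//|c] : goal \/ conn (fun x => S x /\ (f x <= n)%N) u v.
  by exists v; split=> //; have [_ [_ vn]] := conn_in c; apply/eqP; rewrite eqn_leq vn.
apply: (conn_ind (P := fun v => goal \/ conn (fun x => S x /\ (f x <= n)%N) u v) _ _ h).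
  by right; apply: conn_refl.
move=> x y [|c] Sx Sy xy; first by left.
case: (leqP (f y) n) => yn; first by right; apply: conn_step c _ xy.
left; exists x; split=> //; have [_ [_ xn]] := conn_in c; apply/eqP.
by rewrite eqn_leq xn -ltnS (leq_trans yn) // fa.
Qed.

Lemma vnorm_sub_tri (x y z : V) : (vnorm (vsub x z) <= vnorm (vsub x y) + vnorm (vsub y z))%N.
Proof. case: x y z => ? ? [? ?] [? ?]; rewrite /vnorm /vsub /=; lia. Qed.

Lemma vnorm_subC (x y : V) : vnorm (vsub x y) = vnorm (vsub y x).
Proof. case: x y => ? ? [? ?]; rewrite /vnorm /vsub /=; lia. Qed.

Lemma vsub0 (x : V) : vsub x (0, 0) = x.
Proof. by case: x => a b; rewrite /vsub /= !subr0. Qed.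

Lemma adjb_vnorm_sub c u v : adjb u v -> (vnorm (vsub v c) <= (vnorm (vsub u c)).+1)%N.
Proof. case: c u v => ? ? [? ?] [? ?]; rewrite adjbE /vnorm /vsub /=; lia. Qed.

Lemma bdd_ball (v : V) r : bdd (fun u => (vnorm (vsub u v) <= r)%N).
Proof.
exists (r + vnorm v)%N => -[a b]; case: v => c e; rewrite /vnorm /vsub /=; lia.
Qed.

Lemma bdd_sub (S S' : V -> Prop) : (forall v, S v -> S' v) -> bdd S' -> bdd S.
Proof. by move=> h [r hr]; exists r => v /h /hr. Qed.

(* A closed connection across the annulus around v with radii r and k r. *)
Definition Cr (k r : nat) (v : V) (w : V -> bool) : Prop := exists z z',
  [/\ (vnorm (vsub z v) <= r)%N,
      conn (fun u => ~~ w u /\ (vnorm (vsub u v) <= k * r + 1)%N) z z' &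
      (k * r < vnorm (vsub z' v))%N].

Lemma dep_Cr k r v : dep (fun u => (vnorm (vsub u v) <= k * r + 1)%N) (Cr k r v).
Proof.
move=> w w' h [z [z' [h1 h2 h3]]]; exists z, z'; split=> //.
by apply: conn_sub h2 => u [wu un]; rewrite -h.
Qed.

Lemma Cr_intro k r v w z z' : (0 < k)%N -> (vnorm (vsub z v) <= r)%N ->
  conn (fun u => ~~ w u) z z' -> (k * r < vnorm (vsub z' v))%N -> Cr k r v w.
Proof.
move=> k0 zr c zk.
have [||x [cx ex]] := conn_trunc (f := fun u => vnorm (vsub u v)) (n := (k * r + 1)%N) _ c.
- by move=> ? ?; exact: adjb_vnorm_sub.
- rewrite addn1 zk andbT; apply: leq_trans zr _; apply: leqW; exact: leq_pmull.
by exists z, x; split=> //; rewrite ex addn1.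
Qed.

Definition grid (r m : nat) : seq V :=
  [seq (x.1 * r%:Z, x.2 * r%:Z) | x <- allpairs pair (int_range m) (int_range m)].

Lemma size_grid r m : size (grid r m) = (m.*2.+1 * m.*2.+1)%N.
Proof. by rewrite size_map size_allpairs !size_map !size_iota. Qed.

Lemma grid_near r m z : (0 < r)%N -> (vnorm z <= m * r)%N ->
  exists2 v, v \in grid r m.+1 & (vnorm (vsub z v) <= r)%N.
Proof.
case: z => a b r0; rewrite /vnorm /= geq_max => /andP[am bm].
have rz : r%:Z != 0 by lia.
have H (x : int) : (absz x <= m * r)%N -> (absz (x %/ r)%Z <= m.+1)%N /\
   (absz (x - (x %/ r)%Z * r%:Z)%R <= r)%N.
  move=> xm; have e := divz_eq x r; have := ltz_pmod x (d := r) ltac:(lia).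
  have := modz_ge0 x rz; move: (x %% r)%Z (x %/ r)%Z e => y q e y0 yr.
  split; last by rewrite e; lia.
  rewrite -(leq_pmul2r r0); have : (absz (q * r%:Z)%R <= m * r + r)%N by lia.
  by rewrite abszM absz_nat mulSn addnC.
have [a1 a2] := H a am; have [b1 b2] := H b bm.
exists ((a %/ r)%Z * r, (b %/ r)%Z * r); last by rewrite /vsub /= geq_max a2.
apply/mapP; exists ((a %/ r)%Z, (b %/ r)%Z) => //.
by apply/allpairsP; exists ((a %/ r)%Z, (b %/ r)%Z); rewrite /= !mem_int_range.
Qed.

(** The large crossing starts near a grid point v1 and ends near a grid point v2; followed from
    either end, it crosses the small annulus around that point. Factor 6 and k >= 3 put v1 and v2 so
    far apart that the balls of radius kr + 1, on which the two small crossings depend, are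
    disjoint. *)
Lemma Cr_renorm k r w : (3 <= k)%N -> (0 < r)%N -> Cr k (6 * r) (0, 0) w ->
  exists v1 v2, [/\ v1 \in grid r (6 * k + 2), v2 \in grid r (6 * k + 2),
   (k * r + 1 + (k * r + 1) < vnorm (vsub v1 v2))%N, Cr k r v1 w & Cr k r v2 w].
Proof.
move=> k3 r0 [z [z' [z6 c zk]]]; rewrite !vsub0 in z6 zk.
have c' : conn (fun u => ~~ w u) z z' by apply: conn_sub c => ? [].
have z6' : (vnorm z' <= k * (6 * r) + 1)%N by have [_ [_]] := conn_in c; rewrite vsub0.
have kr : (3 * r <= k * r)%N by rewrite leq_mul2r k3 orbT.
have ek : (k * (6 * r) = 6 * (k * r))%N by rewrite mulnCA.
have e6 : ((6 * k + 1) * r = 6 * (k * r) + r)%N by rewrite mulnDl mul1n mulnA.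
have [|v1 g1 d1] := @grid_near r (6 * k + 1) z r0; first by rewrite e6; lia.
have [|v2 g2 d2] := @grid_near r (6 * k + 1) z' r0; first by rewrite e6; lia.
have t1 := vnorm_sub_tri z' v1 (0, 0); have t2 := vnorm_sub_tri v1 z (0, 0).
have t3 := vnorm_sub_tri z' v2 v1; have t4 := vnorm_sub_tri z v2 (0, 0).
rewrite !vsub0 in t1 t2 t4; rewrite (vnorm_subC v1 z) in t2; rewrite (vnorm_subC v2 v1) in t3.
have t5 := vnorm_sub_tri v2 z (0, 0); rewrite !vsub0 in t5; rewrite (vnorm_subC v2 z) in t5.
have t6 := vnorm_sub_tri z' v2 (0, 0); rewrite !vsub0 in t6.
rewrite ek in z6 zk z6'.
exists v1, v2; split=> //.
- by move: g1; rewrite addn1 addn2.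
- by move: g2; rewrite addn1 addn2.
- lia.
- apply: (Cr_intro _ d1 c'); lia.
- apply: (Cr_intro _ d2 (conn_sym c')); lia.
Qed.

Section Prob.
Context {R : realType} {d : measure_display} {Om : measurableType d} (P : probability Om R).

Lemma union_bound (T : eqType) (s : seq T) (E : T -> set Om) (A : set Om) :
  measurable A -> (forall i, measurable (E i)) ->
  (forall om, A om -> exists2 i, i \in s & E i om) -> (P A <= \sum_(i <- s) P (E i))%E.
Proof.
move=> mA mE h.
pose U := foldr (fun i B => E i `|` B) set0.
have mU t : measurable (U t) by elim: t => [|i t IH]; [exact: measurable0|exact: measurableU].
have HU t : (P (U t) <= \sum_(i <- t) P (E i))%E.
  elim: t => [|i t IH]; first by rewrite big_nil measure0.
  rewrite big_cons; apply: le_trans (leeD2l _ IH).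
  by apply: measureU2.
apply: le_trans (HU s); apply: le_measure; rewrite ?inE // => om /h[i is_ Ei].
elim: s is_ {h} => // j t IH; rewrite inE => /orP[/eqP <-|/IH]; first by left.
by right.
Qed.

Variables (X : Om -> V -> bool) (p : R).
Hypothesis perc : site_percolation P X p.

Lemma ev_translate (v : V) (S : V -> Prop) (Q Q' : (V -> bool) -> Prop) : bdd S -> dep S Q ->
  (forall w, Q' w <-> Q (fun u => w (vadd u v))) -> P (ev X Q') = P (ev X Q).
Proof.
move=> bS dQ e.
have K : cancel (vadd^~ v) (vadd^~ (vopp v)).
  by case: v {e} => a b [c f]; rewrite /vadd /= !addrK.
have perc' := percolation_relabel K perc.
rewrite (ev_law perc perc' bS dQ); congr (P _); apply/seteqP; split=> om /= h; exact/e.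
Qed.

Lemma Cr_prob k r v : P (ev X (Cr k r v)) = P (ev X (Cr k r (0, 0))).
Proof.
have e z : vsub (vadd z v) v = vsub z (0, 0).
  by case: z v => ? ? [? ?]; rewrite /vsub /vadd /= !addrK !subr0.
apply: (ev_translate (v := v) (Q' := Cr k r v) (bdd_ball (0, 0) (k * r + 1)) (@dep_Cr k r (0, 0))) => w.
split=> -[z [z' [h1 h2 h3]]]; last first.
  exists (vadd z v), (vadd z' v); split; rewrite ?e //.
  apply: (conn_map (f := vadd^~ v) _ _ h2) => [u u'|u]; last by rewrite e.
  by case: u u' v {e h1 h2 h3} => ? ? [? ?] [? ?]; rewrite !adjbE /=; lia.
have e' x : vadd (vadd x (vopp v)) v = x.
  by case: x v {e h1 h2 h3} => ? ? [? ?]; rewrite /vadd /= !subrK.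
exists (vadd z (vopp v)), (vadd z' (vopp v)); split; rewrite -?e ?e' //.
apply: (conn_map (f := vadd^~ (vopp v)) _ _ h2) => [u u'|u]; last by rewrite -e e'.
by case: u u' v {e e' h1 h2 h3} => ? ? [? ?] [? ?]; rewrite !adjbE /=; lia.
Qed.

Definition pcr k r : R := fine (P (ev X (Cr k r (0, 0)))).

Lemma pcrE k r v : P (ev X (Cr k r v)) = (pcr k r)%:E.
Proof.
rewrite Cr_prob /pcr fineK //; apply: fin_num_measure.
exact: (ev_measurable perc (bdd_ball _ _) (@dep_Cr _ _ _)).
Qed.

Lemma pcr_ge0 k r : 0 <= pcr k r.
Proof. by rewrite fine_ge0. Qed.

Lemma mCr k r v : measurable (ev X (Cr k r v)).
Proof. exact: (ev_measurable perc (bdd_ball _ _) (@dep_Cr _ _ _)). Qed.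

(** The number of pairs (v1, v2). The mesh 1 stands for any mesh, as the size of the grid does not
    depend on it. *)
Definition Cgrid (k : nat) : R := ((size (grid 1 (6 * k + 2))) ^ 2)%:R.

(** A union bound over pairs of distant grid points, whose crossings are independent; hence the
    square. *)
Lemma pcr_renorm k r : (3 <= k)%N -> (0 < r)%N -> pcr k (6 * r) <= Cgrid k * pcr k r ^+ 2.
Proof.
move=> k3 r0; rewrite -lee_fin -(pcrE k (6 * r) (0, 0)).
pose G := grid r (6 * k + 2).
pose far (x : V * V) := (k * r + 1 + (k * r + 1) < vnorm (vsub x.1 x.2))%N.
pose E (x : V * V) := if far x then ev X (fun w => Cr k r x.1 w /\ Cr k r x.2 w) else set0.
have mE x : measurable (E x).
  rewrite /E; case: ifP => // _.
  rewrite (_ : ev X _ = ev X (Cr k r x.1) `&` ev X (Cr k r x.2)) //.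
  by apply: measurableI; exact: mCr.
have PE x : (P (E x) <= (pcr k r ^+ 2)%:E)%E.
  rewrite /E; case: ifP => [fx|_]; last by rewrite measure0 lee_fin exprn_ge0 // pcr_ge0.
  have dis u : (vnorm (vsub u x.1) <= k * r + 1)%N -> (vnorm (vsub u x.2) <= k * r + 1)%N -> False.
    move=> u1 u2; have := vnorm_sub_tri x.1 u x.2; rewrite (vnorm_subC x.1 u).
    by move: fx; rewrite /far; lia.
  rewrite (ev_indep perc (bdd_ball _ _) (bdd_ball _ _) (@dep_Cr k r x.1) (@dep_Cr k r x.2) dis).
  by rewrite !pcrE -EFinM expr2.
apply: (@le_trans _ _ (\sum_(x <- allpairs pair G G) P (E x))%E).
  apply: union_bound => //; first exact: mCr.
  move=> om /(Cr_renorm k3 r0)[v1 [v2 [g1 g2 f c1 c2]]].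
  exists (v1, v2); first by apply/allpairsP; exists (v1, v2).
  by rewrite /E /far f.
apply: (@le_trans _ _ (\sum_(x <- allpairs pair G G) (pcr k r ^+ 2)%:E)%E).
  by apply: lee_sum => x _.
rewrite sumEFin lee_fin big_const_seq count_predT iter_addr_0 size_allpairs -mulr_natl /Cgrid.
by rewrite -mulnn !size_grid lexx.
Qed.

End Prob.

(* Except for v itself, the arm stays in the open half-plane to the left of v. *)
Definition armL (r : nat) (v : V) (w : V -> bool) : Prop := exists z,
  conn (fun u => (w u /\ (u = v \/ u.1 < v.1)) /\ (vnorm (vsub u v) <= r)%N) v z /\
  (r <= vnorm (vsub z v))%N.

(* As armL, with all vertices of the ball of radius K regarded as open. *)
Definition hreach (K r : nat) (w : V -> bool) : Prop := exists z,
  conn (fun u => (u.1 < 0 /\ (w u || (vnorm u <= K)%N)) /\ (vnorm u <= r)%N) (-1, 0) z /\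
  (r <= vnorm z)%N.

Lemma dep_armL r v :
  dep (fun u => (u = v \/ u.1 < v.1) /\ (vnorm (vsub u v) <= r)%N) (armL r v).
Proof.
move=> w w' h [z [c zr]]; exists z; split=> //; apply: conn_sub c => u [[wu ul] un].
by rewrite -h.
Qed.

Lemma dep_hreach K r :
  dep (fun u => u.1 < 0 /\ (K < vnorm u <= r)%N) (hreach K r).
Proof.
move=> w w' h [z [c zr]]; exists z; split=> //; apply: conn_sub c => u [[wu ul] un].
do 2! split=> //; move: ul; case: (leqP (vnorm u) K) => uK; first by rewrite !orbT.
by rewrite !orbF h // uK.
Qed.

Lemma armL_mono r r' v w : (r <= r')%N -> armL r' v w -> armL r v w.
Proof.
move=> rr [z [c zr]].
have [||x [cx ex]] := conn_trunc (f := fun u => vnorm (vsub u v)) (n := r) _ c.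
- by move=> ? ?; exact: adjb_vnorm_sub.
- rewrite (leq_trans rr zr) andbT; case: v {c zr} => a b.
  by rewrite /vnorm /vsub /= !subrr.
exists x; split; last by rewrite ex.
by apply: conn_sub cx => u [[? ?] ?].
Qed.

Lemma scale_index (A j : nat) : (0 < A <= j)%N ->
  exists i, [/\ (A * 6 ^ i <= j)%N, (j < A * 6 ^ i.+1)%N & (i <= j)%N].
Proof.
move=> /andP[A0 Aj]; have q0 : (0 < j %/ A)%N by rewrite divn_gt0.
have /andP[h1 h2] := trunc_log_bounds (isT : (1 < 6)%N) q0.
exists (trunc_log 6 (j %/ A)); split.
- by rewrite mulnC -leq_divRL.
- by rewrite mulnC -ltn_divLR.
- apply: leq_trans (leq_trans (ltnW (ltn_expl _ (isT : (1 < 6)%N))) h1) (leq_div _ _).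
Qed.

(** The closed path of [halfplane_dual] starts next to (-1, j) and descends to height at most 0. At
    the scale r = r0 6^i with (k + 3) r <= j < 6 (k + 3) r, it starts within r of the multiple (-1,
    tr) just below and ends farther than kr from it. Each scale thus has a bounded number of
    centres. *)
Lemma hreach_fail k r0 rr w : (3 <= k)%N -> (0 < r0)%N -> ((k + 3) * r0 < rr)%N ->
  ~ hreach ((k + 3) * r0) rr w ->
  exists i t, [/\ (i <= rr.+1)%N, (t <= 6 * (k + 3))%N &
    Cr k (r0 * 6 ^ i) (-1, (t * (r0 * 6 ^ i))%N%:Z) w].
Proof.
move=> k3 r00 Krr nh.
have [||j [z [z' [/andP[Kj jr] zj z'0 c]]]] := @halfplane_dual w ((k + 3) * r0) rr.
- by rewrite Krr andbT muln_gt0 r00 addn3.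
- move=> v cv; rewrite ltnNge; apply/negP => rv; apply: nh.
  have [||x [cx ex]] := conn_trunc (f := vnorm) (n := rr) _ cv.
  + by move=> ? ?; exact: adjb_vnorm.
  + by rewrite rv andbT /vnorm /=; lia.
  by exists x; split=> //; rewrite ex.
have [|i [h1 h2 ij]] := @scale_index ((k + 3) * r0) j.
  by rewrite (ltnW Kj) muln_gt0 r00 addn3.
pose r := (r0 * 6 ^ i)%N; have r1 : (0 < r)%N by rewrite muln_gt0 r00 expn_gt0.
have e1 : ((k + 3) * r <= j)%N by rewrite /r mulnA.
have e2 : (j < 6 * (k + 3) * r)%N by move: h2; rewrite expnS /r; nia.
exists i, (j %/ r)%N; split.
- exact: leq_trans ij jr.
- by apply: ltnW; rewrite ltn_divLR.
rewrite -/r; have ej := divn_eq j r; have jm := ltn_pmod j r1.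
set t := (j %/ r)%N in ej *; set m := (j %% r)%N in ej jm.
have [a1 a2 a3 a4] := adjb_bounds zj; rewrite /= in a1 a2 a3 a4.
have d1 : (vnorm (vsub z ((-1)%R, (t * r)%N%:Z)) <= r)%N.
  case: z zj c a1 a2 a3 a4 => x y _ _ /=; rewrite /vnorm /vsub /=; move: (t * r)%N ej => tr ej.
  lia.
apply: (Cr_intro (z := z) (z' := z')) => //; first by apply: leq_trans k3.
case: z' z'0 {c} => x y /= y0; rewrite /vnorm /vsub /= leq_max; apply/orP; right.
have : (k * r + 3 * r <= j)%N by rewrite -mulnDl.
move: (t * r)%N (k * r)%N ej => tr kr ej; lia.
Qed.

Section Arms.
Context {R : realType} {d : measure_display} {Om : measurableType d} (P : probability Om R).
Variables (X : Om -> V -> bool) (p : R) (k : nat).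
Hypothesis perc : site_percolation P X p.
Hypothesis p0 : 0 < p.
Hypothesis k3 : (3 <= k)%N.
Hypothesis small : forall e : R, 0 < e -> exists r0, forall r, (r0 <= r)%N -> pcr P X k r <= e.

Let C : R := Cgrid k.

(** One constant serves both the recursion and the number of centres per scale. *)
Let C_ge : (6 * (k + 3)).+1%:R <= C.
Proof.
rewrite /C /Cgrid size_grid ler_nat; move: (k) k3 => k' k3'.
have : (6 * (k' + 3) < (6 * k' + 2).*2.+1)%N by lia.
move=> h; apply: leq_trans h _; rewrite -{1}(mul1n (_.+1)) expnS.
by rewrite -mulnA leq_mul // -{1}(muln1 (_.+1)) leq_mul // muln_gt0.
Qed.

Let C0 : 0 < C. Proof. by apply: lt_le_trans C_ge; rewrite ltr0n. Qed.

(** C times the crossing probability is at most squared from one scale to the next, and r0 is chosen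
    to start it at 1/4. *)
Lemma pcr_scales : exists2 r0, (0 < r0)%N & forall i, C * pcr P X k (r0 * 6 ^ i) <= (1 / 4) ^+ i.+1.
Proof.
have [r0 h] := small (divr_gt0 (ltr01 : 0 < 1 :> R) (mulr_gt0 (ltr0n _ 4) C0)).
exists r0.+1 => //; elim=> [|i IH].
  rewrite muln1 expr1; have := h r0.+1 (leqnSn _).
  move=> /(ler_wpM2l (ltW C0)) /le_trans; apply.
  by rewrite (_ : C * (1 / (4 * C)) = 1 / 4) ?lexx //; field; rewrite gt_eqF.
have r1 : (0 < r0.+1 * 6 ^ i)%N by rewrite muln_gt0 expn_gt0.
have := pcr_renorm perc k3 r1; rewrite -/C expnS mulnCA => /(ler_wpM2l (ltW C0)) /le_trans; apply.
have -> : C * (C * pcr P X k (r0.+1 * 6 ^ i) ^+ 2) = (C * pcr P X k (r0.+1 * 6 ^ i)) ^+ 2 by ring.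
have x0 : 0 <= C * pcr P X k (r0.+1 * 6 ^ i) by rewrite mulr_ge0 ?pcr_ge0 // ltW.
apply: (@le_trans _ _ (((1 / 4) ^+ i.+1) ^+ 2)); first by rewrite lerXn2r ?nnegrE ?exprn_ge0 ?divr_ge0.
rewrite -exprM; apply: ler_wiXn2l; [by rewrite divr_ge0|lra|lia].
Qed.

Lemma bdd_armL r v : bdd (fun u => (u = v \/ u.1 < v.1) /\ (vnorm (vsub u v) <= r)%N).
Proof. by apply: bdd_sub (bdd_ball v r) => u []. Qed.

Lemma bdd_hreach K r : bdd (fun u : V => u.1 < 0 /\ (K < vnorm u <= r)%N).
Proof. by exists r => u [_ /andP[]]. Qed.

Lemma geom4 n : \sum_(i <- iota 0 n) (1 / 4 : R) ^+ i.+1 <= 1 / 2.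
Proof.
suff : \sum_(i <- iota 0 n) (1 / 4 : R) ^+ i.+1 <= (1 - (1 / 4) ^+ n) / 3.
  have : 0 <= (1 / 4 : R) ^+ n by rewrite exprn_ge0 // divr_ge0.
  lra.
elim: n => [|n IH]; first by rewrite big_nil expr0 subrr mul0r.
rewrite -addn1 iotaD big_cat big_seq1 /= add0n addn1 exprS.
move: (_ ^+ n) IH => x IH; lra.
Qed.

Lemma hreach_prob : exists2 K, (0 < K)%N & forall r, (K < r)%N ->
  ((1 / 2)%:E <= P (ev X (hreach K r)))%E.
Proof.
have [r0 r00 h] := pcr_scales; exists ((k + 3) * r0)%N; first by rewrite muln_gt0 r00 addn3.
move=> r Kr; pose A := ev X (hreach ((k + 3) * r0) r).
have mA : measurable A by exact: (ev_measurable perc (bdd_hreach _ _) (@dep_hreach _ _)).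
suff H : (P (~` A) <= (1 / 2)%:E)%E.
  have fA := fin_num_measure P _ mA.
  have e : P (~` A) = (1 - fine (P A))%:E by rewrite probability_setC // -{1}(fineK fA) EFinB.
  by rewrite -/A -(fineK fA) lee_fin; move: H; rewrite e lee_fin; lra.
pose E (x : nat * nat) := ev X (Cr k (r0 * 6 ^ x.1) (-1, (x.2 * (r0 * 6 ^ x.1))%N%:Z)).
apply: (@le_trans _ _ (\sum_(x <- allpairs pair (iota 0 r.+2) (iota 0 (6 * (k + 3)).+1)) P (E x))%E).
  apply: union_bound; first exact: measurableC.
    by move=> x; exact: mCr perc _ _ _.
  move=> om /(hreach_fail k3 r00 Kr)[i [t [i1 t1 c]]].
  exists (i, t); last exact: c.
  apply/allpairsP; exists (i, t).
  by rewrite !mem_iota !add0n !ltnS i1 t1.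
under eq_bigr do rewrite /E (pcrE perc).
rewrite sumEFin lee_fin big_allpairs_dep.
apply: le_trans (geom4 r.+2); apply: ler_sum => i _.
apply: (@le_trans _ _ (\sum_(j <- iota 0 (6 * (k + 3)).+1) pcr P X k (r0 * 6 ^ i))); first by [].
rewrite big_const_seq count_predT size_iota iter_addr_0 -[_ *+ (6 * (k + 3)).+1]mulr_natl.
apply: le_trans (h i); apply: ler_wpM2r C_ge; exact: pcr_ge0.
Qed.

Lemma box_open_prob (s : seq V) : uniq s ->
  P (ev X (fun w => forall v, v \in s -> w v = true)) = (p ^+ size s)%:E.
Proof.
move=> us; have [_ h] := perc; rewrite /ev (h s (fun=> true) us); congr EFin.
by rewrite big_const_seq count_predT iter_mulr_1.
Qed.

(** The part of the ball of radius K that the arm may use is open with positive probability,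
    independently of [hreach], which looks only outside that ball. *)
Lemma armL_prob : exists2 th : R, 0 < th & forall r, (th%:E <= P (ev X (armL r (0, 0)%R)))%E.
Proof.
have [K K0 hK] := hreach_prob.
pose B (v : V) := (v = (0, 0) \/ v.1 < 0) /\ (vnorm v <= K)%N.
have bB : bdd B by exists K => v [].
have [s us sB] := bdd_seq bB.
exists (p ^+ size s * (1 / 2)); first by rewrite mulr_gt0 ?exprn_gt0 // divr_gt0.
move=> r; pose Q w := forall v : V, v \in s -> w v = true.
(* [hreach_prob] speaks of radii above K only; [armL_mono] returns to r. *)
pose r' := maxn r K.+1.
have dQ : dep B Q by move=> w w' h Qw v vs; rewrite -h ?Qw //; exact/sB.
have := ev_indep perc bB (bdd_hreach K r') dQ (@dep_hreach K r').
rewrite box_open_prob // => H.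
apply: (@le_trans _ _ (P (ev X (fun w => Q w /\ hreach K r' w)))).
  rewrite H; last by move=> v [_ vK] [_ /andP[]]; rewrite ltnNge vK.
  rewrite EFinM; apply: lee_pmul => //; first by rewrite lee_fin exprn_ge0 // ltW.
  by apply: hK; rewrite leq_max leqnn orbT.
apply: le_measure; rewrite ?inE.
- rewrite (_ : ev X _ = ev X Q `&` ev X (hreach K r')) //; apply: measurableI.
    exact: (ev_measurable perc bB dQ).
  exact: (ev_measurable perc (bdd_hreach _ _) (@dep_hreach _ _)).
- exact: (ev_measurable perc (bdd_armL _ _) (@dep_armL _ _)).
move=> om [Qo [z [c zr]]]; apply: (@armL_mono r r'); first exact: leq_maxl.
exists z; rewrite vsub0; split=> //.
have op u : B u -> X om u by move=> /sB; exact: Qo.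
apply: (@conn_trans _ (-1, 0)).
  apply: conn_adj; rewrite ?adjbE // !vsub0 /vnorm /=.
    split=> //; split; last by left.
    by apply: op; split; [left|].
  split; last by rewrite leq_max; lia.
  by split; [apply: op; split; [right|rewrite /vnorm /=; lia]|right].
apply: conn_sub c => u [[u0 uo] ur]; rewrite vsub0; split=> //; split; last by right.
by case/orP: uo => // uK; apply: op; split=> //; right.
Qed.

End Arms.

(** * Passage times in strips *)

Definition TS (S : V -> Prop) (w : V -> bool) (u v : V) (k : nat) : Prop :=
  exists g, [/\ path_from_to g u v, forall x, x \in g -> S x & (Tpath w g <= k)%N].

Lemma TS_trans S w v u x k l : TS S w u v k -> TS S w v x l -> TS S w u x (k + l).
Proof.
move=> [g [pg Sg wg]] [g' [pg' Sg' wg']].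
have /path_from_toP[s [eg p e]] := pg; have /path_from_toP[t [eg' q m]] := pg'.
exists (u :: s ++ t); split.
- by apply/path_from_toP; exists (s ++ t); rewrite cat_path p last_cat e q m.
- move=> z; rewrite -cat_cons mem_cat -eg => /orP[/Sg //|zt].
  by apply: Sg'; rewrite eg' inE zt orbT.
- apply: leq_trans (leq_add wg wg'); rewrite !Tpath_count eg eg' -cat_cons count_cat leq_add2l.
  exact: leq_addl.
Qed.

Lemma TS_sub (S S' : V -> Prop) w u v k l : (forall x, S x -> S' x) -> (k <= l)%N ->
  TS S w u v k -> TS S' w u v l.
Proof. by move=> h kl [g [pg Sg wg]]; exists g; split=> // [x /Sg /h//|]; exact: leq_trans kl. Qed.

Lemma TS_lpath (S : V -> Prop) w (u v : V) :
  (forall x : V, (x.1 = u.1 /\ between u.2 v.2 x.2) \/ (x.2 = v.2 /\ between u.1 v.1 x.1) -> S x) ->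
  TS S w u v (`|u.1 - v.1| + `|u.2 - v.2|).+1.
Proof.
move=> h; have [s [p l sz k]] := lpath u v; exists (u :: s); split.
- by apply/path_from_toP; exists s.
- by move=> x /k /h.
- by rewrite Tpath_count (leq_trans (count_size _ _)) //= sz.
Qed.

(** T(0, u) is bounded for u in the closed cluster of v, since moving inside it is free; linear
    growth then bounds u. *)
Lemma lin_closed_finite (w : V -> bool) (K : nat) :
  (exists n0, forall x, (n0 <= vnorm x)%N -> (vnorm x <= K * Tn w (0, 0)%R x)%N) ->
  forall v, ~~ w v -> exists l : seq V, forall u, conn (fun z => ~~ w z) v u -> u \in l.
Proof.
move=> [n0 h] v _; exists (box (maxn n0 (K * Tn w (0, 0)%R v))) => u /Tn_closed c0.
rewrite mem_box leq_max; case: (leqP n0 (vnorm u)) => [/h h1|/ltnW -> //].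
apply/orP; right; apply: leq_trans h1 _; rewrite leq_mul2l; apply/orP; right.
by have := Tn_tri w v (0, 0) u; rewrite c0 addn0.
Qed.

Definition armR (r : nat) (v : V) (w : V -> bool) : Prop := armL r (vopp v) (fun u => w (vopp u)).

Lemma voppK : involutive vopp. Proof. by case=> a b; rewrite /vopp /= !opprK. Qed.

Lemma dep_armR r v :
  dep (fun u => (u = v \/ v.1 < u.1) /\ (vnorm (vsub u v) <= r)%N) (armR r v).
Proof.
move=> w w' h; apply: dep_armL => u [uv un]; apply: h; split.
  case: uv => [->|uv]; first by left; rewrite voppK.
  right; move: uv; case: u v {un} => a b [c e] /=; lia.
by move: un; case: u v {uv} => a b [c e]; rewrite /vnorm /vsub /=; lia.
Qed.

Lemma armL_translate r v w : armL r v w <-> armL r (0, 0) (fun u => w (vadd u v)).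
Proof.
have e z : vsub (vadd z v) v = vsub z (0, 0).
  by case: z v => ? ? [? ?]; rewrite /vsub /vadd /= !addrK !subr0.
split=> -[z [c zr]]; last first.
  have e0 : vadd (0, 0) v = v by case: (v) => a b; rewrite /vadd /= !add0r.
  exists (vadd z v); rewrite e; split=> //.
  have := conn_map (S' := fun u => (w u /\ (u = v \/ u.1 < v.1)) /\ (vnorm (vsub u v) <= r)%N)
    (f := vadd^~ v) _ _ c.
  rewrite e0; apply => [u u'|u [[wu uv] un]].
    by case: u u' v {e e0 c zr} => ? ? [? ?] [? ?]; rewrite !adjbE /=; lia.
  rewrite e; split=> //; split=> //; case: uv => [->|uv]; first by left.
  by right; move: uv; case: u v {wu un c zr e e0} => ? ? [? ?] /=; lia.
have e' x : vadd (vadd x (vopp v)) v = x.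
  by case: x v {e zr c} => ? ? [? ?]; rewrite /vadd /= !subrK.
have e0 : vadd v (vopp v) = (0, 0) by case: (v) => a b; rewrite /vadd /= !subrr.
exists (vadd z (vopp v)); split; last by rewrite -e e'.
have := conn_map (S' := fun u => (w (vadd u v) /\ (u = (0, 0) \/ u.1 < 0)) /\
  (vnorm (vsub u (0, 0)%R) <= r)%N) (f := vadd^~ (vopp v)) _ _ c.
rewrite e0; apply => [u u'|u [[wu uv] un]].
  by case: u u' v {e e' e0 c zr} => ? ? [? ?] [? ?]; rewrite !adjbE /=; lia.
rewrite e' -e e'; split=> //; split=> //; case: uv => [->|uv]; first by left.
by right; move: uv; case: u v {e e' e0 wu un c zr} => ? ? [? ?] /=; lia.
Qed.

Section Prob.
Context {R : realType} {d : measure_display} {Om : measurableType d} (P : probability Om R).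

Lemma decreasing_prob_ge (E : nat -> set Om) (c : R) : (forall n, measurable (E n)) ->
  (forall m n, (m <= n)%N -> E n `<=` E m) -> (forall n, (c%:E <= P (E n))%E) ->
  (c%:E <= P (\bigcap_n E n))%E.
Proof.
move=> mE dE cE.
have mI : measurable (\bigcap_n E n) by exact: bigcapT_measurable.
have h : (P (E 0%N) < +oo)%E by apply: (le_lt_trans (y := 1%E)); [exact: probability_le1|exact: ltry].
have cv : (P \o E) @ \oo --> P (\bigcap_n E n).
  by apply: nonincreasing_cvg_mu => // m n mn; apply/subsetPset; exact: dE.
apply: (@closed_cvg _ _ \oo _ (P \o E) (fun x => (c%:E <= x)%E)) cv.
  exact: closed_ereal_le_ereal.
by near=> n; exact: cE.
Unshelve. all: by end_near.
Qed.

Lemma markov_count (T : eqType) (s : seq T) (E : T -> set Om) (A : set Om) (e q : R) :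
  measurable A -> (forall i, measurable (E i)) -> (forall i, (P (E i) <= e%:E)%E) -> 0 < q -> 0 <= e ->
  (forall om, A om -> q <= (count (fun i => `[< E i om >]) s)%:R) ->
  (P A <= ((size s)%:R * e / q)%:E)%E.
Proof.
move=> mA mE PE q0 e0 h.
have mi (B : set Om) : measurable B -> measurable_fun [set: Om] (EFin \o (\1_B : Om -> R)).
  by move=> mB; apply/measurable_EFinP; exact: measurable_indic.
have H : (\int[P]_x (q%:E * (\1_A x)%:E) <= \int[P]_x (\sum_(i <- s) (\1_(E i) x)%:E))%E.
  apply: ge0_le_integral => //.
  - by move=> x _; apply: mule_ge0; rewrite lee_fin; [exact: ltW|rewrite indicE; case: (_ \in _)].
  - by apply: measurable_funeM; exact: mi.
  - by apply: emeasurable_sum => i; exact: mi.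
  move=> om _; rewrite sumEFin -EFinM lee_fin indicE.
  have -> : \sum_(i <- s) \1_(E i) om = (count (fun i => `[< E i om >]) s)%:R :> R.
    elim: (s) => [|i t IH]; first by rewrite big_nil.
    by rewrite big_cons IH /= natrD indicE; congr (_%:R + _); apply/idP/idP; rewrite inE => /asboolP.
  case: (boolP (om \in A)) => [|_]; last by rewrite mulr0.
  by rewrite inE => /h; rewrite mulr1.
move: H; rewrite ge0_integralZl //; [|exact: mi|by rewrite lee_fin ltW].
rewrite integral_indic // setIT ge0_integral_sum //; last by move=> i; exact: mi.
move=> H.
have H2 : (\sum_(i <- s) \int[P]_x (\1_(E i) x)%:E <= ((size s)%:R * e)%:E)%E.
  apply: (@le_trans _ _ (\sum_(i <- s) e%:E)%E).
    by apply: lee_sum => i _; rewrite integral_indic // setIT; exact: PE.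
  by rewrite sumEFin big_const_seq count_predT iter_addr_0 mulr_natl.
have fA := fin_num_measure P _ mA.
have h3 : (q%:E * P A <= ((size s)%:R * e)%:E)%E := le_trans H H2.
rewrite -(fineK fA) -EFinM lee_fin in h3.
by rewrite -(fineK fA) lee_fin ler_pdivlMr // mulrC.
Qed.

Variables (X : Om -> V -> bool) (p : R).
Hypothesis perc : site_percolation P X p.

Lemma armR_prob r v : P (ev X (armR r v)) = P (ev X (armL r (0, 0))).
Proof.
have perc' := percolation_relabel voppK perc.
have -> : ev X (armR r v) = ev (fun om u => X om (vopp u)) (armL r (vopp v)) by [].
have -> : P (ev X (armL r (0, 0))) = P (ev (fun om u => X om (vopp u)) (armL r (0, 0))).
  exact: ev_law perc perc' (bdd_armL r (0, 0)) (@dep_armL r (0, 0)).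
rewrite (ev_translate perc' (v := vopp v) (Q' := armL r (vopp v)) (bdd_armL r (0, 0)) (@dep_armL r (0, 0))) // => w.
rewrite armL_translate.
rewrite (_ : (fun u => w (vadd u (vopp v))) = (fun u => w (vadd (vopp v) u))) //.
by apply/funext => u; congr w; rewrite /vadd addrC [u.2 + _]addrC.
Qed.

(** Lattice paths form a countable type, so an event asserting a path with a given passage time is a
    countable union of finite-range events. *)
Lemma passage_measurable (I : countType) (G : I -> seq V) (Q : I -> nat -> Prop) :
  measurable (ev X (fun w => exists i, Q i (Tpath w (G i)))).
Proof.
apply: ev_exists_measurable => i.
exact: (ev_measurable perc (bdd_mem (G i)) (@dep_Tpath (G i) (Q i))).
Qed.

Variable K : nat.
Hypothesis lin : {ae P, forall om, exists n0, forall x, (n0 <= vnorm x)%N ->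
  (vnorm x <= K * Tn (X om) (0, 0)%R x)%N}.

(** A closed crossing from z to z' gives T(0,z') <= T(0,z) <= 2r + 1 <= 3r although |z'| > 3Kr,
    against linear growth. Hence the ratio 3K; the other bound 3 is what [Cr_renorm] requires. *)
Lemma pcr_small (e : R) : 0 < e ->
  exists r0, forall r, (r0 <= r)%N -> pcr P X (maxn 3 (3 * K)) r <= e.
Proof.
move=> e0.
pose F n w := exists g : seq V, (fun g t => [/\ path_from_to g (0, 0) (last ((0, 0) : V) g),
   (n <= vnorm (last ((0, 0)%R : V) g))%N & (K * t < vnorm (last ((0, 0)%R : V) g))%N]) g (Tpath w g).
have mF n : measurable (ev X (F n)) by exact: (passage_measurable id _).
have [|N HN] := ae_eventually_not (P := P) mF e0.
  apply: filterS lin => om [n0 h]; exists n0 => n nn [g [pg ng]].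
  rewrite ltnNge => /negP; apply; apply: leq_trans (h _ (leq_trans nn ng)) _.
  by rewrite leq_mul2l Tn_le // orbT.
exists N.+1 => r Nr; rewrite -lee_fin -(pcrE perc _ _ (0, 0)).
apply: le_trans (HN r (ltnW Nr)); apply: le_measure; rewrite ?inE //; first exact: mCr perc _ _ _.
move=> om [z [z' [h1 h2 h3]]]; rewrite !vsub0 in h1 h3.
have c : conn (fun u => ~~ X om u) z z' by apply: conn_sub h2 => u [].
have [g pg eg] := Tn_attain (X om) (0, 0) z'.
have lg : last ((0, 0) : V) g = z' by case: pg; case: (g) => [|a t] //= _ [].
exists g; rewrite lg eg; split=> //.
  by apply: leq_trans (ltnW h3); rewrite leq_pmull // leq_max.
apply: leq_ltn_trans h3; apply: (@leq_trans (K * (3 * r))).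
  rewrite leq_mul2l; apply/orP; right.
  apply: leq_trans (Tn_tri _ z _ _) _; rewrite (Tn_closed c) addn0.
  apply: leq_trans (Tn_dist _ _ _) _.
  have r0 : (0 < r)%N by apply: leq_trans Nr.
  by move: h1; case: (z) => a b; rewrite /vnorm /= ; lia.
by rewrite mulnCA mulnA leq_mul2r leq_maxr orbT.
Qed.

End Prob.

Lemma TS_map (S S' : V -> Prop) (f : V -> V) w u v k :
  (forall u v, adjb u v -> adjb (f u) (f v)) -> (forall u, S u -> S' (f u)) ->
  TS S (fun z => w (f z)) u v k -> TS S' w (f u) (f v) k.
Proof.
move=> fa fS [g [/path_from_toP[s [-> p l]] Sg wg]]; exists (map f (u :: s)); split.
- apply/path_from_toP; exists (map f s); split=> //; last by rewrite last_map l.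
  by elim: s u p {l Sg wg} => //= c s IH u /andP[uc /IH ->]; rewrite fa.
- by move=> x /mapP[z /Sg h ->]; exact: fS.
- by move: wg; rewrite !Tpath_count count_map.
Qed.

Lemma dep_TS S u v k : dep S (fun w => TS S w u v k).
Proof.
move=> w w' h [g [pg Sg wg]]; exists g; split=> //.
by move: wg; rewrite !Tpath_count (eq_in_count (a2 := w')) // => z /Sg /h.
Qed.

(* The step from v to v + y cannot be made at cost c inside the ball of radius M. *)
Definition Bad (y : V) (c M : nat) (v : V) (w : V -> bool) : Prop :=
  ~ TS (fun u => (vnorm (vsub u v) <= M)%N) w v (vadd v y) c.

Lemma dep_Bad y c M v : dep (fun u => (vnorm (vsub u v) <= M)%N) (Bad y c M v).
Proof. by move=> w w' h nb b; apply: nb; apply: dep_TS b => u /h. Qed.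

Lemma Bad_translate y c M v w : Bad y c M v w <-> Bad y c M (0, 0) (fun u => w (vadd u v)).
Proof.
have e z : vsub (vadd z v) v = vsub z (0, 0).
  by case: z v => ? ? [? ?]; rewrite /vsub /vadd /= !addrK !subr0.
have e' x : vadd (vadd x (vopp v)) v = x.
  by case: x v {e} => ? ? [? ?]; rewrite /vadd /= !subrK.
have fa z u u' : adjb u u' -> adjb (vadd u z) (vadd u' z).
  by case: u u' z => ? ? [? ?] [? ?]; rewrite !adjbE /=; lia.
have e1 : vadd (0, 0) v = v by case: (v) => a b; rewrite /vadd /= !add0r.
have e2 : vadd (vadd (0, 0) y) v = vadd v y.
  by case: (v) (y) => a b [a' b']; rewrite /vadd /= !add0r addrC [b' + b]addrC.
split=> nb b; apply: nb.
  have := TS_map (S' := fun u => (vnorm (vsub u v) <= M)%N) (fa v) _ b.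
  by rewrite e1 e2; apply => u; rewrite e.
have e4 : vadd v (vopp v) = (0, 0) by case: (v) => ? ?; rewrite /vadd /= !subrr.
have e5 : vadd (vadd v y) (vopp v) = vadd (0, 0) y.
  by case: (v) (y) => ? ? [a' b']; rewrite /vadd /= !add0r ![_ + a']addrC ![_ + b']addrC !addrK.
have := @TS_map (fun u => (vnorm (vsub u v) <= M)%N) (fun u => (vnorm (vsub u (0, 0)%R) <= M)%N)
  (vadd^~ (vopp v)) (fun u => w (vadd u v)) v (vadd v y) c (fa (vopp v)).
rewrite /= e4 e5; apply; first by move=> u; rewrite -e e'.
by rewrite (_ : (fun z => w _) = w) //; apply/funext => u; rewrite e'.
Qed.

(** The path makes n steps by y. A good step costs at most c; a bad one is replaced by an L-shaped
    path, which stays in the ball of radius M because |y| <= M. *)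
Lemma strip_pieces (S : V -> Prop) (y : V) (c M j0 n : nat) (w : V -> bool) :
  let v (j : nat) : V := (j%:Z * y.1, j%:Z * y.2) in
  (vnorm y <= M)%N ->
  (forall j u, (j0 <= j <= j0 + n)%N -> (vnorm (vsub u (v j)) <= M)%N -> S u) ->
  TS S w (v j0) (v (j0 + n)%N)
    (1 + n * c + count (fun j => `[< Bad y c M (v j) w >]) (iota j0 n) * (`|y.1| + `|y.2|).+1)%N.
Proof.
move=> v yM; elim: n => [|n IH] hS.
  rewrite addn0; apply: (TS_sub (S := S) (k := 1)) => //.
  exists [:: v j0]; split; first by apply/path_from_toP; exists [::].
    move=> x; rewrite inE => /eqP ->; apply: (hS j0); first by rewrite addn0 !leqnn.
    by rewrite /vsub !subrr.
  by rewrite Tpath_count /= addn0; case: (w _).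
have IH' : TS S w (v j0) (v (j0 + n)%N)
    (1 + n * c + count (fun j => `[< Bad y c M (v j) w >]) (iota j0 n) * (`|y.1| + `|y.2|).+1)%N.
  by apply: IH => j u jn; apply: hS; lia.
have vS : v (j0 + n.+1)%N = vadd (v (j0 + n)%N) y.
  by rewrite addnS /v /vadd /= -addn1 PoszD !mulrDl !mul1r.
have inS u : (vnorm (vsub u (v (j0 + n)%N)) <= M)%N -> S u by apply: hS; lia.
rewrite -[n.+1]addn1 iotaD count_cat /= addn1 vS addn0.
set B := count _ _ in IH' *; set D := (_ + _).+1 in IH' *.
case: asboolP => [_|/contrapT nb] /=.
  have h : TS S w (v (j0 + n)%N) (vadd (v (j0 + n)%N) y) D.
    have := @TS_lpath S w (v (j0 + n)%N) (vadd (v (j0 + n)%N) y).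
    have -> : (`|(v (j0 + n)%N).1 - (vadd (v (j0 + n)%N) y).1| +
      `|(v (j0 + n)%N).2 - (vadd (v (j0 + n)%N) y).2|).+1%N = D.
      by rewrite /D /vadd /= !opprD !addrA !subrr !sub0r !abszN.
    apply=> x h; apply: inS; move: yM h; rewrite /vadd /vsub /vnorm /between /=.
    move: (v (j0 + n)%N) => [v1 v2]; clear; case: x y => x1 x2 [y1 y2] /=; lia.
  apply: (TS_sub (S := S)) (TS_trans IH' h) => //; nia.
have h := TS_sub inS (leqnn c) nb.
apply: (TS_sub (S := S)) (TS_trans IH' h) => //; nia.
Qed.

(** I is the interior of the path, as in [interface_upper]: the end points lie on the lines bounding
    the strip and are left to the arms. *)
Definition strip_path (w : V -> bool) (Y : V) (k : nat) : Prop := exists I : seq V,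
  [/\ (0 < size I)%N, path adjb (0, 0) (rcons I Y), forall u, u \in I -> 0 < u.1 < Y.1
    & (Tpath w I <= k)%N].

Lemma strip_path_of_TS w (Y : V) k : TS (fun u => 0 < u.1 < Y.1) w (1, 0) (Y.1 - 1, Y.2) k ->
  strip_path w Y k.
Proof.
move=> [g [/path_from_toP[s [-> p l]] Sg wg]]; exists ((1, 0) :: s); split=> //.
rewrite /= rcons_path p l /= !adjbE /=; case: (Y) => a b /=; lia.
Qed.

Section Strip.
Context {R : realType} {d : measure_display} {Om : measurableType d} (P : probability Om R).
Variables (X : Om -> V -> bool) (p : R).
Hypothesis perc : site_percolation P X p.
Variables (y : nat -> V) (s t mu : R).
Hypothesis s0 : 0 < s.
Hypothesis y1 : forall n, `|(y n).1%:~R - s * n%:R| <= 2.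
Hypothesis y2 : forall n, `|(y n).2%:~R - t * n%:R| <= 2.
Hypothesis hT : {ae P, forall om,
  (fun n => (Tn (X om) (0, 0) (y n))%:R / n%:R : R) @ \oo --> mu}.

Lemma mu_ge0 : 0 <= mu.
Proof.
have [|om [cv _]] := @limsup_ae_witness R d Om P (fun=> setT) (fun=> measurableT) 1
  (fun om => (fun n => (Tn (X om) (0, 0) (y n))%:R / n%:R : R) @ \oo --> mu) ltr01 _ hT.
  by near=> n; rewrite probability_setT.
rewrite -(cvg_lim _ cv) //; apply: limr_ge; first by apply: cvgP cv.
by near=> n; rewrite divr_ge0.
Unshelve. all: by end_near.
Qed.

(** For large m a path of cost at most m (mu + e) exists with probability near 1; for such m, a ball
    of large radius contains one with probability near 1. Translation makes the bound uniform in
    v. *)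
Lemma Bad_prob (e dl : R) : 0 < e -> 0 < dl ->
  exists m0, forall m, (m0 <= m)%N -> exists M0, forall M, (M0 <= M)%N -> forall v,
    (P (ev X (Bad (y m) (Num.truncn (m%:R * (mu + e))) M v)) <= dl%:E)%E.
Proof.
move=> e0 dl0; pose c m := Num.truncn (m%:R * (mu + e)).
have mu0 := mu_ge0.
have ce0 m : 0 <= m%:R * (mu + e) by rewrite mulr_ge0 // addr_ge0 // ltW.
pose F m w := exists g : seq V, (fun g k => path_from_to g (0, 0) (y m) /\ (k <= c m)%N) g (Tpath w g).
have mF m : measurable (ev X (F m)) by exact: (passage_measurable perc id _).
have d20 : 0 < dl / 2 by rewrite divr_gt0.
have [||m0 Hm0] := @ae_eventually_not _ _ _ P (fun m => ~` ev X (F m)) _ (dl / 2) d20.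
- by move=> m; exact: measurableC.
- apply: filterS hT => om /cvgrPdist_lt /(_ _ e0) [N _ HN]; exists N.+1 => m Nm; apply.
  have [g pg eg] := Tn_attain (X om) (0, 0) (y m).
  exists g; split=> //; rewrite eg truncn_ge_nat //.
  have m0' : 0 < m%:R :> R by rewrite ltr0n (leq_trans _ Nm).
  have := HN m (ltnW Nm); rewrite /= ltr_distlC => /andP[_].
  by rewrite ltr_pdivrMr // mulrC => /ltW.
exists m0 => m mm.
pose E M := ev X (Bad (y m) (c m) M (0, 0)) `&` ev X (F m).
have mB M v : measurable (ev X (Bad (y m) (c m) M v)).
  exact: (ev_measurable perc (bdd_ball _ _) (@dep_Bad _ _ _ _)).
have [||M0 HM0] := @ae_eventually_not _ _ _ P E _ (dl / 2) d20.
- by move=> M; exact: measurableI.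
- apply: aeW => om; case: (pselect (F m (X om))) => [[g [pg gc]]|nF]; last first.
    by exists 0%N => M _ [_ /nF].
  exists (\max_(v <- g) vnorm v)%N => M hM [nb _]; apply: nb; exists g; split=> //.
    by have -> : vadd (0, 0) (y m) = y m by case: (y m) => a b; rewrite /vadd /= !add0r.
  by move=> x xg; rewrite vsub0; apply: leq_trans hM; apply: leq_bigmax_seq.
exists M0 => M hM v.
have -> : P (ev X (Bad (y m) (c m) M v)) = P (ev X (Bad (y m) (c m) M (0, 0))).
  apply: (ev_translate perc (v := v) (Q' := Bad (y m) (c m) M v) (bdd_ball (0, 0) M) (@dep_Bad (y m) (c m) M (0, 0))) => w.
  rewrite Bad_translate (_ : (fun u => w (vadd u v)) = (fun u => w (vadd v u))) //.
  by apply/funext => u; congr w; rewrite /vadd addrC [u.2 + _]addrC.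
apply: (@le_trans _ _ (P (E M `|` ~` ev X (F m)))).
  apply: le_measure; rewrite ?inE; first exact: mB.
    by apply: measurableU; [exact: measurableI|exact: measurableC].
  by move=> om b; case: (pselect (F m (X om))) => f; [left|right].
apply: le_trans; first by apply: measureU2; [exact: measurableI|exact: measurableC].
rewrite [dl]splitr EFinD; apply: leeD; [exact: HM0|exact: Hm0].
Qed.

End Strip.

(** About N copies of an almost optimal path to [y m] are placed end to end, keeping away from both
    sides of the strip, and are linked to the end points by L-shaped paths. By Markov's inequality
    most copies can be confined to their balls. *)
Lemma strip_good (R : realType) d (Om : measurableType d) (P : probability Om R)
  (X : Om -> V -> bool) (p : R) (y : nat -> V) (s t mu e : R) :
  site_percolation P X p -> 0 < s -> (forall n, `|(y n).1%:~R - s * n%:R| <= 2) ->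
  (forall n, `|(y n).2%:~R - t * n%:R| <= 2) ->
  {ae P, forall om, (fun n => (Tn (X om) (0, 0) (y n))%:R / n%:R : R) @ \oo --> mu} ->
  0 < e <= 1 -> exists2 m, (0 < m)%N & exists N0, forall N, (N0 <= N)%N ->
  exists S Q, [/\ dep S Q, bdd S, forall u, S u -> 0 < u.1 < (y (m * N)).1,
    ((1 / 2)%:E <= P (ev X Q))%E &
    forall w, Q w -> exists2 k, strip_path w (y (m * N)) k &
      k%:R <= (m * N)%:R * (mu + 5 * e)].
Proof.
move=> perc s0 y1 y2 hT /andP[e0 e1].
have [c1 [c11 sc tc]] : exists c1 : nat, [/\ (1 <= c1)%N, `|s| <= c1%:R & `|t| <= c1%:R].
  exists (maxn (Num.truncn `|s|).+1 (Num.truncn `|t|).+1); split; first by rewrite leq_max.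
    by apply: (le_trans (ltW (truncnS_gt `|s|))); rewrite ler_nat leq_maxl.
  by apply: (le_trans (ltW (truncnS_gt `|t|))); rewrite ler_nat leq_maxr.
have c1R : 1 <= c1%:R :> R by rewrite ler1n.
(* The allowed proportion of bad steps: a replacement costs at most (2 c1 + 5) m, so all of them
   cost at most e m N. *)
pose eta := e / (2 * c1%:R + 5).
have eta0 : 0 < eta by rewrite divr_gt0 //; lra.
have eta_eq : eta * (2 * c1%:R + 5) = e by rewrite /eta divfK // gt_eqF //; lra.
(* The proportion of steps left out on the right, at a cost of about e m N for the final link. *)
pose h := e / (2 * c1%:R).
have h0 : 0 < h by rewrite divr_gt0 //; lra.
have h_eq : 2 * c1%:R * h = e by rewrite /h mulrC divfK // gt_eqF //; lra.
have h1 : h <= 1 / 2.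
  have : h * (2 * 1) <= h * (2 * c1%:R) by apply: ler_wpM2l; [exact: ltW|lra].
  lra.
have mu0 := mu_ge0 hT.
have [m0 Hm0] := Bad_prob perc hT e0 (divr_gt0 eta0 (ltr0n _ 2)).
(* Each step is misplaced by up to 2 through rounding. The first bound lets the omitted part, of
   width h s m N >= 3N, absorb the total drift 2N with M to spare; the second bounds the drift of
   both coordinates in the final link, 4N, by e m N. *)
have [m [m0m m1 hsm em]] : exists m, [/\ (m0 <= m)%N, (0 < m)%N, 3 <= h * s * m%:R & 4 <= e * m%:R].
  pose k1 := (Num.truncn (3 / (h * s))).+1; pose k2 := (Num.truncn (4 / e)).+1.
  have hs : 0 < h * s by rewrite mulr_gt0.
  exists (maxn m0 (maxn k1 k2)); split; first by rewrite leq_maxl.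
  - by rewrite !leq_max orbT.
  - rewrite mulrC -ler_pdivrMr //; apply: (le_trans (ltW (truncnS_gt (3 / (h * s))))).
    by rewrite ler_nat !leq_max leqnn orbT.
  - rewrite mulrC -ler_pdivrMr //; apply: (le_trans (ltW (truncnS_gt (4 / e)))).
    by rewrite ler_nat !leq_max leqnn !orbT.
exists m => //.
have [M0 HM0] := Hm0 m m0m.
pose M := maxn M0 (vnorm (y m)).
have BP v := HM0 M (leq_maxl _ _) v.
set c := Num.truncn _ in BP.
have mR : 1 <= m%:R :> R by rewrite ler1n.
have cR : c%:R <= m%:R * (mu + e) by rewrite truncn_le mulr_ge0 // addr_ge0 // ltW.
have ym1 := y1 m; have ym2 := y2 m; set a := (y m).1 in ym1; set b := (y m).2 in ym2.
pose v (j : nat) : V := (j%:Z * a, j%:Z * b).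
(* Each step advances by at least 1, so from here on the balls of radius M lie strictly to the right
   of 0. *)
pose j0 := M.+1.
have sm3 : 3 <= s * m%:R.
  have : h * s * m%:R <= 1 * (s * m%:R) by rewrite -mulrA ler_wpM2r // ?mulr_ge0 // ?ltW //; lra.
  lra.
have a1 : 1 <= a.
  have : (1 : R) <= a%:~R by move: ym1; rewrite ler_norml => /andP[]; lra.
  by rewrite -(ler_int R).
pose D := (`|a| + `|b|).+1%N.
pose Cs := (`|1 - (v j0).1| + `|0 - (v j0).2|).+1%N.
pose const : R := Cs%:R + 1 + 2 * c1%:R * m%:R + 6.
pose N0 := maxn (2 * M + 5) (Num.truncn (const / (e * m%:R))).+1.
exists N0 => N hN.
have NM : (2 * M + 5 <= N)%N by rewrite (leq_trans _ hN) // leq_maxl.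
have NMR : 2 * M%:R + 5 <= N%:R :> R by move: NM; rewrite -(ler_nat R) natrD natrM.
have em0 : 0 < e * m%:R by move: em; clear; lra.
have Nc : const <= e * m%:R * N%:R.
  rewrite mulrC -ler_pdivrMr //; apply: (le_trans (ltW (truncnS_gt _))).
  by rewrite ler_nat (leq_trans _ hN) // leq_maxr.
clear hN N0.
have Y1 := y1 (m * N); have Y2 := y2 (m * N); set Y := y (m * N) in Y1 Y2 *.
rewrite natrM in Y1 Y2 *.
have M0R : 0 <= M%:R :> R by [].
have hN1 : (1 - h) * N%:R >= 0 by rewrite mulr_ge0 //; move: h1; clear; lra.
pose j1 := Num.truncn ((1 - h) * N%:R).
have j1a : j1%:R <= (1 - h) * N%:R by rewrite truncn_le.
have j1b : (1 - h) * N%:R < j1%:R + 1 by have := truncnS_gt ((1 - h) * N%:R); rewrite -addn1 natrD.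
have hN2 : N%:R / 2 <= (1 - h) * N%:R.
  by rewrite mulrC ler_wpM2r //; move: h1; clear; lra.
have j01 : (j0 <= j1)%N.
  rewrite truncn_ge_nat // /j0 -addn1 natrD; move: NMR hN2 M0R; clear; lra.
pose n := (j1 - j0)%N.
have j0n : (j0 + n = j1)%N by rewrite subnKC.
have hN0 : 0 <= h * N%:R by rewrite mulr_ge0 // ltW.
have j1N : j1%:R <= N%:R :> R by move: j1a hN0; clear; lra.
have nN : n%:R <= N%:R :> R.
  by apply: le_trans j1N; rewrite ler_nat leq_subr.
pose cnt w := count (fun j => `[< Bad (y m) c M (v j) w >]) (iota j0 n).
(* A step is bad with probability at most eta / 2, so Markov's inequality gives this event
   probability at least 1/2. *)
pose Q w := (cnt w)%:R < eta * N%:R.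
pose S u := exists2 j, (j0 <= j <= j1)%N & (vnorm (vsub u (v j)) <= M)%N.
have aR : `|a%:~R| <= c1%:R * m%:R + 2 :> R.
  have : `|s * m%:R| <= c1%:R * m%:R by rewrite normrM [`|m%:R|]ger0_norm // ler_wpM2r.
  by move=> H; have := ler_normD (a%:~R - s * m%:R) (s * m%:R); rewrite subrK; move: H ym1; clear; lra.
have bR : `|b%:~R| <= c1%:R * m%:R + 2 :> R.
  have : `|t * m%:R| <= c1%:R * m%:R by rewrite normrM [`|m%:R|]ger0_norm // ler_wpM2r.
  by move=> H; have := ler_normD (b%:~R - t * m%:R) (t * m%:R); rewrite subrK; move: H ym2; clear; lra.
have top : j1%:Z * a + M%:Z < Y.1.
  rewrite -(ltr_int R) rmorphD rmorphM /= -!pmulrn.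
  have A1 : a%:~R <= s * m%:R + 2 by move: ym1; clear; rewrite ler_norml => /andP[]; lra.
  have A2 : j1%:R * a%:~R <= (1 - h) * N%:R * (s * m%:R + 2).
    by apply: ler_pM => //; rewrite ler0z (le_trans _ a1).
  have A3 : (1 - h) * N%:R * (s * m%:R + 2) <= N%:R * (s * m%:R + 2) - (h * s * m%:R) * N%:R.
    have -> : (1 - h) * N%:R * (s * m%:R + 2) = N%:R * (s * m%:R + 2) - (h * s * m%:R) * N%:R - 2 * (h * N%:R) by ring.
    move: hN0; clear; lra.
  have A4 : 3 * N%:R <= h * s * m%:R * N%:R by rewrite ler_wpM2r.
  have A5 : s * (m%:R * N%:R) - 2 <= Y.1%:~R by move: Y1; clear; rewrite ler_norml => /andP[]; lra.
  move: A2 A3 A4 A5 NMR M0R; clear; lra.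
have inS u : S u -> 0 < u.1 < Y.1.
  move=> [j /andP[jj0 jj1]]; case: u => u1 u2; rewrite /vsub /vnorm /v /= geq_max => /andP[h1' _].
  have B1 : j%:Z <= j%:Z * a by rewrite ler_peMr.
  have B2 : j%:Z * a <= j1%:Z * a by apply: ler_wpM2r; [exact: le_trans a1|rewrite lez_nat].
  move: (j%:Z * a) (j1%:Z * a) B1 B2 h1' top jj0; rewrite /j0; clear; move=> x x' B1 B2 h1' top' jj0; lia.
have dQ : dep S Q.
  move=> w w' hw; rewrite /Q /cnt (eq_in_count (a2 := fun j => `[< Bad (y m) c M (v j) w' >])) // => j.
  rewrite mem_iota j0n => /andP[ja jb]; apply: asbool_equiv_eq.
  have hu u : (vnorm (vsub u (v j)) <= M)%N -> w u = w' u.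
    by move=> hu; apply: hw; exists j => //; rewrite ja ltnW.
  by split; apply: dep_Bad => u /hu.
have bS : bdd S.
  exists (M + \max_(j <- iota j0 n.+1) vnorm (v j))%N => u [j /andP[ja jb] uj].
  have := vnorm_sub_tri u (v j) (0, 0); rewrite !vsub0 => /leq_trans; apply; apply: leq_add => //.
  apply: (@leq_bigmax_seq _ (iota j0 n.+1) xpredT (fun j => vnorm (v j)) j) => //.
  by rewrite mem_iota ja addnS j0n ltnS.
have mQ : measurable (ev X Q) by exact: (ev_measurable perc bS dQ).
have N0R : 0 < N%:R :> R by move: NMR M0R; clear; lra.
exists S, Q; split=> //.
  have PA : (P (~` ev X Q) <= (1 / 2)%:E)%E.
    apply: (@le_trans _ _ ((size (iota j0 n))%:R * (eta / 2) / (eta * N%:R))%:E).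
      apply: (markov_count (E := fun j => ev X (Bad (y m) c M (v j)))).
      - exact: measurableC.
      - by move=> j; exact: (ev_measurable perc (bdd_ball _ _) (@dep_Bad _ _ _ _)).
      - by move=> j; exact: BP.
      - by rewrite mulr_gt0.
      - by rewrite divr_ge0 // ltW.
      - by move=> om /= /negP; rewrite -leNgt.
    rewrite lee_fin size_iota ler_pdivrMr ?mulr_gt0 //.
    have : n%:R * eta <= N%:R * eta by rewrite ler_wpM2r // ltW.
    clear; lra.
  have fA := fin_num_measure P _ mQ.
  have eA : P (~` ev X Q) = (1 - fine (P (ev X Q)))%:E by rewrite probability_setC // -{1}(fineK fA) EFinB.
  by move: PA; rewrite eA -(fineK fA) !lee_fin; clear; lra.
move=> w Qw.
pose Ce := (`|(v j1).1 - (Y.1 - 1)%R| + `|(v j1).2 - Y.2|).+1%N.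
exists (Cs + (1 + n * c + cnt w * D) + Ce)%N.
  apply: strip_path_of_TS; apply: TS_trans; first apply: TS_trans.
  - apply: TS_lpath => -[x1 x2] /=; rewrite /between /v /=.
    have Z0 : j0%:Z <= j0%:Z * a by rewrite ler_peMr.
    have Z1 : j0%:Z * a <= j1%:Z * a by apply: ler_wpM2r; [exact: le_trans a1|rewrite lez_nat].
    move: (j0%:Z * a) (j1%:Z * a) (j0%:Z * b) Z0 Z1 top; rewrite /j0; clear; lia.
  - have := @strip_pieces (fun u => 0 < u.1 < Y.1) (y m) c M j0 n w _ _; rewrite j0n.
    apply; first exact: leq_maxr.
    by move=> j u jj hj; apply: inS; exists j.
  - apply: TS_lpath => -[x1 x2] /=; rewrite /between /v /=.
    have Z0 : j0%:Z <= j0%:Z * a by rewrite ler_peMr.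
    have Z1 : j0%:Z * a <= j1%:Z * a by apply: ler_wpM2r; [exact: le_trans a1|rewrite lez_nat].
    move: (j0%:Z * a) (j1%:Z * a) (j1%:Z * b) Z0 Z1 top; rewrite /j0; clear; lia.
have E1 : n%:R * c%:R <= N%:R * (m%:R * (mu + e)) by apply: ler_pM.
have DR : D%:R <= (2 * c1%:R + 5) * m%:R :> R.
  rewrite /D -addn1 !natrD !natr_absz !intr_norm; move: aR bR mR; clear; nra.
have E2 : (cnt w)%:R * D%:R <= e * (m%:R * N%:R).
  apply: (@le_trans _ _ (eta * N%:R * ((2 * c1%:R + 5) * m%:R))).
    by apply: ler_pM => //; exact: ltW.
  rewrite -[in X in _ <= X]eta_eq le_eqVlt; apply/orP; left; apply/eqP; ring.
have Nj : N%:R - j1%:R <= h * N%:R + 1 by move: j1b; clear; lra.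
have gen (q : R) (zm zY : int) : `|q| <= c1%:R -> `|zm%:~R - q * m%:R| <= 2 -> `|zY%:~R - q * (m%:R * N%:R)| <= 2 ->
    `|j1%:R * zm%:~R - zY%:~R| <= 2 * N%:R + (c1%:R * m%:R + e / 2 * (m%:R * N%:R)) + 2.
  move=> qc h1' h2'.
  have -> : j1%:R * zm%:~R - zY%:~R = j1%:R * (zm%:~R - q * m%:R) + (q * (m%:R * (j1%:R - N%:R)) + (q * (m%:R * N%:R) - zY%:~R)) by ring.
  apply: le_trans (ler_normD _ _) _; rewrite -addrA; apply: lerD.
    by rewrite normrM [`|j1%:R|]ger0_norm // mulrC; apply: ler_pM.
  apply: le_trans (ler_normD _ _) _; apply: lerD; last by rewrite distrC.
  rewrite normrM; apply: (@le_trans _ _ (c1%:R * (m%:R * (h * N%:R + 1)))).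
    apply: ler_pM => //; rewrite normrM [`|m%:R|]ger0_norm //; apply: ler_wpM2l => //.
    by rewrite distrC ger0_norm ?subr_ge0.
  rewrite -h_eq le_eqVlt; apply/orP; left; apply/eqP; by field.
have E3 : Ce%:R <= 4 * N%:R + 2 * c1%:R * m%:R + e * (m%:R * N%:R) + 6.
  have G1 := gen s a Y.1 sc ym1 Y1; have G2 := gen t b Y.2 tc ym2 Y2.
  rewrite /Ce -addn1 !natrD !natr_absz !intr_norm !rmorphB /= !rmorphM /= -!pmulrn.
  have : `|j1%:R * a%:~R - (Y.1%:~R - 1)| <= `|j1%:R * a%:~R - Y.1%:~R| + 1 :> R.
    rewrite opprB addrCA [1 + _]addrC; apply: le_trans (ler_normD _ _) _.
    by rewrite normr1.
  move: G1 G2 j1N; clear; lra.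
have E4 : 4 * N%:R <= e * m%:R * N%:R by rewrite ler_wpM2r.
(* The five e: confinement of a good step, replacement of bad steps, the omitted part of the final
   link, its rounding drift, and all terms not growing with N. *)
rewrite !natrD !natrM.
move: Nc E1 E2 E3 E4; rewrite /const; clear; lra.
Qed.

(** * Configurations with two infinite arms and a strip path *)

Definition good (w : V -> bool) (Y : V) (k : nat) : Prop := exists I : seq V,
  [/\ [/\ (0 < size I)%N, path adjb (0, 0) (rcons I Y), (0, 0) \notin I & Y \notin I],
      Y != (0, 0), (Tpath w I <= k)%N
    & forall z r, z = (0, 0) \/ z = Y ->
        exists2 u, conn (fun v => w v /\ v \notin I) z u & (r < vnorm u)%N].

Lemma good_relabel (f : V -> V) w Y k : involutive f -> f (0, 0) = (0, 0) ->
  (forall u v, adjb (f u) (f v) = adjb u v) -> (forall v, vnorm (f v) = vnorm v) ->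
  good (fun v => w (f v)) Y k -> good w (f Y) k.
Proof.
move=> fK f0 fa fn [I [[I0 pI zI YI] Yn tI arm]]; exists (map f I); split.
- split; rewrite ?size_map //; last by rewrite mem_map //; exact: inv_inj.
    rewrite -map_rcons -f0; elim: (rcons I Y) ((0, 0) : V) pI => //= c s IH u /andP[uc /IH ->].
    by rewrite fa uc.
  by rewrite -f0 mem_map //; exact: inv_inj.
- by rewrite -f0 (inj_eq (inv_inj fK)).
- by rewrite !Tpath_count count_map in tI *.
move=> z r hz; have [|u c ru] := arm (f z) r.
  by case: hz => ->; [left|right; rewrite fK].
exists (f u); last by rewrite fn.
rewrite -[z]fK; apply: (conn_map (f := f) _ _ c) => [a b|a [wa aI]]; first by rewrite fa.
by split=> //; rewrite mem_map //; exact: inv_inj.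
Qed.

Lemma good_of_arms w Y k : 0 < Y.1 -> (forall r, armL r (0, 0) w) -> (forall r, armR r Y w) ->
  strip_path w Y k -> good w Y k.
Proof.
move=> Y0 hL hR [I [I0 pI sI tI]]; exists I; split=> //.
- split=> //; first by apply/negP => /sI; rewrite ltxx.
  by apply/negP => /sI; rewrite ltxx andbF.
- by apply/eqP => e; move: Y0; rewrite e ltxx.
move=> z r [->|->].
  have [u [c ru]] := hL r.+1; exists u; last by rewrite vsub0 in ru.
  apply: conn_sub c => v [[wv vl] _]; split=> //; apply/negP => /sI /andP[v0 _].
  by case: vl v0 => [->|]; rewrite ?ltxx // => /lt_gtF ->.
have [u [c ru]] := hR (r.+1 + vnorm Y)%N; exists (vopp u).
  rewrite -[Y in conn _ Y _]voppK; apply: (conn_map (f := vopp) _ _ c) => [a b|v [[wv vl] _]].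
    by case: a b => ? ? [? ?]; rewrite !adjbE /=; lia.
  split=> //; apply/negP => /sI /andP[_ v1]; case: vl v1 => [->|]; first by rewrite voppK ltxx.
  by case: v {wv} => a b; case: (Y) => c' e /=; lia.
by move: ru; clear; case: u Y => a b [c e]; rewrite /vnorm /vsub /=; lia.
Qed.

(** The arms serve twice: they put both end points in the infinite cluster and they are the arms of
    [interface_upper]. The resulting open right-most path also shows that [bdist] is an infimum over
    a nonempty set, as the lower bound requires. *)
Lemma good_bdist (R : realType) w Y k :
  (forall v, ~~ w v -> exists l : seq V, forall u, conn (fun z => ~~ w z) v u -> u \in l) ->
  good w Y k -> [/\ Cinf w (0, 0), Cinf w Y, bdist R w (0, 0) Y <= k%:R
    & (Tn w (0, 0) Y)%:R <= bdist R w (0, 0) Y + 2].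
Proof.
move=> fin [I [[I0 pI zI YI] Yn tI arm]].
have C z : z = (0, 0) \/ z = Y -> Cinf w z.
  move=> hz; split.
    by have [u c _] := arm z 0%N hz; have [[]] := conn_in c.
  move=> /finite_seqP[s es]; pose r := (\max_(v <- s) vnorm v)%N.
  have [u c ru] := arm z r hz.
  have : [set u | open_conn w z u] u.
    by apply/open_connE; apply: conn_sub c => v [].
  rewrite es /= => us; move: ru; rewrite ltnNge => /negP; apply.
  by apply: leq_bigmax_seq.
have C0 := C _ (or_introl erefl); have CY := C _ (or_intror erefl).
have [w0 _] := C0; have [wY _] := CY.
have Yn' : (0, 0) != Y by rewrite eq_sym.
have [g [pg wg rg bg]] := interface_upper Yn' w0 wY zI YI I0 pI fin arm.
split=> //.
  apply: (@le_trans _ _ (bcount w g)%:R); last by rewrite ler_nat (leq_trans bg) // -Tpath_count.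
  apply: ge_inf; first by exists 0 => _ [g' _ <-].
  by exists g.
rewrite -lerBlDr; apply: lb_le_inf; first by exists (bcount w g)%:R; exists g.
move=> _ [g' [pg' [_ rg']] <-]; rewrite lerBlDr -natrD ler_nat.
have [g2 pg2 hg2] := rightmost_lower w pg' rg'.
exact: leq_trans (Tn_le _ pg2) hg2.
Qed.

Section Limsup.
Context {R : realType} {d : measure_display} {Om : measurableType d} (P : probability Om R).
Variables (X : Om -> V -> bool) (p : R).
Hypothesis perc : site_percolation P X p.
Hypothesis p0 : 0 < p.
Variable K : nat.
Hypothesis lin : {ae P, forall om, exists n0, forall x, (n0 <= vnorm x)%N ->
  (vnorm x <= K * Tn (X om) (0, 0)%R x)%N}.
Variables (y : nat -> V) (s t mu : R).
Hypothesis s0 : 0 < s.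
Hypothesis y1 : forall n, `|(y n).1%:~R - s * n%:R| <= 2.
Hypothesis y2 : forall n, `|(y n).2%:~R - t * n%:R| <= 2.
Hypothesis hT : {ae P, forall om,
  (fun n => (Tn (X om) (0, 0) (y n))%:R / n%:R : R) @ \oo --> mu}.

(** The arm to the left of 0, the arm to the right of [y n] and the strip path depend on disjoint
    sets of sites, so their joint probability is bounded below uniformly in the arm length r.
    Letting r grow gives infinite arms, and [limsup_ae_witness] gives infinitely many n. *)
Lemma good_limsup (e : R) (Q : Om -> Prop) : 0 < e -> {ae P, forall om, Q om} ->
  exists om, Q om /\ forall N, exists2 n, (N <= n)%N &
    exists2 k, good (X om) (y n) k & k%:R <= n%:R * (mu + e).
Proof.
move=> e0 aeQ; pose e' := Num.min (e / 5) 1.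
have e'0 : 0 < e' <= 1 by rewrite lt_min ltr01 divr_gt0 //= ge_min lexx orbT.
have e5 : 5 * e' <= e.
  have : e' <= e / 5 by rewrite ge_min lexx.
  lra.
have [m m0 [N0 HN0]] := strip_good perc s0 y1 y2 hT e'0.
have [th th0 hth] := armL_prob perc p0 (leq_maxl 3 (3 * K)) (pcr_small perc lin).
have [N|SQ hSQ] := @choice nat ((V -> Prop) * ((V -> bool) -> Prop)) (fun N SQ => (N0 <= N)%N ->
  [/\ dep SQ.1 SQ.2, bdd SQ.1, forall u, SQ.1 u -> 0 < u.1 < (y (m * N)).1,
    ((1 / 2)%:E <= P (ev X SQ.2))%E &
    forall w, SQ.2 w -> exists2 k, strip_path w (y (m * N)) k &
      k%:R <= (m * N)%:R * (mu + 5 * e')]).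
  case: (leqP N0 N) => hN; last by exists (fun=> True, fun=> True).
  by have [S [Q' HQ]] := HN0 N hN; exists (S, Q') => _.
pose Y N := y (m * N).
pose F N r := if (N0 <= N)%N then ev X (fun w => armL r (0, 0) w /\ (armR r (Y N) w /\ (SQ N).2 w)) else set0.
have mA r : measurable (ev X (armL r (0, 0))) by exact: (ev_measurable perc (bdd_armL _ _) (@dep_armL _ _)).
have bR r v : bdd (fun u => (u = v \/ v.1 < u.1) /\ (vnorm (vsub u v) <= r)%N).
  by apply: bdd_sub (bdd_ball v r) => u [].
have mR r N : measurable (ev X (armR r (Y N))) by exact: (ev_measurable perc (bR _ _) (@dep_armR _ _)).
have mF N r : measurable (F N r).
  rewrite /F; case: ifP => // hN; have [dS bS _ _ _] := hSQ N hN.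
  rewrite (_ : ev X _ = ev X (armL r (0, 0)) `&` (ev X (armR r (Y N)) `&` ev X (SQ N).2)) //.
  by apply: measurableI => //; apply: measurableI => //; exact: (ev_measurable perc bS dS).
have Ypos N : (N0 <= N)%N -> 0 < (Y N).1.
  move=> hN; have [_ _ _ PQ HQ] := hSQ N hN; apply: contrapT => Yn.
  have : ev X (SQ N).2 = set0.
    apply/seteqP; split=> om //= /HQ[k [I [+ _ + _] _]].
    case: I => // a l _ /(_ a); rewrite mem_head => /(_ isT) /andP[h1 h2].
    by apply: Yn; exact: lt_trans h1 h2.
  by move=> e1; move: PQ; rewrite e1 measure0 lee_fin leNgt divr_gt0.
pose c := th * (th * (1 / 2)).
have c0 : 0 < c by rewrite !mulr_gt0 // divr_gt0.
have PF N r : (N0 <= N)%N -> (c%:E <= P (F N r))%E.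
  move=> hN; rewrite /F hN; have [dS bS S01 PQ _] := hSQ N hN; have Y0 := Ypos N hN.
  have dRS : dep (fun u => ((u = Y N \/ (Y N).1 < u.1) /\ (vnorm (vsub u (Y N)) <= r)%N) \/ (SQ N).1 u)
      (fun w => armR r (Y N) w /\ (SQ N).2 w).
    move=> w w' h [h1 h2]; split.
      by apply: dep_armR h1 => v hv; apply: h; left.
    by apply: dS h2 => v hv; apply: h; right.
  have bRS : bdd (fun u => ((u = Y N \/ (Y N).1 < u.1) /\ (vnorm (vsub u (Y N)) <= r)%N) \/ (SQ N).1 u).
    have [r1 h1] := bR r (Y N); have [r2 h2] := bS; exists (maxn r1 r2) => v [/h1|/h2] h.
      by rewrite leq_max h.
    by rewrite leq_max h orbT.
  rewrite (ev_indep perc (bdd_armL r (0, 0)) bRS (@dep_armL r (0, 0)) dRS); last first.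
    move=> v [vl _] [[vr _]|/S01 /andP[v0 _]].
      case: vl => [e1|v0]; case: vr => [e2|v1]; subst.
      - by move: Y0; rewrite -e2 ltxx.
      - by move: v1 => /(lt_trans Y0); rewrite ltxx.
      - by move: (lt_trans v0 Y0); rewrite ltxx.
      - by move: (lt_trans v0 (lt_trans Y0 v1)); rewrite ltxx.
    by case: vl v0 => [->|]; rewrite ?ltxx // => /lt_gtF ->.
  rewrite (ev_indep perc (bR r (Y N)) bS (@dep_armR r (Y N)) dS); last first.
    move=> v [vr _] /S01 /andP[_ v1]; case: vr v1 => [->|]; first by rewrite ltxx.
    by move=> /lt_gtF ->.
  rewrite (armR_prob perc) /c !EFinM.
  have h12 : (0 <= (1 / 2 : R)%:E)%E by rewrite lee_fin divr_ge0.
  have hth0 : (0 <= th%:E)%E by rewrite lee_fin ltW.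
  by apply: lee_pmul => //; [exact: mule_ge0|apply: lee_pmul].
pose E N := \bigcap_r F N r.
have mE N : measurable (E N) by exact: bigcapT_measurable.
have PE N : (N0 <= N)%N -> (c%:E <= P (E N))%E.
  move=> hN; apply: decreasing_prob_ge; first exact: mF.
    move=> r r' rr; rewrite /F hN => om [h1 [h2 h3]]; split; first exact: armL_mono h1.
    by split=> //; exact: armL_mono h2.
  by move=> r; exact: PF.
have [|om [Qom hom]] := limsup_ae_witness mE c0 _ aeQ; first by exists N0 => // N; exact: PE.
exists om; split=> // N.
have [n Nn En] := hom (maxn N N0).
have hn : (N0 <= n)%N by apply: leq_trans Nn; rewrite leq_maxr.
exists (m * n)%N.
  apply: leq_trans (leq_trans (leq_maxl N N0) Nn) _; exact: leq_pmull.
have [_ _ _ _ HQ] := hSQ n hn.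
have Fn r : F n r om by exact: En.
have Gn r : armL r (0, 0) (X om) /\ (armR r (Y n) (X om) /\ (SQ n).2 (X om)).
  by have := Fn r; rewrite /F hn.
have [_ [_ /HQ[k sk hk]]] := Gn 0%N.
exists k.
  by apply: good_of_arms => //; [exact: Ypos|move=> r; case: (Gn r)|move=> r; case: (Gn r) => _ []].
apply: le_trans hk _; apply: ler_wpM2l => //; lra.
Qed.

End Limsup.

(** * Equality of the boundary norm and the time constant *)

Section Nearest.
Context {R : realType}.
Implicit Types (x z : R * R) (u v : V).

Lemma sqrt3_gt0 : 0 < Num.sqrt 3 :> R. Proof. by rewrite sqrtr_gt0. Qed.

Lemma sqrt3_sqr : Num.sqrt 3 * Num.sqrt 3 = 3 :> R.
Proof. by rewrite -expr2 sqr_sqrtr. Qed.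

(** [scoord] and [tcoord] are the real coordinates in the lattice basis 1, e^{i pi/3}. *)
Definition tcoord x : R := x.2 * (2 / Num.sqrt 3).
Definition scoord x : R := x.1 - tcoord x / 2.

Lemma linf_le_eucl x : linf x <= eucl x.
Proof.
rewrite /linf /eucl ge_max -!sqrtr_sqr !ler_wsqrtr //; first by rewrite lerDr sqr_ge0.
by rewrite lerDl sqr_ge0.
Qed.

Lemma coord_bounds x : `|tcoord x| <= 2 * linf x /\ `|scoord x| <= 2 * linf x.
Proof.
have h1 : `|x.1| <= linf x by rewrite /linf le_max lexx.
have h2 : `|x.2| <= linf x by rewrite /linf le_max lexx orbT.
have k1 : 2 / Num.sqrt 3 <= 5 / 4 :> R.
  rewrite ler_pdivrMr ?sqrt3_gt0 //.
  have := sqrt3_sqr; have := sqrt3_gt0; nra.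
have k0 : 0 <= 2 / Num.sqrt 3 :> R by rewrite divr_ge0 // ltW // sqrt3_gt0.
have ht : `|tcoord x| <= 5 / 4 * linf x.
  by rewrite /tcoord normrM (ger0_norm k0) mulrC; apply: ler_pM.
have l0 : 0 <= linf x by apply: le_trans h1.
split; first by lra.
rewrite /scoord; apply: le_trans (ler_normB _ _) _; rewrite normrM [`|2^-1|]ger0_norm ?invr_ge0 //.
lra.
Qed.

Lemma scoord_sub x v : scoord (sub2 x (emb R v)) = scoord x - v.1%:~R /\
  tcoord (sub2 x (emb R v)) = tcoord x - v.2%:~R.
Proof.
have s0 : Num.sqrt 3 != 0 :> R by rewrite gt_eqF // sqrt3_gt0.
rewrite /scoord /tcoord /sub2 /emb /=; split; by field.
Qed.

Lemma near_bounds x v : linf (sub2 x (emb R v)) <= 1 ->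
  `|v.1%:~R - scoord x| <= 2 /\ `|v.2%:~R - tcoord x| <= 2.
Proof.
move=> h; have [h1 h2] := coord_bounds (sub2 x (emb R v)); have [e1 e2] := scoord_sub x v.
by rewrite e2 in h1; rewrite e1 in h2; rewrite distrC [X in _ /\ X <= _]distrC; split; lra.
Qed.

Lemma exists_round x : exists v, eucl (sub2 x (emb R v)) <= 1.
Proof.
have round (r : R) : exists n : int, `|r - n%:~R| <= 1 / 2.
  exists (Num.floor (r + 1 / 2)); have := floor_itv (r + 1 / 2).
  by rewrite intrD1 ler_norml => /andP[h1 h2]; apply/andP; split; lra.
have [a ha] := round (scoord x); have [b hb] := round (tcoord x).
exists (a, b); rewrite /eucl -[1 in leRHS]sqrtr1; apply: ler_wsqrtr.
have [e1 e2] := scoord_sub x (a, b); rewrite /= in e1 e2.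
set z := sub2 x (emb R (a, b)) in e1 e2 *.
have f2 : z.2 = tcoord z * Num.sqrt 3 / 2.
  by rewrite /tcoord; field; rewrite gt_eqF // sqrt3_gt0.
have f1 : z.1 = scoord z + tcoord z / 2 by rewrite /scoord subrK.
rewrite f1 f2 e1 e2.
move: (scoord x - a%:~R) (tcoord x - b%:~R) ha hb => ds dt.
rewrite !ler_norml => /andP[h1 h2] /andP[h3 h4].
have -> : (ds + dt / 2) ^+ 2 + (dt * Num.sqrt 3 / 2) ^+ 2 = ds ^+ 2 + ds * dt + dt ^+ 2 / 4 + dt ^+ 2 / 4 * (Num.sqrt 3 * Num.sqrt 3) by field.
rewrite sqrt3_sqr; nra.
Qed.

Lemma total_argmin (T : eqType) (r : T -> T -> Prop) (s : seq T) :
  (forall a b : T, r a b \/ r b a) -> (forall b a c : T, r a b -> r b c -> r a c) -> s != [::] ->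
  exists2 a : T, a \in s & forall b : T, b \in s -> r a b.
Proof.
move=> tot tr; case: s => // a s _; elim: s a => [|b s IH] a.
  by exists a; rewrite ?mem_head // => u; rewrite inE => /eqP ->; case: (tot a a).
have [v vs hv] := IH b; case: (tot a v) => h.
  exists a; first exact: mem_head.
  move=> u; rewrite inE => /orP[/eqP ->|/hv]; first by case: (tot a a).
  exact: tr.
exists v; first by rewrite inE vs orbT.
by move=> u; rewrite inE => /orP[/eqP -> //|/hv].
Qed.

Lemma emb_inj : injective (emb R).
Proof.
move=> [a b] [c e] [] /= h1 h2.
have s0 : Num.sqrt 3 != 0 :> R by rewrite gt_eqF // sqrt3_gt0.
have hb : b = e.
  apply/eqP; rewrite -(eqr_int R); apply/eqP; apply: (mulIf s0); apply: (mulIf (x := 2^-1)) => //.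
by subst e; move: h1 => /addIr /eqP; rewrite eqr_int => /eqP ->.
Qed.

(** The tie-break yields a total preorder and the bound leaves finitely many candidates. A minimizer
    therefore exists, and the default value of [xget] in [nearest] and [lnear] is never taken. *)
Lemma lex_argmin (f : V -> R) (v0 : V) (r : nat) : (forall v, f v <= f v0 -> (vnorm v <= r)%N) ->
  exists v, forall u, f v < f u \/ (f v = f u /\ lexle (emb R v) (emb R u)).
Proof.
move=> h; pose rel v u := f v < f u \/ (f v = f u /\ lexle (emb R v) (emb R u)).
have tot (x y : V) : rel x y \/ rel y x.
  rewrite /rel /lexle; case: (ltgtP (f x) (f y)) => fxy; [by left; left|by right; left|].
  case: (ltgtP (emb R x).1 (emb R y).1) => e; [by left; right; split=> //; left|by right; right; split=> //; left|].
  by case: (leP (emb R x).2 (emb R y).2) => e2; [left|right]; right; split=> //; right; split=> //; exact: ltW.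
have tr (y x z : V) : rel x y -> rel y z -> rel x z.
  rewrite /rel /lexle => -[h1|[h1 h1']] [h2|[h2 h2']].
  - by left; exact: lt_trans h1 h2.
  - by left; rewrite -h2.
  - by left; rewrite h1.
  right; split; first by rewrite h1.
  case: h1' h2' => [a1|[a1 a1']] [a2|[a2 a2']]; [left; exact: lt_trans a1 a2|left; by rewrite -a2|left; by rewrite a1|].
  by right; split; [rewrite a1|exact: le_trans a1' a2'].
have [|v _ hv] := @total_argmin _ rel (v0 :: box r) tot tr; first by [].
exists v => u; case: (leP (f u) (f v0)) => fu.
  by apply: hv; rewrite inE mem_box h // orbT.
have := hv v0 (mem_head _ _); case=> [h1|[h1 _]]; left; first exact: lt_trans h1 fu.
by rewrite h1.
Qed.

Lemma near_finite x : exists r, forall v, linf (sub2 x (emb R v)) <= 1 -> (vnorm v <= r)%N.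
Proof.
exists (maxn (Num.truncn (`|scoord x| + 2)) (Num.truncn (`|tcoord x| + 2))) => v /near_bounds[h1 h2].
have H (n : int) (q : R) : `|n%:~R - q| <= 2 -> (`|n| <= Num.truncn (`|q| + 2))%N.
  move=> h; rewrite truncn_ge_nat ?addr_ge0 // natr_absz intr_norm.
  by have := ler_normD (n%:~R - q) q; rewrite subrK; lra.
by rewrite /vnorm geq_max !leq_max (H _ _ h1) (H _ _ h2) orbT.
Qed.

Lemma nearest_linf x : linf (sub2 x (emb R (nearest x))) <= 1.
Proof.
have [v0 hv0] := exists_round x; have [r hr] := near_finite x.
have [|v hv] := @lex_argmin (fun v => eucl (sub2 x (emb R v))) v0 r.
  by move=> v h; apply: hr; apply: le_trans (linf_le_eucl _) (le_trans h hv0).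
have h u : eucl (sub2 x (emb R (nearest x))) < eucl (sub2 x (emb R u)) \/
    (eucl (sub2 x (emb R (nearest x))) = eucl (sub2 x (emb R u)) /\ lexle (emb R (nearest x)) (emb R u)).
  by move: u; rewrite /nearest; case: xgetP => [u _ //|/(_ v)]; case.
apply: le_trans (linf_le_eucl _) (le_trans _ hv0).
by case: (h v0) => [/ltW//|[-> _]].
Qed.

(** [tildeC] without the restriction to the infinite cluster: a deterministic vertex, equal to
    [tildeC] as soon as it belongs to the cluster. *)
Definition lnear x : V := xget (0, 0) [set v | forall u,
  linf (sub2 x (emb R v)) < linf (sub2 x (emb R u)) \/
  (linf (sub2 x (emb R v)) = linf (sub2 x (emb R u)) /\ lexle (emb R v) (emb R u))].

Lemma lnear_spec x u : linf (sub2 x (emb R (lnear x))) < linf (sub2 x (emb R u)) \/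
  (linf (sub2 x (emb R (lnear x))) = linf (sub2 x (emb R u)) /\ lexle (emb R (lnear x)) (emb R u)).
Proof.
have [v0 hv0] := exists_round x; have [r hr] := near_finite x.
have [|v hv] := @lex_argmin (fun v => linf (sub2 x (emb R v))) v0 r.
  by move=> v h; apply: hr; apply: le_trans h (le_trans (linf_le_eucl _) hv0).
by move: u; rewrite /lnear; case: xgetP => [u _ //|/(_ v)]; case.
Qed.

Lemma lnear_linf x : linf (sub2 x (emb R (lnear x))) <= 1.
Proof.
have [v0 hv0] := exists_round x; apply: le_trans (le_trans (linf_le_eucl _) hv0).
by case: (lnear_spec x v0) => [/ltW//|[-> _]].
Qed.

Lemma lexle_anti (a b : R * R) : lexle a b -> lexle b a -> a = b.
Proof.
case: a b => a1 a2 [b1 b2] [/= h1|[/= h1 h2]] [/= h3|[/= h3 h4]].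
- by move: (lt_trans h1 h3); rewrite ltxx.
- by move: h1; rewrite h3 ltxx.
- by move: h3; rewrite h1 ltxx.
- by congr pair => //; apply/eqP; rewrite eq_le h2.
Qed.

Lemma tildeC_lnear w x : Cinf w (lnear x) -> tildeC w x = lnear x.
Proof.
move=> hC; apply: xget_subset1.
  by split=> // u _; exact: lnear_spec.
move=> u v [Cu hu] [Cv hv]; apply: emb_inj.
case: (hu v Cv) => [h1|[h1 l1]]; case: (hv u Cu) => [h2|[h2 l2]].
- by move: (lt_trans h1 h2); rewrite ltxx.
- by move: h1; rewrite h2 ltxx.
- by move: h2; rewrite h1 ltxx.
- exact: lexle_anti.
Qed.

Lemma lnear0 : lnear (0, 0) = (0, 0).
Proof.
apply: emb_inj.
have e0 : linf (sub2 (0, 0) (emb R (0, 0))) = 0.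
  by rewrite /linf /sub2 /emb /= !(mul0r, mul1r, addr0, subr0, normr0, maxxx).
have l0 z : 0 <= linf z by rewrite /linf le_max normr_ge0.
case: (lnear_spec (0, 0) (0, 0)); rewrite e0; first by rewrite ltNge l0.
have g z : `|z.1| <= linf z /\ `|z.2| <= linf z by rewrite /linf !le_max !lexx orbT.
move=> [h _]; have := g (sub2 (0, 0) (emb R (lnear (0, 0)))); rewrite h.
rewrite !normr_le0 /sub2 /= !sub0r !oppr_eq0 => -[/eqP h1 /eqP h2].
by rewrite /emb /= h1 h2 !(mul0r, addr0).
Qed.

End Nearest.

Section Limits.
Context {R : realType}.

Lemma cvg_div_bounded (u v : nat -> R) (C l : R) : (forall n, `|u n - v n| <= C) ->
  (fun n => u n / n%:R) @ \oo --> l -> (fun n => v n / n%:R) @ \oo --> l.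
Proof.
move=> h cu; apply/cvgrPdist_le => e e0.
have e2 : 0 < e / 2 by rewrite divr_gt0.
move/cvgrPdist_le: cu => /(_ _ e2)[N _ HN].
exists (maxn N (Num.truncn (C / (e / 2))).+1) => // n /=; rewrite geq_max => /andP[nN nC].
have n0 : 0 < n%:R :> R by rewrite ltr0n (leq_trans _ nC).
have hC : C <= e / 2 * n%:R.
  rewrite mulrC -ler_pdivrMr //; apply: le_trans (ltW (truncnS_gt _)) _.
  by rewrite ler_nat.
have := HN n nN => /= h1.
have -> : l - v n / n%:R = (l - u n / n%:R) + (u n - v n) / n%:R.
  by field; rewrite gt_eqF.
apply: le_trans (ler_normD _ _) _; rewrite [e]splitr; apply: lerD => //.
rewrite normrM [`|n%:R^-1|]gtr0_norm ?invr_gt0 // ler_pdivrMr //.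
exact: le_trans (h n) hC.
Qed.

Lemma limit_le_often (u v : nat -> R) (l m : R) : u @ \oo --> l -> v @ \oo --> m ->
  (forall N, exists2 n, (N <= n)%N & u n <= v n) -> l <= m.
Proof.
move=> cu cv h; rewrite leNgt; apply/negP => ml.
have e0 : 0 < (l - m) / 2 by rewrite divr_gt0 // subr_gt0.
move/cvgrPdist_lt: cu => /(_ _ e0)[N1 _ H1]; move/cvgrPdist_lt: cv => /(_ _ e0)[N2 _ H2].
have [n nN uv] := h (maxn N1 N2); move: nN; rewrite geq_max => /andP[n1 n2].
have := H1 n n1; have := H2 n n2; rewrite /= !ltr_norml => /andP[a1 a2] /andP[a3 a4].
lra.
Qed.

End Limits.

Lemma Tn_lip w a b b' : (Tn w a b <= Tn w a b' + (2 * vnorm (vsub b' b)).+1)%N.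
Proof.
apply: leq_trans (Tn_tri w b' a b) _; rewrite leq_add2l; apply: leq_trans (Tn_dist _ _ _) _.
by rewrite ltnS mul2n -addnn /vsub /vnorm; apply: leq_add; [exact: leq_maxl|exact: leq_maxr].
Qed.

Lemma Tn_lipl w a a' b : (Tn w a b <= Tn w a' b + (2 * vnorm (vsub a a')).+1)%N.
Proof.
apply: leq_trans (Tn_tri w a' a b) _; rewrite addnC leq_add2l; apply: leq_trans (Tn_dist _ _ _) _.
by rewrite ltnS mul2n -addnn /vsub /vnorm; apply: leq_add; [exact: leq_maxl|exact: leq_maxr].
Qed.

Lemma Tn_diff (R : realType) w a b a' b' (C D : nat) :
  (vnorm (vsub a a') <= C)%N -> (vnorm (vsub b b') <= D)%N ->
  `|(Tn w a b)%:R - (Tn w a' b')%:R| <= (2 * C + 2 * D + 2)%:R :> R.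
Proof.
move=> hC hD; have h1 := Tn_lip w a b b'; have h2 := Tn_lipl w a a' b'.
have h3 := Tn_lip w a' b' b; have h4 := Tn_lipl w a' a b.
rewrite (vnorm_subC b' b) in h1; rewrite (vnorm_subC a' a) in h4.
move: h1 h2 h3 h4 hC hD; move: (vnorm _) (vnorm _) (Tn _ _ _) (Tn _ _ _) (Tn _ _ _) (Tn _ _ _).
move=> x y t1 t2 t3 t4 h1 h2 h3 h4 hC hD.
rewrite ler_norml lerBlDr lerBrDl -!natrD; apply/andP; split.
  by rewrite lerBlDr -natrD ler_nat; lia.
by rewrite ler_nat; lia.
Qed.

Section Norm.
Context {R : realType}.

Lemma coord_diff (q q' : R) (a b : int) (c C : nat) :
  `|a%:~R - q| <= 2 -> `|b%:~R - q'| <= 2 -> `|q - q'| <= c%:R -> (4 + c <= C)%N -> (`|a - b| <= C)%N.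
Proof.
move=> h1 h2 h3 h4; rewrite -(ler_nat R) natr_absz intr_norm rmorphB /=.
have h5 : 4 + c%:R <= C%:R :> R by rewrite -natrD ler_nat.
have -> : a%:~R - b%:~R = (a%:~R - q) + (q - q') + - (b%:~R - q') :> R by ring.
apply: le_trans (ler_normD _ _) _; rewrite normrN; apply: le_trans (lerD (ler_normD _ _) (lexx _)) _.
lra.
Qed.

Lemma coord_scale (a : R) x : scoord (scal2 a x) = a * scoord x /\ tcoord (scal2 a x) = a * tcoord x.
Proof. by rewrite /scoord /tcoord /scal2 /=; split; ring. Qed.

Lemma vnorm_near (x x' : R * R) v v' (c C : nat) :
  linf (sub2 x (emb R v)) <= 1 -> linf (sub2 x' (emb R v')) <= 1 ->
  `|scoord x - scoord x'| <= c%:R -> `|tcoord x - tcoord x'| <= c%:R -> (4 + c <= C)%N ->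
  (vnorm (vsub v v') <= C)%N.
Proof.
move=> /near_bounds[h1 h2] /near_bounds[h3 h4] hs ht cC.
by rewrite /vnorm geq_max (coord_diff h1 h3 hs cC) (coord_diff h2 h4 ht cC).
Qed.

Context {d : measure_display} {Om : measurableType d} (P : probability Om R).
Variables (X : Om -> V -> bool) (mu : R * R -> R).
Hypothesis hmu : forall z : R * R,
  {ae P, forall om, (fun n : nat => Tpt (X om) ((0, 0) : R * R) (scal2 n%:R z) / n%:R) @ \oo --> mu z}.

(** Moving an end point by a bounded distance changes T by a bounded amount, so the choice of
    vertices near n z is free. *)
Lemma T_near (y : nat -> V) z (C : nat) :
  (forall n, `|(y n).1%:~R - n%:R * scoord z| <= C%:R) ->
  (forall n, `|(y n).2%:~R - n%:R * tcoord z| <= C%:R) ->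
  {ae P, forall om, (fun n => (Tn (X om) (0, 0) (y n))%:R / n%:R : R) @ \oo --> mu z}.
Proof.
move=> h1 h2; apply: filterS (hmu z) => om.
pose K := (2 * 4 + 2 * (C + 4) + 2)%N.
apply: (@cvg_div_bounded _ (fun n => Tpt (X om) ((0, 0) : R * R) (scal2 n%:R z)) _ K%:R) => n.
rewrite /Tpt Tvert_Tn; apply: Tn_diff.
  have e0 : linf (sub2 (0, 0) (emb R (0, 0))) <= 1.
    by rewrite /linf /sub2 /emb /= !(mul0r, addr0, subr0, normr0, maxxx).
  by apply: (vnorm_near (c := 0) (nearest_linf _) e0); rewrite ?subrr ?normr0.
have [b1 b2] := near_bounds (nearest_linf (scal2 n%:R z)).
have [e1 e2] := coord_scale n%:R z; rewrite e1 in b1; rewrite e2 in b2.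
have H (a b : int) (q : R) : `|a%:~R - q| <= 2 -> `|b%:~R - q| <= C%:R -> (`|a - b| <= C + 4)%N.
  move=> g1 g2; rewrite -(ler_nat R) natr_absz intr_norm rmorphB /= natrD.
  have -> : a%:~R - b%:~R = (a%:~R - q) - (b%:~R - q) :> R by ring.
  by apply: le_trans (ler_normB _ _) _; lra.
by rewrite /vnorm geq_max (H _ _ _ b1 (h1 n)) (H _ _ _ b2 (h2 n)).
Qed.

Lemma T_lnear z : {ae P, forall om,
  (fun n => (Tn (X om) (0, 0) (lnear (scal2 n%:R z)))%:R / n%:R : R) @ \oo --> mu z}.
Proof.
apply: (@T_near _ z 2) => n; have [b1 b2] := near_bounds (lnear_linf (scal2 n%:R z)).
  by have [e1 _] := coord_scale n%:R z; rewrite -e1.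
by have [_ e2] := coord_scale n%:R z; rewrite -e2.
Qed.

Lemma ae_witness (Q : Om -> Prop) : {ae P, forall om, Q om} -> exists om, Q om.
Proof.
move=> h; have [|om [Qom _]] := @limsup_ae_witness _ _ _ P (fun=> setT) (fun=> measurableT) 1 Q ltr01 _ h.
  by near=> n; rewrite probability_setT.
by exists om.
Unshelve. all: by end_near.
Qed.

(** With k the integer part of a n, the points k z and n a z stay at bounded distance, and k / n
    tends to a. *)
Lemma mu_scale (a : R) z : 0 < a -> mu (scal2 a z) = a * mu z.
Proof.
move=> a0; pose k n := Num.truncn (a * n%:R).
have k1 n : (k n)%:R <= a * n%:R by rewrite truncn_le mulr_ge0 // ltW.
have k2 n : a * n%:R < (k n)%:R + 1 by have := truncnS_gt (a * n%:R); rewrite -addn1 natrD.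
pose C := ((Num.truncn `|scoord z|).+1 + (Num.truncn `|tcoord z|).+1 + 2)%N.
have bnd (q : R) m : `|q| <= (Num.truncn `|q|).+1%:R -> forall n,
    `|m - (k n)%:R * q| <= 2 -> `|m - n%:R * (a * q)| <= ((Num.truncn `|q|).+1 + 2)%:R.
  move=> hq n hm.
  have -> : m - n%:R * (a * q) = (m - (k n)%:R * q) - (a * n%:R - (k n)%:R) * q by ring.
  apply: le_trans (ler_normB _ _) _; rewrite natrD addrC; apply: lerD => //.
  rewrite normrM -[leRHS]mul1r; apply: ler_pM => //.
  by rewrite ger0_norm ?subr_ge0 //; have := k2 n; lra.
have hq (q : R) : `|q| <= (Num.truncn `|q|).+1%:R by exact: ltW (truncnS_gt _).
have [es et] := coord_scale a z.
have A1 := @T_near (fun n => lnear (scal2 (k n)%:R z)) (scal2 a z) C _ _.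
have {A1} A1 : {ae P, forall om, (fun n => (Tn (X om) (0, 0) (lnear (scal2 (k n)%:R z)))%:R / n%:R : R)
    @ \oo --> mu (scal2 a z)}.
  apply: A1 => n; have [b1 b2] := near_bounds (lnear_linf (scal2 (k n)%:R z)).
    have [e1 _] := coord_scale (k n)%:R z; rewrite e1 in b1; rewrite es.
    apply: le_trans (bnd _ _ (hq _) n b1) _; rewrite ler_nat /C; lia.
  have [_ e2] := coord_scale (k n)%:R z; rewrite e2 in b2; rewrite et.
  apply: le_trans (bnd _ _ (hq _) n b2) _; rewrite ler_nat /C; lia.
have [om [c1 c2]] : exists om,
    (fun n => (Tn (X om) (0, 0) (lnear (scal2 (k n)%:R z)))%:R / n%:R : R) @ \oo --> mu (scal2 a z) /\
    (fun n => (Tn (X om) (0, 0) (lnear (scal2 n%:R z)))%:R / n%:R : R) @ \oo --> mu z.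
  apply: ae_witness; apply: filterS2 A1 (T_lnear z) => om c1 c2; by split.
have kinf : k @ \oo --> \oo.
  apply/cvgnyPge => A; exists (Num.truncn (A%:R / a)).+1 => // n /= hn.
  rewrite /k truncn_ge_nat; last by rewrite mulr_ge0 // ltW.
  rewrite -ler_pdivrMl // mulrC.
  by apply: le_trans (ltW (truncnS_gt _)) _; rewrite ler_nat.
have kn : (fun n => (k n)%:R / n%:R : R) @ \oo --> a.
  apply: (@cvg_div_bounded _ (fun n => a * n%:R) _ 1) => [n|].
    by rewrite ger0_norm ?subr_ge0 //; have := k2 n; lra.
  have cc : (fun _ : nat => a) @ \oo --> a by exact: cvg_cst.
  apply: cvg_trans cc; apply: near_eq_cvg; exists 1%N => // n /= n0.
  by rewrite mulfK // pnatr_eq0 -lt0n.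
have c3 := cvg_comp _ _ kinf c2.
have c4 : (fun n => (Tn (X om) (0, 0) (lnear (scal2 (k n)%:R z)))%:R / (k n)%:R * ((k n)%:R / n%:R) : R)
    @ \oo --> mu z * a.
  by apply: (@cvgM _ _ \oo _ (fun n => (Tn (X om) (0, 0) (lnear (scal2 (k n)%:R z)))%:R / (k n)%:R : R)
    (fun n => (k n)%:R / n%:R : R)).
have c5 : (fun n => (Tn (X om) (0, 0) (lnear (scal2 (k n)%:R z)))%:R / n%:R : R) @ \oo --> mu z * a.
  refine (cvg_trans _ c4); apply: near_eq_cvg.
  have /cvgnyPge/(_ 1%N)[N0 _ hN0] := kinf.
  by exists N0 => // n /hN0 /= kn1; rewrite mulrA divfK // pnatr_eq0 -lt0n.
rewrite mulrC; exact: (cvg_unique (@Rhausdorff R) c1 c5).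
Qed.

Lemma scal2_0 (a : R) : scal2 a (0, 0) = (0, 0).
Proof. by rewrite /scal2 /= mulr0. Qed.

Lemma mu0 : mu (0, 0) = 0.
Proof. have := mu_scale (0, 0) (ltr0n R 2); rewrite scal2_0; lra. Qed.

End Norm.

Definition vscale (k : nat) (v : V) : V := (k%:Z * v.1, k%:Z * v.2).

(** Every far vertex is close to an integer multiple of a vertex from a fixed finite box, so that
    finitely many directions control all of them. *)
Lemma vnorm_vscale_near (Q k : nat) (x : V) : (2 <= Q)%N -> k = (vnorm x %/ Q)%N -> (0 < k)%N ->
  exists v, [/\ (vnorm (vsub x (vscale k v)) <= k)%N, (vnorm v <= 2 * Q + 1)%N & (Q <= (vnorm v).+1)%N].
Proof.
move=> Q2 ek k0; have en := divn_eq (vnorm x) Q; have em := ltn_pmod (vnorm x) (ltnW Q2).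
rewrite -ek in en; have n1 : (k * Q <= vnorm x)%N by rewrite en leq_addr.
have n2 : (vnorm x < k * Q + Q)%N by rewrite en ltn_add2l.
have kz : k%:Z != 0 by lia.
have H (a : int) : (absz a <= vnorm x)%N -> [/\ (absz (a - k%:Z * (a %/ k%:Z)%Z)%R <= k)%N,
    (absz (a %/ k%:Z)%Z <= 2 * Q + 1)%N & (k * Q <= absz a -> Q <= (absz (a %/ k%:Z)%Z).+1)%N].
  move=> ax; have e := divz_eq a k; have r1 := modz_ge0 a kz; have r2 := ltz_pmod a (d := k) ltac:(lia).
  move: (a %% k)%Z (a %/ k)%Z e r1 r2 => r q e r1 r2.
  have kq : (absz (k%:Z * q)%R = k * absz q)%N by rewrite abszM absz_nat.
  split.
  - rewrite e; move: (q * k%:Z) (k%:Z * q) (mulrC q k%:Z) => ? ? ->; lia.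
  - have : (k * absz q <= k * (2 * Q + 1))%N.
      rewrite -kq mulrC; have : (k * Q + Q + k <= k * (2 * Q + 1))%N by nia.
      have : (absz (q * k%:Z)%R <= k * Q + Q + k)%N by lia.
      exact: leq_trans.
    by rewrite leq_pmul2l.
  - move=> ka; rewrite -(leq_pmul2l k0) mulnS -kq mulrC.
    have : (absz a <= absz (q * k%:Z)%R + k)%N by lia.
    by rewrite addnC; exact: leq_trans.
have [a1 a2 a3] := H x.1 (leq_maxl _ _); have [b1 b2 b3] := H x.2 (leq_maxr _ _).
exists ((x.1 %/ k)%Z, (x.2 %/ k)%Z); split.
- by rewrite /vnorm /vsub /vscale /= geq_max a1 b1.
- by rewrite /vnorm /= geq_max a2 b2.
rewrite /vnorm /= -maxnSS leq_max.
by move: n1; rewrite {1}/vnorm leq_max => /orP[/a3 ->|/b3 ->]; rewrite ?orbT.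
Qed.

Lemma seq_eventually (T : eqType) (s : seq T) (Q : T -> nat -> Prop) :
  (forall v, v \in s -> exists N, forall n, (N <= n)%N -> Q v n) ->
  exists N, forall n, (N <= n)%N -> forall v, v \in s -> Q v n.
Proof.
elim: s => [|a s IH] h; first by exists 0%N.
have [|N1 H1] := IH; first by move=> v vs; apply: h; rewrite inE vs orbT.
have [N2 H2] := h a (mem_head _ _).
exists (maxn N1 N2) => n; rewrite geq_max => /andP[n1 n2] v; rewrite inE => /orP[/eqP ->|].
  exact: H2.
exact: H1.
Qed.

Section Norm.
Context {R : realType} {d : measure_display} {Om : measurableType d} (P : probability Om R).
Variables (X : Om -> V -> bool) (mu : R * R -> R).
Hypothesis hmu : forall z : R * R,
  {ae P, forall om, (fun n : nat => Tpt (X om) ((0, 0) : R * R) (scal2 n%:R z) / n%:R) @ \oo --> mu z}.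

Lemma ae_seq (T : eqType) (s : seq T) (Q : T -> Om -> Prop) :
  (forall v, {ae P, forall om, Q v om}) -> {ae P, forall om, forall v, v \in s -> Q v om}.
Proof.
move=> h; elim: s => [|a s IH]; first by apply: aeW.
apply: filterS2 (h a) IH => om Qa Qs v; rewrite inE => /orP[/eqP -> //|].
exact: Qs.
Qed.

Lemma emb_coord v : scoord (emb R v) = v.1%:~R /\ tcoord (emb R v) = v.2%:~R.
Proof.
have s0 : Num.sqrt 3 != 0 :> R by rewrite gt_eqF // sqrt3_gt0.
by rewrite /scoord /tcoord /emb /=; split; field.
Qed.

Lemma vnorm_eucl v : (vnorm v)%:R <= 2 * eucl (emb R v).
Proof.
have [h1 h2] := coord_bounds (emb R v); have [e1 e2] := emb_coord v; rewrite e1 in h2; rewrite e2 in h1.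
have h3 := linf_le_eucl (emb R v).
rewrite /vnorm; case: (leqP `|v.1|%N `|v.2|%N) => h; rewrite natr_absz intr_norm; lra.
Qed.

Lemma eucl_scal (a : R) z : 0 <= a -> eucl (scal2 a z) = a * eucl z.
Proof.
move=> a0; rewrite /eucl /scal2 /= !exprMn -mulrDr sqrtrM ?sqr_ge0 //.
by rewrite sqrtr_sqr ger0_norm.
Qed.

Lemma eucl_ge0 (z : R * R) : 0 <= eucl z. Proof. exact: sqrtr_ge0. Qed.

Lemma eucl_eq0 (z : R * R) : eucl z = 0 -> z = (0, 0).
Proof.
move=> /eqP; rewrite sqrtr_eq0 => h.
have h1 := sqr_ge0 z.1; have h2 := sqr_ge0 z.2.
have /eqP : z.1 ^+ 2 = 0 by lra.
have /eqP : z.2 ^+ 2 = 0 by lra.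
rewrite !sqrf_eq0 => /eqP e2 /eqP e1.
by rewrite [z]surjective_pairing e1 e2.
Qed.

Lemma homog_polar (rho : R * R -> R) : rho (0, 0) = 0 -> (forall a z, 0 < a -> rho (scal2 a z) = a * rho z) ->
  forall z, exists2 u, (eucl z != 0 -> eucl u = 1) & rho z = eucl z * rho u.
Proof.
move=> r0 rh z; case: (eqVneq (eucl z) 0) => ez.
  by exists z => //; rewrite ez mul0r (eucl_eq0 ez).
have z0 : 0 < eucl z by rewrite lt_neqAle eq_sym ez eucl_ge0.
exists (scal2 (eucl z)^-1 z) => [_|].
  by rewrite eucl_scal ?invr_ge0 ?eucl_ge0 // mulVf.
by rewrite rh ?invr_gt0 // mulVKf.
Qed.

Variable c0 : R.
Hypothesis c00 : 0 < c0.
Hypothesis mu_unit : forall z, eucl z = 1 -> c0 <= mu z.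

Lemma mu_lower z : c0 * eucl z <= mu z.
Proof.
have [u hu ->] := homog_polar (mu0 hmu) (mu_scale hmu) z.
case: (eqVneq (eucl z) 0) => [->|ez]; first by rewrite mulr0 mul0r.
by rewrite mulrC ler_wpM2l ?eucl_ge0 // mu_unit // hu.
Qed.

(** Convergence along the multiples of each v in the box is eventually simultaneous. Writing x as k
    v up to distance k, T(0, kv) >= 4k leaves T(0, x) >= 4k - (2k + 1) >= k, while |x| < (k + 1) Q
    <= 2 Q k. *)
Lemma lin_growth : exists K, {ae P, forall om, exists n0, forall x, (n0 <= vnorm x)%N ->
  (vnorm x <= K * Tn (X om) (0, 0)%R x)%N}.
Proof.
(* Since |v| >= Q - 1 in the max-norm, which is at most twice the Euclidean norm, this choice gives
   mu(v) >= 5: one unit is lost to convergence. *)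
pose Q := ((Num.truncn (10 / c0)).+1 + 2)%N.
have hQ : 10 <= c0 * (Q%:R - 1).
  have h1 : 10 / c0 <= (Num.truncn (10 / c0)).+1%:R by exact: ltW (truncnS_gt _).
  rewrite /Q natrD -ler_pdivrMl // mulrC; lra.
exists (2 * Q)%N.
have := ae_seq (box (2 * Q + 1)) (fun v => T_near hmu (y := fun k => vscale k v) (z := emb R v) (C := 0%N) _ _).
move=> H; apply: filterS (H _ _) => [om hom| |].
- have [N HN] : exists N, forall n, (N <= n)%N -> forall v, v \in box (2 * Q + 1) ->
      mu (emb R v) - 1 <= (Tn (X om) (0, 0) (vscale n v))%:R / n%:R.
    apply: seq_eventually => v vb; move/cvgrPdist_lt: (hom v vb) => /(_ _ ltr01)[N _ HN].
    exists N => n /HN /=; rewrite ltr_norml => /andP[_]; lra.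
  exists (Q * N.+1)%N => x xn; pose k := (vnorm x %/ Q)%N.
  have Q2 : (2 <= Q)%N by rewrite /Q addn2.
  have kN : (N < k)%N by rewrite /k leq_divRL ?(ltnW Q2) // mulnC.
  have k0 : (0 < k)%N by apply: leq_ltn_trans kN.
  have [v [h1 h2 h3]] := vnorm_vscale_near Q2 (erefl k) k0.
  have h4 := HN k (ltnW kN) v; rewrite mem_box in h4.
  have k0R : 0 < k%:R :> R by rewrite ltr0n.
  have h5 : (mu (emb R v) - 1) * k%:R <= (Tn (X om) (0, 0) (vscale k v))%:R.
    by rewrite -ler_pdivlMr //; apply: h4.
  have h6 := Tn_lip (X om) (0, 0) (vscale k v) x.
  have h7 : 5 <= mu (emb R v).
    have := mu_lower (emb R v); have := vnorm_eucl v.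
    have : Q%:R - 1 <= (vnorm v)%:R :> R by rewrite lerBlDr -[1]/(1%:R) -natrD ler_nat addn1.
    move=> g1 g2 g3.
    have : c0 * (Q%:R - 1) <= c0 * (2 * eucl (emb R v)) by rewrite ler_pM2l //; lra.
    lra.
  have h8 : (4 * k <= Tn (X om) (0, 0)%R (vscale k v))%N.
    rewrite -(ler_nat R) natrM; apply: le_trans h5; rewrite ler_pM2r //; lra.
  have h9 : (k <= Tn (X om) (0, 0)%R x)%N by lia.
  have : (vnorm x < k.+1 * Q)%N by rewrite /k -ltn_divLR // ltnW.
  move=> h10; apply: leq_trans (ltnW h10) _; apply: (@leq_trans (2 * Q * k)); first by nia.
  by rewrite leq_mul2l h9 orbT.
- move=> v n; have [-> _] := emb_coord v; rewrite /vscale /= intrM -pmulrn subrr normr0 //.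
- move=> v n; have [_ ->] := emb_coord v; rewrite /vscale /= intrM -pmulrn subrr normr0 //.
Qed.

Variables (p : R) (beta : R * R -> R).
Hypothesis p0 : 0 < p.
Hypothesis perc : site_percolation P X p.
Hypothesis hbeta : forall x : R * R, {ae P, forall om, (fun n : nat =>
  bdist R (X om) (tildeC (X om) ((0, 0) : R * R)) (tildeC (X om) (scal2 n%:R x)) / n%:R) @ \oo --> beta x}.

(** f is a lattice symmetry turning the direction x into one of positive first coordinate s. The
    good configurations of the reflected percolation are carried back by [good_relabel], and both
    inequalities are read along infinitely many n. *)
Lemma beta_eq_mu_dir (f : V -> V) (s t : R) (x : R * R) : involutive f -> f (0, 0) = (0, 0) ->
  (forall u v, adjb (f u) (f v) = adjb u v) -> (forall v, vnorm (f v) = vnorm v) -> 0 < s ->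
  (forall n, `|(f (lnear (scal2 n%:R x))).1%:~R - s * n%:R| <= 2) ->
  (forall n, `|(f (lnear (scal2 n%:R x))).2%:~R - t * n%:R| <= 2) ->
  beta x = mu x.
Proof.
move=> fK f0 fa fn s0 h1 h2.
have perc' := percolation_relabel fK perc.
have [K lin] := lin_growth.
have hT x' : {ae P, forall om, (fun n => (Tn (X om) (0, 0) (lnear (scal2 n%:R x')))%:R / n%:R : R) @ \oo --> mu x'}.
  exact: T_lnear hmu x'.
have Tf om u : Tn (fun v => X om (f v)) (0, 0) u = Tn (X om) (0, 0) (f u).
  by rewrite (Tn_relabel _ _ _ fK fK fa) f0.
have lin' : {ae P, forall om, exists n0, forall x, (n0 <= vnorm x)%N ->
    (vnorm x <= K * Tn (fun v => X om (f v)) (0, 0)%R x)%N}.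
  apply: filterS lin => om [n0 hn]; exists n0 => u hu.
  by rewrite Tf -[in X in (X <= _)%N](fn u); apply: hn; rewrite fn.
have hT' : {ae P, forall om, (fun n => (Tn (fun v => X om (f v)) (0, 0) (f (lnear (scal2 n%:R x))))%:R / n%:R : R) @ \oo --> mu x}.
  apply: filterS (hT x) => om; apply: cvg_trans; apply: near_eq_cvg; exists 0%N => // n _ /=.
  by rewrite Tf fK.
have key (e : R) : 0 < e -> mu x <= beta x <= mu x + e.
  move=> e0.
  have aeQ : {ae P, forall om,
     (exists n0, forall x, (n0 <= vnorm x)%N -> (vnorm x <= K * Tn (X om) (0, 0)%R x)%N) /\
     ((fun n => (Tn (X om) (0, 0) (lnear (scal2 n%:R x)))%:R / n%:R : R) @ \oo --> mu x /\
      (fun n : nat => bdist R (X om) (tildeC (X om) ((0, 0) : R * R)) (tildeC (X om) (scal2 n%:R x)) / n%:R)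
        @ \oo --> beta x)}.
    apply: filterS2 lin (filterI (hT x) (hbeta x)) => om h3 [h4 h5]; by split.
  have [om [[hlin [hTm hb]] hgood]] := good_limsup perc' p0 lin' s0 h1 h2 hT' e0 aeQ.
  have fin := lin_closed_finite hlin.
  have hn N : exists2 n, (N <= n)%N &
     bdist R (X om) (tildeC (X om) ((0, 0) : R * R)) (tildeC (X om) (scal2 n%:R x)) <= n%:R * (mu x + e) /\
     (Tn (X om) (0, 0) (lnear (scal2 n%:R x)))%:R <=
       bdist R (X om) (tildeC (X om) ((0, 0) : R * R)) (tildeC (X om) (scal2 n%:R x)) + 2.
    have [n nN [k gk hk]] := hgood N; exists n => //.
    have gk' := good_relabel fK f0 fa fn gk; rewrite fK in gk'.
    have [C0 CY b1 b2] := good_bdist R fin gk'.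
    rewrite (tildeC_lnear CY) (@tildeC_lnear _ _ (0, 0)) ?lnear0 //.
    by split=> //; apply: le_trans hk.
  apply/andP; split.
    have hb' : (fun n : nat => (bdist R (X om) (tildeC (X om) ((0, 0) : R * R)) (tildeC (X om) (scal2 n%:R x)) + 2) / n%:R)
        @ \oo --> beta x.
      by apply: (@cvg_div_bounded _ _ _ 2) hb => n; rewrite opprD addrA subrr sub0r normrN ger0_norm.
    apply: (limit_le_often hTm hb') => N; have [n nN [_ h3]] := hn N; exists n => //.
    by rewrite ler_wpM2r ?invr_ge0.
  have hc : (fun _ : nat => mu x + e) @ \oo --> mu x + e by exact: cvg_cst.
  apply: (limit_le_often hb hc) => N; have [n nN [h3 _]] := hn N.+1; exists n; first exact: ltnW.
  by rewrite ler_pdivrMr ?ltr0n ?(leq_trans _ nN) // mulrC.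
apply/eqP; rewrite eq_le; have /andP[-> _] := key 1 ltr01; rewrite andbT.
by apply/ler_addgt0Pr => e e0; have /andP[] := key e e0.
Qed.

Lemma beta_eq_mu x : beta x = mu x.
Proof.
case: (eqVneq x (0, 0)) => [->|x0].
  rewrite (mu0 hmu).
  have [om hom] := ae_witness (hbeta (0, 0)).
  have : (fun n : nat => bdist R (X om) (tildeC (X om) ((0, 0) : R * R)) (tildeC (X om) ((0, 0) : R * R)) / n%:R) @ \oo --> beta (0, 0).
    by apply: cvg_trans hom; apply: near_eq_cvg; exists 0%N => // n _ /=; rewrite scal2_0.
  move=> h; have h0 : (fun n : nat => (0 : R) / n%:R) @ \oo --> beta (0, 0).
    by apply: (@cvg_div_bounded _ _ (fun=> 0) `|bdist R (X om) (tildeC (X om) ((0, 0) : R * R)) (tildeC (X om) ((0, 0) : R * R))|) h => n; rewrite subr0.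
  have h1 : (fun n : nat => (0 : R) / n%:R) @ \oo --> (0 : R).
    have cc : (fun _ : nat => 0 : R) @ \oo --> (0 : R) by exact: cvg_cst.
    by apply: cvg_trans cc; apply: near_eq_cvg; exists 0%N => // n _ /=; rewrite mul0r.
  exact: (cvg_unique (@Rhausdorff R) h0 h1).
have nb n := near_bounds (lnear_linf (scal2 n%:R x)).
have cs n := coord_scale n%:R x.
have hs n : `|(lnear (scal2 n%:R x)).1%:~R - scoord x * n%:R| <= 2.
  by have [b1 _] := nb n; have [e1 _] := cs n; rewrite mulrC -e1.
have ht n : `|(lnear (scal2 n%:R x)).2%:~R - tcoord x * n%:R| <= 2.
  by have [_ b2] := nb n; have [_ e2] := cs n; rewrite mulrC -e2.
have neg (a : int) (q : R) n : `|a%:~R - q * n%:R| <= 2 -> `|(- a)%:~R - - q * n%:R| <= 2.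
  by move=> h; rewrite mulNr intrN opprK addrC distrC.
have s3 : Num.sqrt 3 != 0 :> R by rewrite gt_eqF // sqrt3_gt0.
(* The sign of the first coordinate is corrected by the point reflection; if that coordinate
   vanishes, the swap of the coordinates, possibly with a change of signs, makes it positive. *)
case: (ltgtP (scoord x) 0) => hsx.
- apply: (@beta_eq_mu_dir vopp (- scoord x) (- tcoord x)).
  + exact: voppK.
  + by rewrite /vopp /= oppr0.
  + by case=> ? ? [? ?]; rewrite !adjbE /=; lia.
  + by case=> ? ?; rewrite /vnorm /= !abszN.
  + by rewrite oppr_gt0.
  + by move=> n; exact: neg (hs n).
  + by move=> n; exact: neg (ht n).
- by apply: (@beta_eq_mu_dir id (scoord x) (tcoord x)).
case: (ltgtP (tcoord x) 0) => htx.
- apply: (@beta_eq_mu_dir (fun v => (- v.2, - v.1)) (- tcoord x) (- scoord x)).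
  + by case=> a b /=; rewrite !opprK.
  + by rewrite /= oppr0.
  + by case=> ? ? [? ?]; rewrite !adjbE /=; lia.
  + by case=> ? ?; rewrite /vnorm /= !abszN maxnC.
  + by rewrite oppr_gt0.
  + by move=> n; exact: neg (ht n).
  + by move=> n; exact: neg (hs n).
- apply: (@beta_eq_mu_dir (fun v => (v.2, v.1)) (tcoord x) (scoord x)) => //.
  + by case.
  + by case=> ? ? [? ?]; rewrite !adjbE /=; lia.
  + by case=> ? ?; rewrite /vnorm /= maxnC.
move/eqP: x0; case; move: hsx htx; rewrite /scoord /tcoord.
case: (x) => a b /=; move=> ha hb; have b0 : b = 0.
  by move/eqP: hb; rewrite mulf_eq0 mulf_eq0 invr_eq0 (negbTE s3) pnatr_eq0 !orbF => /eqP.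
by move: ha; rewrite b0 !mul0r subr0 => ->.
Qed.

End Norm.

(** * The Brunn-Minkowski inequality in the plane *)

Section Lebesgue.
Context {R : realType}.
Notation mu := (@lebesgue_measure R).
Notation TR := (measurableTypeR R).

Lemma measurable_shift (c : R) : measurable_fun [set: TR] ((fun x : R => x + c) : TR -> TR).
Proof. by apply: measurable_funD => //; exact: measurable_cst. Qed.

Lemma measurable_shift_set (c : R) (A : set TR) : measurable A -> measurable ([set x | A (x + c)] : set TR).
Proof. by move=> mA; rewrite -[X in measurable X]setTI; exact: (measurable_shift c measurableT mA). Qed.

Lemma leb_shift (c : R) (A : set TR) : measurable A -> mu [set x | A (x + c)] = mu A.
Proof.
move=> mA; rewrite -[LHS]/(pushforward mu ((fun x : R => x + c) : TR -> TR) A).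
apply/esym/lebesgue_measure_unique => //=; first exact: measurable_shift.
move=> mf _ [[a b]] _ <-.
rewrite /pushforward (_ : _ @^-1` _ = `]a - c, b - c]%classic); last first.
  by apply/seteqP; split=> x /=; rewrite !in_itv /= ltrBlDr lerBrDr.
rewrite !lebesgue_measure_itv /= !lte_fin ltrD2r; case: ifP => // _.
by rewrite -!EFinB opprB addrA subrK.
Qed.

(** Translate A by an element b of B near inf B, and B by an element a of A near sup A. Both copies
    lie in C; the copy of B lies above m = a + inf B, and that of A exceeds m by at most e. *)
Lemma leb_sum_ge (A B C : set TR) : measurable A -> measurable B -> measurable C ->
  A !=set0 -> B !=set0 -> has_ubound A -> has_lbound B ->
  (forall a b, A a -> B b -> C (a + b)) -> (mu A + mu B <= mu C)%E.
Proof.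
move=> mA mB mC [a0 Aa0] [b0 Bb0] ubA lbB h.
apply/lee_addgt0Pr => e e0; have e2 : 0 < e / 2 by rewrite divr_gt0.
have supA : has_sup A by split=> //; exists a0.
have infB : has_inf B by split=> //; exists b0.
have [a Aa asup] := sup_adherent e2 supA.
have [b Bb binf] := inf_adherent e2 infB.
pose A' : set TR := [set x | A (x + - b)]; pose B' : set TR := [set x | B (x + - a)].
have mA' : measurable A' by exact: measurable_shift_set.
have mB' : measurable B' by exact: measurable_shift_set.
pose m := a + inf B.
have <- : mu A' = mu A by exact: leb_shift.
have <- : mu B' = mu B by exact: leb_shift.
pose A1 : set TR := A' `&` [set` `]-oo, m[].
have mA1 : measurable A1 by apply: measurableI => //; exact: measurable_itv.
have mI : measurable ([set` `[m, m + e]] : set TR) by exact: measurable_itv.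
have hA : (mu A' <= mu A1 + e%:E)%E.
  apply: (@le_trans _ _ (mu (A1 `|` [set` `[m, m + e]]))).
    apply: le_measure; rewrite ?inE //; first exact: measurableU.
    move=> x A'x; case: (ltP x m) => xm; [left; split=> //=|right]; rewrite /= in_itv /= ?xm //.
    have : x - b <= sup A by apply: sup_upper_bound.
    by rewrite /m; lra.
  have <- : mu [set` `[m, m + e]] = e%:E.
    by rewrite lebesgue_measure_itv /= lte_fin ltrDl e0 -EFinD addrAC subrr add0r.
  exact: measureU2.
have dis : A1 `&` B' = set0.
  apply/seteqP; split=> x //= -[[_]]; rewrite /= in_itv /= => xm B'x.
  have : inf B <= x - a by apply: inf_lbound.
  by move: xm; rewrite /m; lra.
apply: (@le_trans _ _ (mu A1 + e%:E + mu B')%E); first exact: leeD2r.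
rewrite addeAC; apply: leeD2r; rewrite -measureU //.
apply: le_measure; rewrite ?inE //; first exact: measurableU.
move=> x [[A'x _]|B'x]; first by rewrite -(subrK b x); exact: h.
by rewrite -(subrK a x) addrC; exact: h.
Qed.

Lemma leb2_ysection (A : set (TR * TR)) : measurable A -> leb2 A = (\int[mu]_y mu (ysection A y))%E.
Proof.
move=> mA; rewrite /leb2 (@product_measure_unique _ _ TR TR R mu mu (mu \x^ mu)%E) //.
by move=> B C mB mC; exact: (@product_measure2E _ _ TR TR R mu mu B C mB mC).
Qed.

Lemma leb2_xsection (A : set (TR * TR)) : leb2 A = (\int[mu]_x mu (xsection A x))%E.
Proof. by []. Qed.

(* Bonnesen's device: taking S to be the supremum of h makes every slice of height in (0, 1)
   nonempty, so that the one-dimensional inequality applies slice by slice. *)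
Definition hypo (S : R) (h : R -> \bar R) : set (TR * TR) :=
  [set z | 0 < z.2 < 1 /\ ((S * z.2)%:E < h z.1)%E].

Lemma measurable_hypo S (h : TR -> \bar R) : measurable_fun [set: TR] h -> measurable (hypo S h).
Proof.
move=> mh.
have m1 : measurable_fun [set: TR * TR] ((fun z => (S * z.2)%:E) : TR * TR -> \bar R).
  apply/measurable_EFinP; apply: measurable_funM; first exact: measurable_cst.
  exact: measurable_snd.
have m2 : measurable_fun [set: TR * TR] ((fun z => h z.1) : TR * TR -> \bar R).
  by apply: measurableT_comp => //; exact: measurable_fst.
have := measurable_lte measurableT m1 m2.
rewrite setTI => m3.
have -> : hypo S h = (setT `*` [set` `]0, 1[]) `&` [set z | ((S * z.2)%:E < h z.1)%E].
  by apply/seteqP; split=> z /=; rewrite in_itv /= => -[]; [move=> ? ?|move=> [_ ?] ?].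
by apply: measurableI => //; apply: measurableX => //; exact: measurable_itv.
Qed.

(** The section over x is the interval from 0 to min(1, h x / S). The minimum gives this inequality,
    and the converse [hypo_ge] when h <= S. *)
Lemma hypo_le S (h : TR -> \bar R) : 0 < S -> measurable_fun [set: TR] h -> (forall x, (0 <= h x)%E) ->
  (leb2 (hypo S h) <= (S^-1)%:E * \int[mu]_x h x)%E.
Proof.
move=> S0 mh h0; rewrite leb2_xsection -ge0_integralZl_EFin //; last by rewrite invr_ge0 ltW.
apply: ge0_le_integral => //.
- by apply: measurable_fun_xsection; exact: measurable_hypo.
- by apply: measurable_funeM.
move=> x _; have := h0 x; case hx : (h x) => [r| |] // r0; last first.
  by rewrite gt0_muley ?lte_fin ?invr_gt0 // leey.
have mi : measurable ([set` `]0, (S^-1 * r)[] : set TR) by exact: measurable_itv.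
apply: (@le_trans _ _ (mu [set` `]0, (S^-1 * r)[])).
  apply: le_measure; rewrite ?inE //; first by apply: measurable_xsection; exact: measurable_hypo.
  move=> y /xsectionP [/=]; rewrite hx lte_fin in_itv /= => /andP[y0 _] yr.
  by rewrite y0 /= mulrC ltr_pdivlMr // mulrC.
by rewrite lebesgue_measure_itv /= lte_fin; case: ifP => _; rewrite ?sube0 -?EFinM // lee_fin mulr_ge0 // invr_ge0 ltW.
Qed.

Lemma hypo_ge S (h : TR -> \bar R) : 0 < S -> measurable_fun [set: TR] h -> (forall x, (0 <= h x <= S%:E)%E) ->
  ((S^-1)%:E * \int[mu]_x h x <= leb2 (hypo S h))%E.
Proof.
move=> S0 mh h0; have h1 x : (0 <= h x)%E by case/andP: (h0 x).
rewrite leb2_xsection -ge0_integralZl_EFin //; last by rewrite invr_ge0 ltW.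
apply: ge0_le_integral => //.
- by move=> x _; rewrite mule_ge0 // lee_fin invr_ge0 ltW.
- by apply: measurable_funeM.
- by apply: measurable_fun_xsection; exact: measurable_hypo.
move=> x _; have := h0 x; case hx : (h x) => [r| |] //; rewrite ?leye_eq ?andbF // => /andP[r0 rS].
rewrite !lee_fin in r0 rS.
have mi : measurable ([set` `]0, (S^-1 * r)[] : set TR) by exact: measurable_itv.
apply: (@le_trans _ _ (mu [set` `]0, (S^-1 * r)[])).
  rewrite lebesgue_measure_itv /= lte_fin; case: ifPn => h2; rewrite ?sube0 -?EFinM //.
  by rewrite lee_fin leNgt.
apply: le_measure; rewrite ?inE //; first by apply: measurable_xsection; exact: measurable_hypo.
move=> y; rewrite /= in_itv /= mulrC ltr_pdivlMr // => /andP[y0 yr].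
apply/xsectionP; split => /=; last by rewrite hx lte_fin mulrC.
by rewrite y0 /= -(ltr_pM2r S0) mul1r (lt_le_trans yr).
Qed.

(** Cauchy-Schwarz as an identity: (x^2/p + y^2/q)(p + q) = (x + y)^2 + (xq - yp)^2/(pq). *)
Lemma bm_algebra (a b c p q : R) : 0 < p -> 0 < q -> 0 <= a -> 0 <= b ->
  p^-1 * a + q^-1 * b <= (p + q)^-1 * c -> Num.sqrt a + Num.sqrt b <= Num.sqrt c.
Proof.
move=> p0 q0 a0 b0; have [pq0 pn qn] : [/\ 0 < p + q, p != 0 & q != 0].
  by split; [exact: addr_gt0|rewrite gt_eqF|rewrite gt_eqF].
rewrite mulrC [leRHS]mulrC ler_pdivlMr // => h.
have [sa sb] := (sqrtr_ge0 a, sqrtr_ge0 b).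
have := sqr_sqrtr a0; have := sqr_sqrtr b0.
move: (Num.sqrt a) (Num.sqrt b) sa sb => x y x0 y0 eb ea; rewrite -ea -eb in h.
have h2 : (x + y) ^+ 2 <= c.
  apply: le_trans h.
  have -> : (x ^+ 2 / p + q^-1 * y ^+ 2) * (p + q) = (x + y) ^+ 2 + (x * q - y * p) ^+ 2 / (p * q).
    by field; rewrite pn qn.
  by rewrite lerDl divr_ge0 ?sqr_ge0 // mulr_ge0 ?ltW.
rewrite -(@ler_pXn2r _ 2) ?nnegrE ?addr_ge0 ?sqrtr_ge0 // sqr_sqrtr //.
exact: le_trans (sqr_ge0 _) h2.
Qed.

Lemma xsection_bounded (A : set (TR * TR)) : bounded2 A ->
  exists2 M, 0 <= M & forall x, (xsection A x !=set0 -> `|x| <= M) /\ (forall y, xsection A x y -> `|y| <= M).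
Proof.
move=> [M hM]; exists `|M| => // x; split=> [[y /xsectionP/hM [h _]]|y /xsectionP/hM [_ h]];
  exact: le_trans h (ler_norm M).
Qed.

Lemma mu_gt0_neq0 (A : set TR) : (0 < mu A)%E -> A !=set0.
Proof. by move=> h; apply/set0P/eqP => A0; rewrite A0 measure0 ltxx in h. Qed.

Lemma section_sup (A : set (TR * TR)) : measurable A -> bounded2 A -> (0 < leb2 A)%E ->
  exists2 S : R, 0 < S & (forall x, (0 <= mu (xsection A x) <= S%:E)%E) /\
    forall s : R, s < S -> exists x, (s%:E < mu (xsection A x))%E.
Proof.
move=> mA bA A0; have [M M0 hM] := xsection_bounded bA.
set f := fun x => mu (xsection A x).
have f1 x : (f x <= (2 * M)%:E)%E.
  have mi : measurable ([set` `[(- M), M]] : set TR) by exact: measurable_itv.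
  apply: (@le_trans _ _ (mu [set` `[(- M), M]])).
    apply: le_measure; rewrite ?inE //; first exact: measurable_xsection.
    by move=> y /(hM x).2; rewrite ler_norml /= in_itv.
  rewrite lebesgue_measure_itv /= lte_fin; case: ifP => _; rewrite -?EFinB lee_fin; lra.
have s1 : (ereal_sup (range f) <= (2 * M)%:E)%E by apply: ge_ereal_sup => _ [x _ <-].
have s0 : (0 < ereal_sup (range f))%E.
  rewrite ltNge; apply/negP => h; move: A0; rewrite leb2_xsection.
  rewrite (_ : (fun x => _) = cst 0%E) ?integral0 ?ltxx //.
  apply/funext => x /=; apply/eqP; rewrite eq_le measure_ge0 andbT.
  by apply: le_trans h; apply: ereal_sup_ubound; exists x.
case es : (ereal_sup (range f)) s1 s0 => [S| |] //= s1 s0; rewrite lte_fin in s0.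
exists S => //; split=> [x|s sS].
  by rewrite measure_ge0 -es; apply: ereal_sup_ubound; exists x.
have : (s%:E < ereal_sup (range f))%E by rewrite es lte_fin.
by move/ereal_sup_gt => [_ [x _ <-] h]; exists x.
Qed.

Lemma ge0_leD_integral (f g h : TR -> \bar R) : measurable_fun [set: TR] f -> measurable_fun [set: TR] g ->
  measurable_fun [set: TR] h -> (forall x, (0 <= f x)%E) -> (forall x, (0 <= g x)%E) ->
  (forall x, (f x + g x <= h x)%E) -> (\int[mu]_x f x + \int[mu]_x g x <= \int[mu]_x h x)%E.
Proof.
move=> mf mg mh f0 g0 le; rewrite -ge0_integralD //; apply: ge0_le_integral => //.
  by move=> x _; rewrite adde_ge0.
exact: emeasurable_funD.
Qed.

(** With f, g, k the section lengths of A, B, C and p, q the suprema of f, g, the one-dimensional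
    inequality is used twice: on sections, to see that f(x) > p y and g(x') > q y imply k(x + x') >
    (p + q) y, and then on these superlevel sets at each height y. Integration in y gives the
    hypothesis of [bm_algebra]. *)
Lemma brunn_minkowski (A B C : set (TR * TR)) (a b c : R) :
  measurable A -> measurable B -> measurable C -> bounded2 A -> bounded2 B ->
  0 < a -> 0 < b -> leb2 A = a%:E -> leb2 B = b%:E -> leb2 C = c%:E ->
  (forall x y, A x -> B y -> C (x.1 + y.1, x.2 + y.2)) ->
  Num.sqrt a + Num.sqrt b <= Num.sqrt c.
Proof.
move=> mA mB mC bA bB a0 b0 ea eb ec h.
have [p p0 [fp fs]] : exists2 S : R, 0 < S & (forall x, (0 <= mu (xsection A x) <= S%:E)%E) /\
    forall s : R, s < S -> exists x, (s%:E < mu (xsection A x))%E by apply: section_sup; rewrite ?ea ?lte_fin.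
have [q q0 [gp gs]] : exists2 S : R, 0 < S & (forall x, (0 <= mu (xsection B x) <= S%:E)%E) /\
    forall s : R, s < S -> exists x, (s%:E < mu (xsection B x))%E by apply: section_sup; rewrite ?eb ?lte_fin.
have [M M0 hM] := xsection_bounded bA; have [N N0 hN] := xsection_bounded bB.
set f := fun x => mu (xsection A x) in fp fs; set g := fun x => mu (xsection B x) in gp gs.
pose k := fun x => mu (xsection C x).
have mf : measurable_fun [set: TR] (f : TR -> \bar R) by exact: measurable_fun_xsection.
have mg : measurable_fun [set: TR] (g : TR -> \bar R) by exact: measurable_fun_xsection.
have mk : measurable_fun [set: TR] (k : TR -> \bar R) by exact: measurable_fun_xsection.
apply: (@bm_algebra _ _ _ p q) => //; [exact: ltW|exact: ltW|]; rewrite -lee_fin EFinD !EFinM -ea -eb -ec.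
have pq : 0 < p + q by exact: addr_gt0.
have hA := hypo_ge p0 mf fp; have hB := hypo_ge q0 mg gp.
have hC := hypo_le pq mk (fun x => measure_ge0 mu _).
apply: le_trans hC; apply: le_trans (leeD hA hB) _.
have mf' := measurable_hypo p mf; have mg' := measurable_hypo q mg.
have mk' := measurable_hypo (p + q) mk.
rewrite (leb2_ysection mf') (leb2_ysection mg') (leb2_ysection mk').
have my (D : set (TR * TR)) (mD : measurable D) : measurable_fun [set: TR] (fun y => mu (ysection D y)) by exact: measurable_fun_ysection.
apply: (ge0_leD_integral (my _ mf') (my _ mg') (my _ mk')) => //.
move=> y; case: (boolP (0 < y < 1)) => [/andP[y0 y1]|y01]; last first.
  have e0 S l : ysection (hypo S l) y = set0.
    by apply/seteqP; split=> // x /ysectionP [/= yy]; rewrite yy in y01.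
  by rewrite !e0 !measure0 adde0.
have sup_of (D : set (TR * TR)) S (M1 : R) (D0 : forall s : R, s < S -> exists x, (s%:E < mu (xsection D x))%E) :
    0 < S -> (forall x, xsection D x !=set0 -> `|x| <= M1) ->
    let D' := ysection (hypo S (fun x => mu (xsection D x))) y in
    D' !=set0 /\ (has_ubound D' /\ has_lbound D').
  move=> S0 hD D'; have Db x : D' x -> `|x| <= M1.
    move=> /ysectionP [_ /=] hx; apply: hD; apply: mu_gt0_neq0; apply: le_lt_trans hx.
    by rewrite lee_fin mulr_ge0 // ltW.
  split; last by split; [exists M1|exists (- M1)] => x /Db; rewrite ler_norml => /andP[].
  have [x hx] : exists x, ((S * y)%:E < mu (xsection D x))%E by apply: D0; rewrite gtr_pMr.
  by exists x; apply/ysectionP; rewrite /hypo /= y0 y1.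
have [nA [uA _]] := sup_of A p M fs p0 (fun x => (hM x).1).
have [nB [_ lB]] := sup_of B q N gs q0 (fun x => (hN x).1).
apply: leb_sum_ge => //; [exact: measurable_ysection..|].
move=> x x' /ysectionP [_ /= hx] /ysectionP [_ /= hx'].
apply/ysectionP; split; first by rewrite /= y0 y1.
rewrite /= mulrDl EFinD; apply: lt_le_trans (lteD hx hx') _.
have ne (D : set (TR * TR)) S t : 0 < S -> ((S * y)%:E < mu (xsection D t))%E -> xsection D t !=set0.
  by move=> S0 ht; apply: mu_gt0_neq0; apply: le_lt_trans ht; rewrite lee_fin mulr_ge0 // ltW.
apply: leb_sum_ge; [exact: measurable_xsection..| | | | |].
- exact: ne hx.
- exact: ne hx'.
- by exists M => t /(hM x).2; rewrite ler_norml => /andP[].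
- by exists (- N) => t /(hN x').2; rewrite ler_norml => /andP[].
by move=> s t /xsectionP As /xsectionP Bt; apply/xsectionP; exact: h As Bt.
Qed.

End Lebesgue.

(** * The area swept by a moving disc *)

Section Sausage.
Context {R : realType}.
Notation mu := (@lebesgue_measure R).
Notation TR := (measurableTypeR R).

Definition disc (v : R * R) (s : R) : set (R * R) :=
  [set z : R * R | (z.1 - v.1) ^+ 2 + (z.2 - v.2) ^+ 2 < s ^+ 2].

Lemma measurable_disc v s : measurable (disc v s : set (TR * TR)).
Proof.
pose f (z : R * R) : R := (z.1 - v.1) ^+ 2 + (z.2 - v.2) ^+ 2.
have m : measurable_fun [set: TR * TR] (f : TR * TR -> TR).
  apply: measurable_funD; apply: measurable_funX; apply: measurable_funB; try exact: measurable_cst.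
    exact: measurable_fst.
  exact: measurable_snd.
have := m measurableT [set` `]-oo, (s ^+ 2)[] (measurable_itv _).
by rewrite setTI; congr measurable; apply/seteqP; split=> z /=; rewrite in_itv.
Qed.

Lemma eucl_lt (z : R * R) s : 0 <= s -> (eucl z < s) = (z.1 ^+ 2 + z.2 ^+ 2 < s ^+ 2).
Proof.
move=> s0; have h : 0 <= z.1 ^+ 2 + z.2 ^+ 2 by rewrite addr_ge0 ?sqr_ge0.
by rewrite /eucl -[in RHS](sqr_sqrtr h) ltr_pXn2r ?nnegrE ?sqrtr_ge0.
Qed.

Lemma discE v s : 0 <= s -> disc v s = [set z | eucl (sub2 z v) < s].
Proof. by move=> s0; apply/seteqP; split=> z; rewrite /= eucl_lt. Qed.

(** What a translated interval gains lies just beyond one end of I, in an interval of length |w|. *)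
Lemma shift_diff_le (I : set TR) (w : R) : measurable I -> bounded_set (I : set R) -> is_interval (I : set R) ->
  (mu ([set y | I (y - w)%R] `\` I) <= `|w|%:E)%E.
Proof.
move=> mI bI iI; set E := _ `\` _.
have mE : measurable E by apply: measurableD => //; exact: (measurable_shift_set (- w)).
have [->|/set0P[y0 [y0I y0N]]] := eqVneq E set0; first by rewrite measure0 lee_fin.
have [M hM] : exists M, forall x, I x -> `|x| <= M.
  by have [M [_ hM]] := bI; exists (M + 1) => x; apply: hM; rewrite ltrDl.
have ub : has_ubound (I : set R) by exists M => x /hM; rewrite ler_norml => /andP[].
have lb : has_lbound (I : set R) by exists (- M) => x /hM; rewrite ler_norml => /andP[].
have main (a b : R) : (forall y, E y -> a <= y <= b) -> (b - a <= `|w|)%R -> (mu E <= `|w|%:E)%E.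
  move=> h ab; apply: (@le_trans _ _ (mu [set` `[a, b]])).
    by apply: le_measure; rewrite ?inE // => y /h; rewrite /= in_itv.
  rewrite lebesgue_measure_itv /= lte_fin; case: ifP => _; rewrite -?EFinB lee_fin //.
have ne : (I : set R) !=set0 by exists (y0 - w).
case: (lerP 0 w) => w0.
- apply: (main (sup I) (sup I + w)); last by rewrite ger0_norm // addrAC subrr add0r.
  move=> y [yI yN]; apply/andP; split; last by rewrite -lerBlDr; apply: sup_upper_bound.
  apply: ge_sup => // i Ii; rewrite leNgt; apply/negP => yi; apply: yN.
  by apply: (iI _ _ yI Ii); rewrite (ltW yi) andbT lerBlDr lerDl.
apply: (main (inf I + w) (inf I)); last by rewrite ltr0_norm // opprD addrA subrr add0r.
move=> y [yI yN]; apply/andP; split; first by rewrite -lerBrDr; apply: inf_lbound.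
apply: lb_le_inf => // i Ii; rewrite leNgt; apply/negP => yi; apply: yN.
by apply: (iI _ _ Ii yI); rewrite (ltW yi) /= lerBrDr gerDl ltW.
Qed.

Lemma integral_le_box (f : TR -> \bar R) (c a b : R) : measurable_fun [set: TR] f -> 0 <= c -> a <= b ->
  (forall x, (0 <= f x <= c%:E)%E) -> (forall x, ~ (a <= x <= b) -> f x = 0%E) ->
  (\int[mu]_x f x <= (c * (b - a))%:E)%E.
Proof.
move=> mf c0 ab fc f0; pose D : set TR := [set` `[a, b]].
have mD : measurable D by exact: measurable_itv.
apply: (@le_trans _ _ (\int[mu]_x (c * \1_D x)%:E)%E).
  apply: ge0_le_integral => //.
  - by move=> x _; case/andP: (fc x).
  - by apply/measurable_EFinP; apply: measurable_funM; [exact: measurable_cst|exact: measurable_indic].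
  move=> x _; rewrite indicE; case: (boolP (x \in D)); rewrite ?mulr1 ?mulr0.
    by case/andP: (fc x).
  by rewrite notin_setE /D /= in_itv /= => /f0 ->.
under eq_integral do rewrite EFinM.
rewrite ge0_integralZl_EFin //; last by apply/measurable_EFinP; exact: measurable_indic.
rewrite integral_indic // setIT EFinM; apply: lee_wpmul2l; first by rewrite lee_fin.
suff: (mu D <= (b - a)%:E)%E by [].
by rewrite /D lebesgue_measure_itv /= lte_fin; case: ifP => // _; rewrite lee_fin subr_ge0.
Qed.

(** A sublevel set of a convex quadratic function of y: the section of a disc along a line of slope
    given by m. *)
Lemma sq_interval (a b s2 m q : R) : is_interval [set y : R | (q + m * y - a) ^+ 2 + (y - b) ^+ 2 < s2].
Proof.
move=> x z /= hx hz y /andP[xy yz].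
case: (ltrP x z) => xz; last by have -> : y = x by apply/eqP; rewrite eq_le xy (le_trans yz).
pose t := (y - x) / (z - x).
have zx : 0 < z - x by rewrite subr_gt0.
have t0 : 0 <= t by rewrite divr_ge0 ?subr_ge0 // ltW.
have t1 : t <= 1 by rewrite ler_pdivrMr // mul1r lerD2r.
have -> : y = (1 - t) * x + t * z by rewrite /t; field; rewrite gt_eqF.
have -> : (q + m * ((1 - t) * x + t * z) - a) ^+ 2 + ((1 - t) * x + t * z - b) ^+ 2 =
   (1 - t) * ((q + m * x - a) ^+ 2 + (x - b) ^+ 2) + t * ((q + m * z - a) ^+ 2 + (z - b) ^+ 2)
   - t * (1 - t) * ((m * (z - x)) ^+ 2 + (z - x) ^+ 2) by ring.
apply: (@le_lt_trans _ _ ((1 - t) * ((q + m * x - a) ^+ 2 + (x - b) ^+ 2) + t * ((q + m * z - a) ^+ 2 + (z - b) ^+ 2))).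
  by rewrite gerBl; apply: mulr_ge0; [apply: mulr_ge0; rewrite ?subr_ge0|rewrite addr_ge0 ?sqr_ge0].
have -> : s2 = (1 - t) * s2 + t * s2 by ring.
case: (ltrP 0 t) => t00.
  by apply: ler_ltD; [apply: ler_wpM2l; rewrite ?subr_ge0 // ltW|rewrite ltr_pM2l].
have -> : t = 0 by apply/eqP; rewrite eq_le t00.
by rewrite subr0 !mul1r !mul0r !addr0.
Qed.

Lemma leb2_shear (m : R) (E : set (TR * TR)) : measurable E ->
  measurable ([set z | E (z.1 + m * z.2, z.2)%R] : set (TR * TR)) /\
  leb2 ([set z | E (z.1 + m * z.2, z.2)%R] : set (TR * TR)) = leb2 E.
Proof.
move=> mE; have mT : measurable_fun [set: TR * TR] ((fun z => (z.1 + m * z.2, z.2)) : TR * TR -> TR * TR).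
  apply: measurable_fun_pair; last exact: measurable_snd.
  apply: measurable_funD; first exact: measurable_fst.
  by apply: measurable_funM; [exact: measurable_cst|exact: measurable_snd].
have mE' : measurable ([set z | E (z.1 + m * z.2, z.2)%R] : set (TR * TR)).
  by have := mT measurableT _ mE; rewrite setTI.
split=> //; rewrite (leb2_ysection mE) (leb2_ysection mE'); apply: eq_integral => y _.
by rewrite -(leb_shift (m * y) (measurable_ysection y mE)).
Qed.

Lemma bounded_sq (a s : R) (I : set R) : (forall y, I y -> (y - a) ^+ 2 < s ^+ 2) -> bounded_set I.
Proof.
move=> h; exists (`|s| + `|a|); split; first exact: num_real.
move=> M hM y /h; rewrite -real_normK ?num_real // -[s ^+ 2]real_normK ?num_real // => h2.
apply: ltW; apply: le_lt_trans hM; rewrite -(subrK a y); apply: le_trans (ler_normD _ _) _.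
by rewrite lerD2r ltW // -(@ltr_pXn2r _ 2) ?nnegrE.
Qed.

(* A shear makes v' - v vertical; each vertical section is then an interval minus a translate,
   of length at most that of the translation. *)
Lemma disc_diff (v v' : R * R) (s : R) : 0 <= s ->
  (leb2 (disc v' s `\` disc v s : set (TR * TR)) <= (2 * s * eucl (sub2 v' v))%:E)%E.
Proof.
move=> s0; set w := sub2 v' v; have mD := measurableD (measurable_disc v' s) (measurable_disc v s).
have mls (c : R) (D : set TR) : measurable D -> measurable ([set x | D (x - c)] : set TR).
  by move=> mD'; exact: (measurable_shift_set (- c)).
case: (eqVneq w.2 0) => w2.
- rewrite leb2_ysection //.
  have -> : 2 * s * eucl w = `|w.1| * ((v.2 + s) - (v.2 - s)).
    by rewrite /eucl w2 expr0n addr0 sqrtr_sqr; ring.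
  have e2 : v'.2 = v.2 by apply/eqP; rewrite -subr_eq0 -[_ - _]/(w.2) w2.
  apply: integral_le_box => //; first exact: measurable_fun_ysection.
  + by rewrite lerD2l ge0_cp.
  + move=> y; rewrite measure_ge0 /=.
    pose I : set TR := ysection (disc v s) y.
    have mI : measurable I by apply: measurable_ysection; exact: measurable_disc.
    have hI x : I x <-> (x - v.1) ^+ 2 + (y - v.2) ^+ 2 < s ^+ 2.
      by split=> [/ysectionP|h]; last apply/ysectionP.
    have -> : ysection (disc v' s `\` disc v s) y = [set x | I (x - w.1)] `\` I.
      apply/seteqP; split=> x.
        move=> /ysectionP [h1 h2]; split; last by move=> /ysectionP.
        by apply/hI; move: h1; rewrite /disc /= e2; congr (_ ^+ 2 + _ < _); rewrite /w /=; ring.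
      move=> [/hI h1 h2]; apply/ysectionP; split; last by move=> h; apply: h2; apply/ysectionP.
      by move: h1; rewrite /disc /= e2; congr (_ ^+ 2 + _ < _); rewrite /w /=; ring.
    apply: shift_diff_le => //.
      apply: (@bounded_sq v.1 s) => x /hI; apply: le_lt_trans.
      by rewrite lerDl sqr_ge0.
    move=> x z /hI hx /hI hz t xtz; apply/hI.
    have := @sq_interval v.2 v.1 (s ^+ 2) 0 y x z.
    rewrite /= !mul0r addr0 addrC hx addrC hz => /(_ isT isT t xtz).
    by rewrite mul0r addr0 addrC.
  move=> y hy; rewrite (_ : ysection _ y = set0) ?measure0 //.
  apply/seteqP; split=> // x /ysectionP [/= h1 _]; apply: hy.
  have {}h1 : (y - v.2) ^+ 2 < s ^+ 2.
    by move: h1; rewrite /disc /= e2; apply: le_lt_trans; rewrite lerDr sqr_ge0.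
  have : `|y - v.2| < s by rewrite -(@ltr_pXn2r _ 2) ?nnegrE // real_normK ?num_real.
  by rewrite ltr_norml => /andP[? ?]; apply/andP; split; lra.
(* The sheared disc projects to the interval of radius s k about [c0], and |w.2| k is the Euclidean
   norm of w. *)
pose m := w.1 / w.2; pose k := Num.sqrt (1 + m ^+ 2).
have hw : w.1 = m * w.2 by rewrite /m divfK.
have [mE <-] := leb2_shear m mD; rewrite leb2_xsection.
pose c0 := v.1 - m * v.2.
have -> : 2 * s * eucl w = `|w.2| * ((c0 + s * k) - (c0 - s * k)).
  have -> : eucl w = `|w.2| * k.
    rewrite /eucl /k -sqrtr_sqr -sqrtrM ?sqr_ge0 //; congr Num.sqrt; rewrite /m; field.
    exact: w2.
  by ring.
have k0 : 0 <= k by exact: sqrtr_ge0.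
apply: integral_le_box => //; first exact: measurable_fun_xsection.
- by have := mulr_ge0 s0 k0; lra.
- move=> q; rewrite measure_ge0 /=.
  have [mE1 _] := leb2_shear m (measurable_disc v s).
  pose I : set TR := xsection ([set z | disc v s (z.1 + m * z.2, z.2)%R] : set (TR * TR)) q.
  have mI : measurable I by exact: measurable_xsection.
  have hI y : I y <-> (q + m * y - v.1) ^+ 2 + (y - v.2) ^+ 2 < s ^+ 2.
    by split=> [/xsectionP|h]; last apply/xsectionP.
  have e1 y : (q + m * (y - w.2) - v.1) = q + m * y - v'.1.
    by have := hw; rewrite /w /=; lra.
  have e2 y : y - w.2 - v.2 = y - v'.2 by rewrite /w /=; ring.
  set E := xsection _ _; have -> : E = [set y | I (y - w.2)] `\` I.
    apply/seteqP; split=> y.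
      move=> /xsectionP [/= h1 h2]; split; last by move=> /hI.
      by apply/hI; rewrite e1 e2.
    move=> [/hI h1 h2]; apply/xsectionP; split; first by move: h1; rewrite e1 e2.
    by move=> h; apply: h2; apply/hI.
  apply: shift_diff_le => //.
    by apply: (@bounded_sq v.2 s) => x /hI; apply: le_lt_trans; rewrite lerDr sqr_ge0.
  move=> x z /hI hx /hI hz t xtz; apply/hI.
  exact: (@sq_interval v.1 v.2 (s ^+ 2) m q x z hx hz t xtz).
move=> q hq; rewrite (_ : xsection _ q = set0) ?measure0 //.
apply/seteqP; split=> // y /xsectionP [/= h1 _]; apply: hq.
have e0 : v'.1 - m * v'.2 = c0.
  by have := hw; rewrite /c0 /w /=; lra.
have : `|q - c0| < s * k.
  rewrite -(@ltr_pXn2r _ 2) ?nnegrE ?mulr_ge0 // real_normK ?num_real // exprMn sqr_sqrtr; last first.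
    by rewrite addr_ge0 // sqr_ge0.
  move: h1; rewrite /disc /= -e0; move: v'.1 v'.2 => a b h1.
  have : (q - (a - m * b)) ^+ 2 <= (1 + m ^+ 2) * ((q + m * y - a) ^+ 2 + (y - b) ^+ 2).
    rewrite -subr_ge0; have -> : (1 + m ^+ 2) * ((q + m * y - a) ^+ 2 + (y - b) ^+ 2) - (q - (a - m * b)) ^+ 2
      = (m * (q + m * y - a) + (y - b)) ^+ 2 by ring.
    exact: sqr_ge0.
  move/le_lt_trans; apply; rewrite mulrC ltr_pM2r //.
  by rewrite ltr_pwDl // sqr_ge0.
by rewrite ltr_norml => /andP[? ?]; apply/andP; split; lra.
Qed.

End Sausage.

(** * Areas of discs and of chains of discs *)

Section DiskArea.
Context {R : realType}.
Notation mu := (@lebesgue_measure R).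
Notation TR := (measurableTypeR R).

Lemma derivable_LR (f f' : R -> R) (a b : R) : (forall x : R, is_derive x 1 f (f' x)) -> derivable_oo_LRcontinuous f a b.
Proof.
move=> fd; have fc x : {for x, continuous f}.
  by apply/differentiable_continuous/derivable1_diffP; have [] := fd x.
by split=> [x _||]; [have [] := fd x|apply: cvg_at_right_filter; exact: fc|apply: cvg_at_left_filter; exact: fc].
Qed.

(** Substitution x = r sin t; r^2 (t + sin t cos t) is an antiderivative of 2 (r cos t)^2. *)
Lemma integral_half_circle (r : R) : 0 < r ->
  (\int[mu]_(x in `[(- r)%R, r]) (2 * Num.sqrt (r ^+ 2 - x ^+ 2))%:E = (pi * r ^+ 2)%:E)%E.
Proof.
move=> r0; pose F (t : R) := r * sin t; pose a : R := - (pi / 2); pose b : R := pi / 2.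
have pi2 : 0 < pi / 2 :> R by rewrite divr_gt0 ?pi_gt0.
have ab : a < b by rewrite /a /b; move: (pi / 2) pi2 => x; clear; lra.
have Fd (t : R) : is_derive t 1 F (r * cos t) by exact: (is_deriveZ r (is_derive_sin t)).
have F' : derive1 F = (fun t => r * cos t).
  by apply/funext => t; rewrite derive1E; exact: derive_val.
have Fa : F a = - r by rewrite /F /a sinN sin_pihalf mulrN1.
have Fb : F b = r by rewrite /F /b sin_pihalf mulr1.
have cc : continuous (fun t : R => r * cos t).
  by move=> t; apply: cvgM; [exact: cvg_cst|exact: continuous_cos].
pose G (x : R) := 2 * Num.sqrt (r ^+ 2 - x ^+ 2).
have cG : continuous G.
  move=> x; apply: cvgM; first exact: cvg_cst.
  apply: (@continuous_comp _ _ _ (fun x : R => r ^+ 2 - x ^+ 2)); last exact: sqrt_continuous.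
  by apply: cvgB; [exact: cvg_cst|exact: exprn_continuous].
have := @integration_by_substitution_increasing R F G a b (ltW ab).
rewrite Fa Fb F' => -> //; first last.
- exact: continuous_subspaceT.
- exact: derivable_LR Fd.
- by apply/cvg_ex; exists (r * cos b); apply: cvg_at_left_filter; exact: cc.
- by apply/cvg_ex; exists (r * cos a); apply: cvg_at_right_filter; exact: cc.
- move=> x y xab yab xy; rewrite ltr_pM2l //.
  by rewrite ltr_sin.
pose H (t : R) := r ^+ 2 * (t + sin t * cos t).
have Hd (t : R) : is_derive t 1 H (2 * (r * cos t) ^+ 2).
  have := is_deriveZ (r ^+ 2) (is_deriveD (is_derive_id t 1) (is_deriveM (is_derive_sin t) (is_derive_cos t))).
  move/is_derive_eq; apply; rewrite /GRing.scale /=.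
  have := cos2Dsin2 t; move: (cos t) (sin t) => c s h.
  have -> : 2 * (r * c) ^+ 2 = r ^+ 2 * ((c ^+ 2 + s ^+ 2) + c ^+ 2 - s ^+ 2) by ring.
  by rewrite h; ring.
transitivity (\int[mu]_(t in `[a, b]) (2 * (r * cos t) ^+ 2)%:E)%E.
  apply: eq_integral => t; rewrite inE /= in_itv /= => tab; congr EFin.
  suff : G (F t) * (r * cos t) = 2 * (r * cos t) ^+ 2 by move=> <-.
  rewrite /G /F; have c0 : 0 <= cos t by apply: cos_ge0_pihalf.
  have -> : r ^+ 2 - (r * sin t) ^+ 2 = (r * cos t) ^+ 2.
    by have := cos2Dsin2 t; rewrite !exprMn => h; rewrite -[X in X - _]mulr1 -h; ring.
  by rewrite sqrtr_sqr ger0_norm ?mulr_ge0 ?(ltW r0) //; ring.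
have Hc : {within `[a, b], continuous (fun t : R => 2 * (r * cos t) ^+ 2)}.
  apply: continuous_subspaceT => t; apply: cvgM; first exact: cvg_cst.
  by apply: (@continuous_comp _ _ _ (fun t => r * cos t) (fun x => x ^+ 2)); [exact: cc|exact: exprn_continuous].
have H' : {in `]a, b[, derive1 H =1 (fun t : R => 2 * (r * cos t) ^+ 2)}.
  by move=> x _; rewrite derive1E; exact: derive_val.
rewrite (continuous_FTC2 ab Hc (derivable_LR _ _ Hd) H').
by rewrite -EFinB; congr EFin; rewrite /H /a /b sinN cosN cos_pihalf !mulr0 !addr0; field.
Qed.

(** [Num.sqrt] is 0 on negative numbers, so the integrand vanishes outside [-r, r]. *)
Lemma half_circle_total (r : R) : 0 < r -> (\int[mu]_x (2 * Num.sqrt (r ^+ 2 - x ^+ 2))%:E = (pi * r ^+ 2)%:E)%E.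
Proof.
move=> r0; rewrite -(integral_half_circle r0) [RHS]integral_mkcond; apply: eq_integral => x _.
rewrite patchE; case: ifPn => //; rewrite notin_setE /= in_itv /= => h; congr EFin.
rewrite ler0_sqrtr ?mulr0 // subr_le0; apply/ltW; rewrite ltNge; apply/negP => h2; apply: h.
by rewrite -ler_norml -(@ler_pXn2r _ 2) ?nnegrE ?(ltW r0) // real_normK ?num_real.
Qed.

Lemma sq_le_itv (c y : R) : 0 <= c -> (y ^+ 2 <= c) = (- Num.sqrt c <= y <= Num.sqrt c).
Proof.
move=> c0; rewrite -ler_norml -[in LHS](sqr_sqrtr c0) -[in LHS](@real_normK _ y) ?num_real //.
by rewrite ler_pXn2r // nnegrE.
Qed.

Lemma sq_lt_itv (c y : R) : 0 <= c -> (y ^+ 2 < c) = (- Num.sqrt c < y < Num.sqrt c).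
Proof.
move=> c0; rewrite -ltr_norml -[in LHS](sqr_sqrtr c0) -[in LHS](@real_normK _ y) ?num_real //.
by rewrite ltr_pXn2r // nnegrE ?sqrtr_ge0.
Qed.

Lemma leb2_disc0 (r : R) : 0 < r -> leb2 (disc (0, 0)%R r : set (TR * TR)) = (pi * r ^+ 2)%:E.
Proof.
move=> r0; rewrite leb2_xsection -half_circle_total //; apply: eq_integral => x _.
case: (leP (r ^+ 2 - x ^+ 2) 0) => h.
  rewrite ler0_sqrtr // mulr0.
  rewrite (_ : xsection _ x = set0) ?measure0 //.
  apply/seteqP; split=> // y /xsectionP; rewrite /disc /= !subr0 => h1.
  by have := sqr_ge0 y; move: h h1; move: (r ^+ 2) (x ^+ 2) (y ^+ 2) => A B C; lra.
rewrite (_ : xsection _ x = [set` `](- Num.sqrt (r ^+ 2 - x ^+ 2)), (Num.sqrt (r ^+ 2 - x ^+ 2))[]).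
  rewrite lebesgue_measure_itv /= lte_fin -subr_gt0 opprK.
  have s0 : 0 < Num.sqrt (r ^+ 2 - x ^+ 2) by rewrite sqrtr_gt0.
  by rewrite addr_gt0 // -?EFinB -?EFinD ?opprK; congr EFin; ring.
apply/seteqP; split=> y; rewrite /= in_itv /= -sq_lt_itv ?ltW //.
  by move/xsectionP; rewrite /disc /= !subr0; lra.
by move=> hy; apply/xsectionP; rewrite /disc /= !subr0; lra.
Qed.

Lemma leb2_disk (r : R) : 0 < r -> leb2 (disk r : set (TR * TR)) = (pi * r ^+ 2)%:E.
Proof.
move=> r0; rewrite leb2_xsection -half_circle_total //; apply: eq_integral => x _.
have hd (y : R) : disk r (x, y) <-> y ^+ 2 <= r ^+ 2 - x ^+ 2.
  have h : 0 <= x ^+ 2 + y ^+ 2 by rewrite addr_ge0 ?sqr_ge0.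
  rewrite /disk /eucl /= -(@ler_pXn2r _ 2) ?nnegrE ?sqrtr_ge0 ?(ltW r0) // sqr_sqrtr //.
  by split; lra.
case: (ltP (r ^+ 2 - x ^+ 2) 0) => h.
  rewrite ler0_sqrtr ?(ltW h) // mulr0 (_ : xsection _ x = set0) ?measure0 //.
  apply/seteqP; split=> // y /xsectionP /hd h1.
  by have := sqr_ge0 y; move: h h1; move: (r ^+ 2) (x ^+ 2) (y ^+ 2) => A B C; lra.
rewrite (_ : xsection _ x = [set` `[(- Num.sqrt (r ^+ 2 - x ^+ 2)), (Num.sqrt (r ^+ 2 - x ^+ 2))]]).
  rewrite lebesgue_measure_itv /= lte_fin -subr_gt0 opprK -mulr2n pmulrn_lgt0 //.
  rewrite lt_def sqrtr_ge0 andbT; case: eqP => [->|_] /=; first by rewrite mulr0.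
  by rewrite -?EFinB -?EFinD ?opprK; congr EFin; ring.
apply/seteqP; split=> y; rewrite /= in_itv /= -sq_le_itv //; first by move/xsectionP/hd.
by move=> hy; apply/xsectionP/hd.
Qed.

Lemma leb2_translate (v : R * R) (E : set (TR * TR)) : measurable E ->
  leb2 ([set z | E (z.1 + v.1, z.2 + v.2)%R] : set (TR * TR)) = leb2 E.
Proof.
move=> mE; rewrite leb2_xsection.
transitivity (\int[mu]_x mu (xsection E (x + v.1)%R))%E.
  by apply: eq_integral => x _; rewrite -(leb_shift v.2 (measurable_xsection (x + v.1) mE)).
have mT : measurable_fun [set: TR * TR] ((fun z => (z.1 + v.1, z.2)) : TR * TR -> TR * TR).
  apply: measurable_fun_pair; last exact: measurable_snd.
  by apply: measurable_funD; [exact: measurable_fst|exact: measurable_cst].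
have mE' : measurable ([set z | E (z.1 + v.1, z.2)%R] : set (TR * TR)).
  by have := mT measurableT _ mE; rewrite setTI.
transitivity (leb2 ([set z | E (z.1 + v.1, z.2)%R] : set (TR * TR))) => //.
rewrite (leb2_ysection mE) (leb2_ysection mE'); apply: eq_integral => y _.
by rewrite -(leb_shift v.1 (measurable_ysection y mE)).
Qed.

Lemma leb2_disc v (r : R) : 0 < r -> leb2 (disc v r : set (TR * TR)) = (pi * r ^+ 2)%:E.
Proof.
move=> r0; rewrite -(leb2_disc0 r0) -(leb2_translate (- v.1, - v.2) (measurable_disc (0, 0) r)).
by congr leb2; apply/seteqP; split=> z; rewrite /disc /= !subr0.
Qed.

(** Each new disc adds at most its difference with the preceding disc. *)
Lemma sausage (r : R) (v : nat -> R * R) n : 0 < r ->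
  (leb2 (\bigcup_(i in `I_n.+1) (disc (v i) r : set (TR * TR))) <=
   (pi * r ^+ 2 + 2 * r * \sum_(0 <= i < n) eucl (sub2 (v i.+1) (v i)))%:E)%E.
Proof.
move=> r0; elim: n => [|n IH].
  rewrite big_geq // mulr0 addr0 (_ : `I_1 = [set 0%N]); last by apply/seteqP; split=> -[|[]] //=.
  by rewrite bigcup_set1 leb2_disc.
have mD i : measurable (disc (v i) r : set (TR * TR)) by exact: measurable_disc.
set D := \bigcup_(i in _) _; set D0 := \bigcup_(i in _) _ in IH.
have mD0 : measurable (D0 : set (TR * TR)) by exact: bigcup_measurable.
have mDD : measurable (disc (v n.+1) r `\` disc (v n) r : set (TR * TR)) by exact: measurableD.
apply: (@le_trans _ _ (leb2 (D0 `|` (disc (v n.+1) r `\` disc (v n) r) : set (TR * TR)))).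
  apply: (le_measure ((@lebesgue_measure R) \x (@lebesgue_measure R))%E); rewrite ?inE //.
  - exact: bigcup_measurable.
  - exact: measurableU.
  move=> z [i /= ilt iz]; case: (pselect (D0 z)) => [|nz]; first by left.
  right; have : i = n.+1.
    apply/eqP; rewrite eqn_leq -ltnS ilt /= ltnNge; apply/negP => ile.
    by apply: nz; exists i.
  move=> ein; rewrite -ein; split=> // nn; apply: nz; exists n => //=.
apply: (le_trans (measureU2 ((@lebesgue_measure R) \x (@lebesgue_measure R))%E mD0 mDD)).
apply: le_trans (leeD IH (disc_diff (v n) (v n.+1) (ltW r0))) _.
by rewrite -EFinD lee_fin big_nat_recr //= mulrDr addrA.
Qed.

End DiskArea.

(** * The isoperimetric inequality for Jordan curves *)

Section Plane.
Context {R : realType}.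
Notation TR := (measurableTypeR R).
Implicit Types x y z p q : R * R.

Lemma eucl_sqr x : eucl x ^+ 2 = x.1 ^+ 2 + x.2 ^+ 2.
Proof. by rewrite sqr_sqrtr // addr_ge0 ?sqr_ge0. Qed.

Lemma dot_le x y : x.1 * y.1 + x.2 * y.2 <= eucl x * eucl y.
Proof.
apply: le_trans (ler_norm _) _; rewrite -(@ler_pXn2r _ 2) ?nnegrE ?mulr_ge0 ?eucl_ge0 //.
rewrite real_normK ?num_real // exprMn !eucl_sqr -subr_ge0.
have -> : (x.1 ^+ 2 + x.2 ^+ 2) * (y.1 ^+ 2 + y.2 ^+ 2) - (x.1 * y.1 + x.2 * y.2) ^+ 2 = (x.1 * y.2 - x.2 * y.1) ^+ 2 by ring.
exact: sqr_ge0.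
Qed.

Lemma eucl_tri y x z : eucl (sub2 x z) <= eucl (sub2 x y) + eucl (sub2 y z).
Proof.
rewrite -(@ler_pXn2r _ 2) ?nnegrE ?addr_ge0 ?eucl_ge0 // sqrrD !eucl_sqr.
have := dot_le (sub2 x y) (sub2 y z); rewrite /sub2 /=; lra.
Qed.

Lemma eucl_sym x y : eucl (sub2 x y) = eucl (sub2 y x).
Proof. by rewrite /eucl /= -sqrrN opprB -[X in _ + X]sqrrN opprB. Qed.

Lemma eucl_le_l1 x : eucl x <= `|x.1| + `|x.2|.
Proof.
rewrite -(@ler_pXn2r _ 2) ?nnegrE ?addr_ge0 ?eucl_ge0 // eucl_sqr sqrrD !real_normK ?num_real //.
have : 0 <= `|x.1| * `|x.2| by rewrite mulr_ge0.
by move: (_ * _) => a; lra.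
Qed.

Lemma nbhs_eucl (z : R * R) (A : set (R * R)) :
  nbhs z A <-> exists2 e, 0 < e & forall y, eucl (sub2 y z) < e -> A y.
Proof.
split=> [/nbhs_ballP [e e0 h]|[e e0 h]].
  exists e => // y hy; apply: h; have := le_lt_trans (linf_le_eucl _) hy.
  by rewrite /linf gt_max /= => /andP[? ?]; split; rewrite /ball /= distrC.
apply/nbhs_ballP; exists (e / 2); rewrite /= ?divr_gt0 // => y [] /=; rewrite /ball /= => h1 h2.
apply: h; apply: le_lt_trans (eucl_le_l1 _) _; rewrite /= distrC (distrC y.2); lra.
Qed.

Definition seg p q (t : R) : R * R := (p.1 + t * (q.1 - p.1), p.2 + t * (q.2 - p.2)).

Lemma seg_continuous p q : continuous (seg p q).
Proof.
move=> t; have c (a b : R) : a + s * b @[s --> t] --> a + t * b.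
  by apply: cvgD; [exact: cvg_cst|apply: cvgM; [exact: cvg_id|exact: cvg_cst]].
exact: (cvg_pair (c p.1 (q.1 - p.1)) (c p.2 (q.2 - p.2))).
Qed.

Lemma seg_component (A : set (R * R)) p q : (forall t, 0 <= t <= 1 -> A (seg p q t)) -> connected_component A p q.
Proof.
move=> h; exists (seg p q @` [set` `[0, 1]]); first split.
- by exists 0; rewrite /= ?in_itv /= ?lexx ?ler01 // /seg !mul0r !addr0; case: p h.
- by move=> y [t] /=; rewrite in_itv => /h ? <-.
- apply: connected_continuous_connected; first exact: segment_connected.
  exact/continuous_subspaceT/seg_continuous.
by exists 1; rewrite /= ?in_itv /= ?lexx ?ler01 // /seg !mul1r !subrKC; case: q h.
Qed.

Lemma eucl_seg p q (t : R) : 0 <= t <= 1 -> eucl (sub2 (seg p q t) p) <= eucl (sub2 q p) /\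
  eucl (sub2 q (seg p q t)) <= eucl (sub2 q p).
Proof.
move=> /andP[t0 t1]; split.
  have -> : sub2 (seg p q t) p = scal2 t (sub2 q p) by rewrite /sub2 /scal2 /seg /=; congr pair; ring.
  by rewrite eucl_scal // ler_piMl ?eucl_ge0.
have -> : sub2 q (seg p q t) = scal2 (1 - t) (sub2 q p) by rewrite /sub2 /scal2 /seg /=; congr pair; ring.
by rewrite eucl_scal ?subr_ge0 // ler_piMl ?eucl_ge0 // gerBl.
Qed.

Definition eopen (U : set (R * R)) := forall z, U z -> exists2 e, 0 < e & forall y, eucl (sub2 y z) < e -> U y.

(** An open set is a countable union of open squares with rational centres, which belong to the
    product sigma-algebra. *)
Lemma eopen_measurable U : eopen U -> measurable (U : set (TR * TR)).
Proof.
move=> oU; pose box (i : rat * rat * nat) : set (TR * TR) :=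
  [set` `](ratr i.1.1 - i.2.+1%:R^-1), (ratr i.1.1 + i.2.+1%:R^-1)[] `*`
  [set` `](ratr i.1.2 - i.2.+1%:R^-1), (ratr i.1.2 + i.2.+1%:R^-1)[].
pose F i := if `[< box i `<=` U >] then box i else set0.
have -> : U = \bigcup_i F i.
  apply/seteqP; split=> [z Uz|z [i _]]; last by rewrite /F; case: asboolP => // h /h.
  have [e e0 he] := oU z Uz.
  have [n hn] : exists n : nat, n.+1%:R^-1 < e / 4.
    have e4 : 0 < e / 4 by rewrite divr_gt0.
    have := archi_boundP (ltW (_ : 0 < (e / 4)^-1)); rewrite invr_gt0 => /(_ e4) hn.
    exists (Num.bound (e / 4)^-1); rewrite -[ltRHS]invrK ltf_pV2 ?posrE ?invr_gt0 //.
    by apply: lt_trans hn _; rewrite ltr_nat.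
  have n0 : 0 < n.+1%:R^-1 :> R by rewrite invr_gt0.
  have rat_near (a r : R) : 0 < r -> exists q : rat, ratr q - r < a < ratr q + r.
    move=> r0; have : a - r < a + r by lra.
    move=> /rat_in_itvoo[q]; rewrite in_itv /= => /andP[h1 h2]; exists q; apply/andP; split; lra.
  have [q1 h1] := rat_near z.1 _ n0; have [q2 h2] := rat_near z.2 _ n0.
  exists (q1, q2, n) => //; rewrite /F asboolT; first by split; rewrite /= in_itv.
  move=> y [] /=; rewrite !in_itv /= => k1 k2; apply: he.
  apply: le_lt_trans (eucl_le_l1 _) _.
  have dd (q a b : R) : q - n.+1%:R^-1 < a < q + n.+1%:R^-1 -> q - n.+1%:R^-1 < b < q + n.+1%:R^-1 -> `|a - b| < e / 2.
    move: (n.+1%:R^-1) hn => r hr; move=> /andP[? ?] /andP[? ?]; rewrite ltr_norml; apply/andP; split; lra.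
  have := dd _ _ _ k1 h1; have := dd _ _ _ k2 h2; rewrite /=; lra.
apply: countable_bigcupT_measurable; first exact: countableP.
move=> i; rewrite /F; case: ifP => // _.
by apply: measurableX; exact: measurable_itv.
Qed.

End Plane.

Section Jordan.
Context {R : realType}.
Notation TR := (measurableTypeR R).
Variable gam : R -> R * R.
Hypothesis gc : {within unit01 (R:=R), continuous gam}.

Lemma unit01E : unit01 (R:=R) = [set` `[0, 1]].
Proof. by apply/seteqP; split=> t; rewrite /unit01 /= in_itv. Qed.

Lemma image_bounded : exists M, forall t, 0 <= t <= 1 -> `|(gam t).1| <= M /\ `|(gam t).2| <= M.
Proof.
have : compact (gam @` unit01 (R:=R)) by apply: continuous_compact => //; rewrite unit01E; exact: segment_compact.
move=> /compact_bounded [M [_ hM]]; exists (M + 1) => t t01.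
have : `|gam t| <= M + 1 by apply: hM; [rewrite ltrDl|exists t].
by rewrite prod_normE ge_max => /andP[].
Qed.

Lemma image_coeopen : eopen (~` (gam @` unit01 (R:=R))).
Proof.
have : compact (gam @` unit01 (R:=R)) by apply: continuous_compact => //; rewrite unit01E; exact: segment_compact.
move=> /compact_closed => /(_ (@norm_hausdorff _ _)) /closed_openC oC z Az.
by apply/nbhs_eucl; exact: open_nbhs_nbhs.
Qed.

Lemma jordan_int_seg p q : jordan_int gam p -> (forall t, 0 <= t <= 1 -> ~ (gam @` unit01 (R:=R)) (seg p q t)) -> jordan_int gam q.
Proof.
move=> [np bp] h; have c : connected_component (~` (gam @` unit01 (R:=R))) p q by exact: seg_component.
split.
  have := h 1; rewrite /seg !mul1r !subrKC -surjective_pairing; apply.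
  by rewrite ler01 lexx.
by rewrite -(same_connected_component c).
Qed.

Lemma jordan_int_eopen : eopen (jordan_int gam).
Proof.
move=> z Uz; have [nz _] := Uz; have [e e0 he] := image_coeopen nz.
exists e => // y yz; apply: (jordan_int_seg Uz) => t t01; apply: he.
by apply: le_lt_trans yz; have [] := eucl_seg z y t01.
Qed.

(** A point with a coordinate larger than M in absolute value can be pushed outward in that
    coordinate without meeting the curve, so its component is unbounded. *)
Lemma jordan_int_bounded : bounded2 (jordan_int gam).
Proof.
have [M hM] := image_bounded; exists M => z [nz [N hN]].
have ray (q : R * R) : (forall t, 0 <= t <= 1 -> `|(seg z q t).1| > M \/ `|(seg z q t).2| > M) -> `|q.1| <= N /\ `|q.2| <= N.
  move=> h; apply: hN; apply: seg_component => t /h hh [s s01 es].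
  by have [h1 h2] := hM s s01; move: h1 h2; rewrite es => h1 h2; case: hh; rewrite ltNge ?h1 ?h2.
have away (a : R) t : 0 <= t -> M < `|a| -> M < `|a + t * (a + Num.sg a * (`|N| + 1) - a)|.
  move=> t0 ha; apply: lt_le_trans ha _.
  have -> : a + t * (a + Num.sg a * (`|N| + 1) - a) = Num.sg a * (`|a| + t * (`|N| + 1)).
    by rewrite [RHS]mulrDr -numEsg; ring.
  case: (eqVneq a 0) => [->|a0]; first by rewrite sgr0 mul0r normr0.
  by rewrite normrM normr_sg a0 mul1r ger0_norm ?lerDl ?addr_ge0 ?mulr_ge0 ?addr_ge0.
have far (a : R) : a != 0 -> `|a + Num.sg a * (`|N| + 1)| <= N -> False.
  move=> a0; have -> : a + Num.sg a * (`|N| + 1) = Num.sg a * (`|a| + `|N| + 1).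
    by rewrite -[X in _ = _ * X]addrA [RHS]mulrDr -numEsg.
  rewrite normrM normr_sg a0 mul1r ger0_norm ?addr_ge0 // => h.
  by have := ler_norm N; have := normr_ge0 a; lra.
have M0 : 0 <= M by apply: le_trans (normr_ge0 (gam 0).1) (hM 0 _).1; rewrite lexx ler01.
have nz0 (a : R) : M < `|a| -> a != 0 by move=> h; rewrite -normr_gt0 (le_lt_trans M0).
split; rewrite leNgt; apply/negP => h.
  have [h1 _] : `|(z.1 + Num.sg z.1 * (`|N| + 1), z.2).1| <= N /\ `|(z.1 + Num.sg z.1 * (`|N| + 1), z.2).2| <= N.
    by apply: ray => t /andP[t0 _]; left; exact: away.
  exact: (far z.1 (nz0 _ h) h1).
have [_ h1] : `|(z.1, z.2 + Num.sg z.2 * (`|N| + 1)).1| <= N /\ `|(z.1, z.2 + Num.sg z.2 * (`|N| + 1)).2| <= N.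
  by apply: ray => t /andP[t0 _]; right; exact: away.
exact: (far z.2 (nz0 _ h) h1).
Qed.

(** Uniform continuity by compactness; N exceeds the sum of the moduli of a finite subcover, hence
    each of them. *)
Lemma image_fine (d : R) : 0 < d -> exists2 N : nat, (0 < N)%N &
  forall t, 0 <= t <= 1 -> exists2 i : nat, (i <= N)%N & eucl (sub2 (gam t) (gam (i%:R / N%:R))) < d.
Proof.
move=> d0; have d2 : 0 < d / 2 by rewrite divr_gt0.
have loc (t : R) : exists n : nat, 0 <= t <= 1 -> forall s, 0 <= s <= 1 -> `|s - t| < 2 / n.+1%:R -> eucl (sub2 (gam s) (gam t)) < d / 2.
  case: (boolP (0 <= t <= 1)) => t01; last by exists 0%N.
  have /subspace_continuousP/(_ t t01) h := gc.
  have : nbhs (gam t) [set y | eucl (sub2 y (gam t)) < d / 2] by apply/nbhs_eucl; exists (d / 2).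
  move/h => /=; rewrite /within /= => /nbhs_ballP [e e0 he].
  have [n hn] : exists n : nat, n.+1%:R^-1 < e / 2.
    have e4 : 0 < e / 2 by rewrite divr_gt0.
    have := archi_boundP (ltW (_ : 0 < (e / 2)^-1)); rewrite invr_gt0 => /(_ e4) hn.
    exists (Num.bound (e / 2)^-1); rewrite -[ltRHS]invrK ltf_pV2 ?posrE ?invr_gt0 //.
    by apply: lt_trans hn _; rewrite ltr_nat.
  exists n => _ s s01 st; apply: he => //; rewrite /ball /= distrC; apply: lt_trans st _.
  by move: (n.+1%:R^-1) hn => x; lra.
have [n nP] := @choice _ _ _ loc.
pose f (t : R) := [set s : R | `|s - t| < (n t).+1%:R^-1].
have fo t : open (f t).
  have -> : f t = ball t ((n t).+1%:R^-1) by apply/seteqP; split=> s; rewrite /f /ball /= distrC.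
  exact: ball_open.
have : @compact R [set` `[0, 1]] by exact: segment_compact.
rewrite compact_cover => /(_ _ [set` `[0, 1]] f (fun t _ => fo t)) [|D sD hD].
  by move=> t ht; exists t => //; rewrite /f /= subrr normr0 invr_gt0.
pose N := (\sum_(t <- finmap.enum_fset D) (n t).+1).+1.
have N0 : 0 < N%:R :> R by rewrite ltr0n.
exists N => // t t01.
have [u Du tu] : exists2 u, u \in finmap.enum_fset D & `|t - u| < (n u).+1%:R^-1.
  have := hD t; rewrite /= in_itv => /(_ t01) [u /= Du ?]; by exists u.
have nN : ((n u).+1 <= N)%N.
  by rewrite /N ltnW // ltnS (big_rem u) //= leq_addr.
pose i := Num.truncn (t * N%:R); case/andP: (t01) => t0 t1.
have tN0 : 0 <= t * N%:R by rewrite mulr_ge0 // ltW.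
have /andP[i1 i2] := truncn_itv tN0.
have iN : (i <= N)%N by rewrite -(ler_nat R); apply: le_trans i1 _; rewrite ler_piMl // ltW.
exists i => //; set s := i%:R / N%:R.
have s01 : 0 <= s <= 1 by rewrite /s divr_ge0 // ler_pdivrMr // mul1r ler_nat.
have st : `|s - t| <= N%:R^-1.
  rewrite distrC ger0_norm; last by rewrite subr_ge0 ler_pdivrMr.
  by rewrite lerBlDl -[X in _ + X]mul1r -mulrDl natr1 ler_pdivlMr // ltW.
have Nn : N%:R^-1 <= (n u).+1%:R^-1 :> R by rewrite lef_pV2 ?ler_nat // posrE ltr0n.
have u01 : 0 <= u <= 1.
  by have := set_mem (sD u Du); rewrite /= in_itv.
apply: le_lt_trans (eucl_tri (gam u) _ _) _; rewrite [d]splitr; apply: ltrD.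
  by apply: nP => //; apply: lt_trans tu _; rewrite ltr_pMl ?invr_gt0 ?ltr1n.
rewrite eucl_sym; apply: nP => //; apply: le_lt_trans (ler_distD t _ _) _.
by move: ((n u).+1%:R^-1) Nn tu st => x; rewrite distrC; lra.
Qed.

End Jordan.

Section Isoperimetric.
Context {R : realType}.
Notation TR := (measurableTypeR R).
Notation mu2 := ((@lebesgue_measure R) \x (@lebesgue_measure R))%E.
Variable gam : R -> R * R.
Hypothesis gc : {within unit01 (R:=R), continuous gam}.
Hypothesis gU : leb2 (jordan_int gam) = 1%E.

(* With B the disc of radius t, Brunn-Minkowski applies to U + B within U `|` G, which bounds G
   outside U, and to (U `\` G) + B within U, which bounds G inside U. *)
Lemma tube_area (v : nat -> R * R) (N : nat) (t d : R) : 0 < t -> 0 < d ->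
  (forall w, (gam @` unit01 (R:=R)) w -> exists2 i, (i <= N)%N & eucl (sub2 w (v i)) < d) ->
  ((4 * t * Num.sqrt pi)%:E <= leb2 (\bigcup_(i in `I_N.+1) (disc (v i) (t + d) : set (TR * TR))))%E.
Proof.
move=> t0 d0 hv; have td0 : 0 < t + d by exact: addr_gt0.
set G := \bigcup_(i in _) _.
have mG : measurable (G : set (TR * TR)) by apply: bigcup_measurable => i _; exact: measurable_disc.
pose U := jordan_int gam; have mU : measurable (U : set (TR * TR)) by apply: eopen_measurable; exact: jordan_int_eopen.
have hit z w : (gam @` unit01 (R:=R)) w -> eucl (sub2 z w) < t -> G z.
  move=> /hv [i iN hi] zw; exists i; first by rewrite /= ltnS.
  rewrite discE ?ltW //=; apply: le_lt_trans (eucl_tri w _ _) _; exact: ltrD.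
(* A segment of length less than t that leaves U crosses the curve, within t of both its ends. *)
have seg_hit z b : U z -> eucl b < t -> ~ U (z.1 + b.1, z.2 + b.2) -> G z /\ G (z.1 + b.1, z.2 + b.2).
  move=> Uz bt nU; set y := (_, _) in nU *.
  have [s s01 hs] : exists2 s, 0 <= s <= 1 & (gam @` unit01 (R:=R)) (seg z y s).
    apply: contrapT => h; apply: nU; apply: (jordan_int_seg Uz) => s s01 hs.
    by apply: h; exists s.
  have yz : sub2 y z = b by rewrite /sub2 /y /= (addrC z.1) (addrC z.2) !addrK -surjective_pairing.
  have [h1 h2] := eucl_seg z y s01; rewrite yz in h1 h2.
  split; first by apply: (hit _ _ hs); rewrite eucl_sym; exact: le_lt_trans bt.
  by apply: (hit _ _ hs); exact: le_lt_trans bt.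
have Gfin : (leb2 G < +oo)%E by apply: le_lt_trans (sausage v N td0) _; rewrite ltry.
have Dle (A B : set (R * R)) : measurable (A : set (TR * TR)) -> measurable (B : set (TR * TR)) -> A `<=` B ->
    (leb2 B < +oo)%E -> exists2 r : R, 0 <= r & leb2 A = r%:E.
  move=> mA mB AB fB; have fA : (leb2 A < +oo)%E by apply: le_lt_trans fB; exact: (le_measure mu2 (mem_set mA) (mem_set mB) AB).
  have A0 : (0 <= leb2 A)%E by exact: (measure_ge0 mu2).
  exists (fine (leb2 A)); first exact: fine_ge0.
  by rewrite fineK // ge0_fin_numE.
have mGU : measurable (G `\` U : set (TR * TR)) by exact: measurableD.
have mUG : measurable (U `\` G : set (TR * TR)) by exact: measurableD.
have mI : measurable (G `&` U : set (TR * TR)) by exact: measurableI.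
have fU : (leb2 U < +oo)%E by rewrite gU ltry.
have [g1 g10 e1] := Dle _ _ mGU mG (@subDsetl _ G U) Gfin.
have [g2 g20 e2] := Dle _ _ mI mG (@subIsetl _ G U) Gfin.
have [u0 u00 e0] := Dle _ _ mUG mU (@subDsetl _ U G) fU.
have eG : leb2 G = (g1 + g2)%:E by rewrite EFinD -e1 -e2; exact: (measureDI mu2).
have eU : 1 = u0 + g2 :> R.
  apply/EFin_inj; rewrite EFinD -e0 -e2 -gU setIC; exact: (measureDI mu2).
have eUG : leb2 (U `|` G) = (1 + g1)%:E.
  rewrite EFinD -e1 -gU (_ : U `|` G = U `|` (G `\` U)); last by rewrite setUDr setDv setD0.
  by apply: (measureU mu2) => //; exact: setDIK.
have sp0 : 0 <= Num.sqrt pi :> R by exact: sqrtr_ge0.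
have tp : 0 < pi * t ^+ 2 by rewrite mulr_gt0 ?pi_gt0 ?exprn_gt0.
have sqtp : Num.sqrt (pi * t ^+ 2) = Num.sqrt pi * t by rewrite sqrtrM ?pi_ge0 // sqrtr_sqr gtr0_norm.
have mB : measurable (disc (0, 0)%R t : set (TR * TR)) by exact: measurable_disc.
have eB : leb2 (disc (0, 0)%R t : set (TR * TR)) = (pi * t ^+ 2)%:E by exact: leb2_disc.
have bt b : disc (0, 0)%R t b -> eucl b < t.
  by rewrite discE ?ltW // /sub2 /= !subr0 -surjective_pairing.
have bB : bounded2 (disc (0, 0)%R t).
  exists t => b /bt h; have := le_lt_trans (linf_le_eucl _) h.
  by rewrite /linf gt_max => /andP[/ltW ? /ltW].
have bU : bounded2 U by exact: jordan_int_bounded.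
have b1 : Num.sqrt 1 + Num.sqrt (pi * t ^+ 2) <= Num.sqrt (1 + g1).
  apply: (@brunn_minkowski R U (disc (0, 0) t) (U `|` G)) => //; first exact: measurableU.
  move=> z b Uz /bt hb; case: (pselect (U (z.1 + b.1, z.2 + b.2))) => hu; first by left.
  by right; have [] := seg_hit z b Uz hb hu.
have b2 : 0 < u0 -> Num.sqrt u0 + Num.sqrt (pi * t ^+ 2) <= Num.sqrt 1.
  move=> u0p; apply: (@brunn_minkowski R (U `\` G) (disc (0, 0) t) U) => //.
    by have [M hM] := bU; exists M => z [/hM].
  move=> z b [Uz nG] /bt hb; apply: contrapT => hu.
  by have [] := seg_hit z b Uz hb hu.
rewrite sqtp sqrtr1 in b1 b2; rewrite eG lee_fin.
set s := Num.sqrt pi * t in b1 b2; have s0 : 0 < s by rewrite mulr_gt0 ?sqrtr_gt0 ?pi_gt0.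
have -> : 4 * t * Num.sqrt pi = 4 * s by rewrite /s; ring.
(* With s = t sqrt pi, the area of G outside U is at least 2s + s^2, and inside U it is 1 - u0 >= 2s
   - s^2; the squares cancel in the sum 4s. If u0 = 0 the second bound is immediate. *)
have h1 : (1 + s) ^+ 2 <= 1 + g1.
  by rewrite -[leRHS]sqr_sqrtr ?addr_ge0 // ler_pXn2r ?nnegrE ?sqrtr_ge0 ?addr_ge0 // ltW.
have h2 : u0 <= (1 - s) ^+ 2.
  move: u00; rewrite le_eqVlt => /predU1P[<-|u0p]; first exact: sqr_ge0.
  have := b2 u0p; have := sqrtr_ge0 u0; rewrite -{3}(sqr_sqrtr (ltW u0p)) => h3 h4.
  by rewrite ler_pXn2r ?nnegrE //; lra.
move: h1 h2 eU; clear; rewrite sqrrB sqrrD !expr1n !mul1r; move: (s ^+ 2) => q; lra.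
Qed.

Lemma len_ge (rho : R * R -> R) (N : nat) : (0 < N)%N ->
  ((\sum_(0 <= i < N) rho (sub2 (gam (i.+1%:R / N%:R)) (gam (i%:R / N%:R))))%:E <= len_rho rho gam)%E.
Proof.
move=> N0; have N0' : 0 < N%:R :> R by rewrite ltr0n.
apply: ereal_sup_ubound; exists N, (fun i => i%:R / N%:R); split=> //.
- by move=> i _; rewrite /= ler_pM2r ?invr_gt0 // ler_nat.
- by rewrite /= divff // gt_eqF.
Qed.

(** The polygon has mesh t^2, negligible against the radius t. Dividing the two area bounds by t and
    letting t tend to 0 leaves 4 sqrt pi <= 2 l. *)
Lemma isoperimetric : ((2 * Num.sqrt pi)%:E <= len_rho (@eucl R) gam)%E.
Proof.
have key (t : R) : 0 < t -> ((4 * Num.sqrt pi)%:E <= (pi * t * (1 + t) ^+ 2)%:E + (2 * (1 + t))%:E * len_rho (@eucl R) gam)%E.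
  move=> t0; have t2 : 0 < t ^+ 2 by rewrite exprn_gt0.
  have [N N0 hN] := image_fine gc t2; pose v i := gam (i%:R / N%:R).
  have hv w : (gam @` unit01 (R:=R)) w -> exists2 i, (i <= N)%N & eucl (sub2 w (v i)) < t ^+ 2.
    by move=> [s s01 <-]; exact: hN.
  have tt : 0 < t + t ^+ 2 by exact: addr_gt0.
  have := le_trans (tube_area t0 t2 hv) (sausage v N tt).
  rewrite lee_fin; set S := \sum_(0 <= i < N) _ => hS.
  apply: (@le_trans _ _ ((pi * t * (1 + t) ^+ 2)%:E + (2 * (1 + t))%:E * S%:E)%E).
    rewrite -EFinM -EFinD lee_fin -(ler_pM2l t0).
    by move: hS; congr (_ <= _); ring.
  by apply: leeD2l; apply: lee_wpmul2l; [rewrite lee_fin; lra|exact: len_ge].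
case L : (len_rho (@eucl R) gam) key => [l| |] key; last 2 first.
- by rewrite leey.
- have := key 1 ltr01; rewrite gt0_muleNy; last by rewrite lte_fin; lra.
  by rewrite addeNy.
rewrite lee_fin; have sp : 0 < pi :> R by exact: pi_gt0.
have l0 : 0 <= l.
  rewrite -lee_fin -L; apply: le_trans (len_ge (@eucl R) (ltnSn 0)).
  by rewrite lee_fin sumr_ge0 // => *; exact: eucl_ge0.
apply/ler_addgt0Pr => e e0.
(* For t <= 1 the error terms are at most t (4 pi + 2 l). *)
pose t := Num.min 1 (e / (4 * pi + 2 * l)).
have D0 : 0 < 4 * pi + 2 * l by lra.
have t0 : 0 < t by rewrite lt_min ltr01 divr_gt0.
have t1 : t <= 1 by rewrite ge_min lexx.
have te : t * (4 * pi + 2 * l) <= e by rewrite -ler_pdivlMr // ge_min lexx orbT.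
have := key t t0; rewrite -EFinM -EFinD lee_fin => h.
have h3 : pi * t * (1 + t) ^+ 2 <= pi * t * 4.
  by apply: ler_wpM2l; [rewrite mulr_ge0 // ltW|nra].
nra.
Qed.

End Isoperimetric.

(** * The circle *)

Section Circle.
Context {R : realType}.
Notation TR := (measurableTypeR R).

Lemma sin_sqr_le (y : R) : sin y ^+ 2 <= y ^+ 2.
Proof.
wlog y0 : y / 0 <= y => [h|].
  by case: (leP 0 y) => [/h//|y0]; rewrite -[sin y ^+ 2]sqrrN -[y ^+ 2]sqrrN -sinN; apply: h; rewrite oppr_ge0 ltW.
have [c _] : exists2 c, c \in `[0, y]%R & sin y - sin 0 = cos c * (y - 0).
  apply: MVT_segment => //.
  exact/continuous_subspaceT/continuous_sin.
rewrite sin0 !subr0 => ->; rewrite exprMn ler_piMl ?sqr_ge0 //.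
Qed.

Lemma cos_half (x : R) : 2 - 2 * cos x = 4 * sin (x / 2) ^+ 2.
Proof.
have := cos2Dsin2 (x / 2); have := cos_mulr2n (x / 2).
rewrite (_ : x / 2 *+ 2 = x); last by rewrite -mulr_natr divfK.
by move=> ->; rewrite -mulr_natl; lra.
Qed.

Variable r : R.
Hypothesis r0 : 0 < r.

Definition circ (t : R) : R * R := (r * cos (pi *+ 2 * t), r * sin (pi *+ 2 * t)).

Lemma circ_chord s t : eucl (sub2 (circ s) (circ t)) ^+ 2 = r ^+ 2 * (4 * sin (pi *+ 2 * (s - t) / 2) ^+ 2).
Proof.
rewrite -cos_half (mulrBr (pi *+ 2)) cosB eucl_sqr /=.
have := cos2Dsin2 (pi *+ 2 * s); have := cos2Dsin2 (pi *+ 2 * t).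
move: (cos _) (sin _) (cos _) (sin _) => a b c d h1 h2.
transitivity (r ^+ 2 * ((c ^+ 2 + d ^+ 2) + (a ^+ 2 + b ^+ 2) - 2 * (c * a + d * b))); first by ring.
by rewrite h1 h2; ring.
Qed.

Lemma circ_chord_le s t : eucl (sub2 (circ s) (circ t)) <= r * (pi *+ 2) * `|s - t|.
Proof.
have p0 : 0 <= pi *+ 2 :> R by rewrite mulrn_wge0 ?pi_ge0.
rewrite -(@ler_pXn2r _ 2) ?nnegrE ?eucl_ge0 ?mulr_ge0 ?(ltW r0) // circ_chord.
have -> : (r * (pi *+ 2) * `|s - t|) ^+ 2 = r ^+ 2 * ((pi *+ 2) * (s - t)) ^+ 2.
  by rewrite !exprMn real_normK ?num_real //; ring.
apply: ler_wpM2l; first exact: sqr_ge0.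
apply: le_trans (_ : 4 * (pi *+ 2 * (s - t) / 2) ^+ 2 <= _); first by rewrite ler_pM2l ?sin_sqr_le.
by rewrite le_eqVlt; apply/orP; left; apply/eqP; field.
Qed.

Lemma eucl_circ t : eucl (circ t) = r.
Proof.
rewrite -[RHS](@gtr0_norm _ r) // -sqrtr_sqr; congr Num.sqrt.
by rewrite /= !exprMn -mulrDr cos2Dsin2 mulr1.
Qed.

Lemma circ_continuous : continuous circ.
Proof.
move=> t; have l : pi *+ 2 * s @[s --> t] --> (pi *+ 2 * t : R) by apply: cvgM; [exact: cvg_cst|exact: cvg_id].
have cs : r * cos (pi *+ 2 * s) @[s --> t] --> r * cos (pi *+ 2 * t).
  by apply: cvgM; [exact: cvg_cst|apply: continuous_comp; [exact: l|exact: continuous_cos]].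
have sn : r * sin (pi *+ 2 * s) @[s --> t] --> r * sin (pi *+ 2 * t).
  by apply: cvgM; [exact: cvg_cst|apply: continuous_comp; [exact: l|exact: continuous_sin]].
exact: cvg_pair cs sn.
Qed.

Lemma circ_inj s t : 0 <= s < 1 -> 0 <= t < 1 -> circ s = circ t -> s = t.
Proof.
wlog ts : s t / t <= s => [h s1 t1 e|].
  by case: (leP t s) => ts; [exact: h|apply/esym; apply: h => //; exact: ltW].
move=> /andP[_ s1] /andP[t0 _] e; move: ts; rewrite le_eqVlt => /predU1P[//|ts].
have := circ_chord s t; rewrite e (_ : sub2 _ _ = (0, 0)); last by rewrite /sub2 !subrr.
rewrite eucl_sqr /= expr0n addr0 => /esym/eqP.
rewrite mulf_eq0 sqrf_eq0 (gt_eqF r0) mulf_eq0 pnatr_eq0 sqrf_eq0 /= gt_eqF //; apply: sin_gt0_pi.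
have -> : pi *+ 2 * (s - t) / 2 = pi * (s - t) by field.
have st : 0 < s - t by rewrite subr_gt0.
rewrite mulr_gt0 ?pi_gt0 //= gtr_pMr ?pi_gt0 //; lra.
Qed.

Lemma circ_jordan : jordan_curve circ.
Proof.
split; first exact/continuous_subspaceT/circ_continuous.
by split; [rewrite /circ mulr0 mulr1 cos0 sin0 cos2pi sin2pi|move=> s t; exact: circ_inj].
Qed.

Lemma circ_image z : eucl z = r -> (circ @` unit01 (R:=R)) z.
Proof.
move=> ez; have h2 : z.1 ^+ 2 + z.2 ^+ 2 = r ^+ 2 by rewrite -ez eucl_sqr.
have x1 : -1 <= z.1 / r <= 1.
  rewrite ler_pdivrMr // ler_pdivlMr // mulN1r mul1r -ler_norml.
  rewrite -(@ler_pXn2r _ 2) ?nnegrE ?(ltW r0) // real_normK ?num_real // -h2 lerDl; exact: sqr_ge0.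
set a := acos (z.1 / r); have a0 : 0 <= a by exact: acos_ge0.
have ap : a <= pi by exact: acos_lepi.
have ca : r * cos a = z.1 by rewrite acosK ?in_itv // mulrC divfK // gt_eqF.
have sa : r * sin a = `|z.2|.
  have er : r = Num.sqrt (r ^+ 2) by rewrite sqrtr_sqr gtr0_norm.
  rewrite sin_acos // [X in X * _]er -sqrtrM ?sqr_ge0 //.
  rewrite -[RHS]sqrtr_sqr; congr Num.sqrt; rewrite (_ : z.2 ^+ 2 = r ^+ 2 - z.1 ^+ 2); last by lra.
  by field; rewrite gt_eqF.
have p0 : 0 < pi *+ 2 :> R by rewrite pmulrn_lgt0 ?pi_gt0.
have pn : pi *+ 2 != 0 :> R by rewrite gt_eqF.
have q01 : 0 <= a / (pi *+ 2) <= 1.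
  rewrite divr_ge0 ?(ltW p0) //= ler_pdivrMr // mul1r mulr2n; apply: le_trans ap _.
  by rewrite lerDl pi_ge0.
case: (leP 0 z.2) => z2.
  exists (a / (pi *+ 2)) => //.
  by rewrite /circ (mulrC (pi *+ 2)) divfK // ca sa ger0_norm // -surjective_pairing.
exists (1 - a / (pi *+ 2)).
  by move: q01; rewrite /unit01 /=; move: (a / _) => b; lra.
rewrite /circ (_ : pi *+ 2 * _ = - a + pi *+ 2); last by rewrite mulrBr mulr1 (mulrC (pi *+ 2)) divfK // addrC.
by rewrite cosD2pi sinD2pi cosN sinN mulrN ca sa ltr0_norm // opprK -surjective_pairing.
Qed.

Lemma eucl_continuous : continuous (@eucl R).
Proof.
move=> z; apply/cvgrPdist_lt => e e0; apply/nbhs_eucl; exists e => // y hy.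
have := eucl_tri y z (0, 0); have := eucl_tri z y (0, 0); rewrite (eucl_sym z y).
have s0 x : sub2 x (0, 0) = x :> R * R by rewrite /sub2 /= !subr0 -surjective_pairing.
by rewrite !s0 ltr_norml => h1 h2; apply/andP; split; lra.
Qed.

(** From a point outside the disc the radial ray escapes to infinity. The component of a point
    inside has an interval of Euclidean norms that omits r, hence stays inside. *)
Lemma circ_int : jordan_int circ = disc (0, 0) r.
Proof.
have s0 (x : R * R) : sub2 x (0, 0) = x by rewrite /sub2 /= !subr0 -surjective_pairing.
rewrite discE ?ltW //; apply/seteqP; split=> z /=; rewrite s0.
  move=> [nz [M hM]]; rewrite ltNge; apply/negP => rz.
  have {}rz : r < eucl z.
    by rewrite lt_neqAle rz andbT; apply/eqP => e; apply: nz; exact: circ_image.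
  pose k := (`|M| + 1) * 2 / r + 1; have M1 : 0 < `|M| + 1 by rewrite ltr_wpDl.
  have k1 : 1 <= k by rewrite lerDr divr_ge0 ?ltW // mulr_ge0 ?ltW.
  have : connected_component (~` (circ @` unit01 (R:=R))) z (scal2 k z).
    apply: seg_component => t /andP[t0 _] [s _ es].
    have : eucl (seg z (scal2 k z) t) = (1 + t * (k - 1)) * eucl z.
      rewrite -eucl_scal; last by rewrite addr_ge0 // mulr_ge0 // subr_ge0.
      by congr eucl; rewrite /seg /scal2 /=; congr pair; ring.
    rewrite -es eucl_circ => e.
    have : r < (1 + t * (k - 1)) * eucl z.
      apply: lt_le_trans rz _; rewrite ler_peMl ?eucl_ge0 // lerDl mulr_ge0 // subr_ge0 //.
    by rewrite -e ltxx.
  move=> /hM [h1 h2].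
  have : eucl (scal2 k z) <= 2 * `|M|.
    apply: le_trans (eucl_le_l1 _) _.
    have := ler_norm M; move: h1 h2; rewrite /=; lra.
  rewrite eucl_scal; last by lra.
  apply/negP; rewrite -ltNge; apply: lt_trans (_ : k * r < _); last by rewrite ltr_pM2l //; lra.
  rewrite /k [(_ + 1) * r]mulrDl divfK ?gt_eqF // mul1r.
  have -> : (`|M| + 1) * 2 + r = 2 * `|M| + (2 + r) by ring.
  by rewrite ltrDl addr_gt0.
move=> rz; have nz : ~ (circ @` unit01 (R:=R)) z.
  by move=> [s _ es]; move: rz; rewrite -es eucl_circ ltxx.
split=> //; exists r => p hp.
suff pr : eucl p < r.
  by have := le_lt_trans (linf_le_eucl p) pr; rewrite /linf gt_max => /andP[/ltW ? /ltW].
rewrite ltNge; apply/negP => rp.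
have : connected ((@eucl R) @` connected_component (~` (circ @` unit01 (R:=R))) z).
  apply: connected_continuous_connected; first exact: component_connected.
  exact/continuous_subspaceT/eucl_continuous.
move/connected_intervalP => /(_ (eucl z) (eucl p)) h.
have [|||q hq eq] := h _ _ r.
- by exists z => //; exact: connected_component_refl.
- by exists p.
- by rewrite ltW.
by have := connected_component_sub hq; apply; exact: circ_image.
Qed.

Lemma circ_len : (len_rho (@eucl R) circ <= (r * (pi *+ 2))%:E)%E.
Proof.
apply: ge_ereal_sup => _ [N [t [t0 tm t1 ->]]]; rewrite lee_fin.
apply: (@le_trans _ _ (\sum_(0 <= i < N) r * (pi *+ 2) * (t i.+1 - t i))).
  rewrite !big_mkord; apply: ler_sum => i _.
  by rewrite -[X in _ * X]ger0_norm ?subr_ge0 ?tm //; exact: circ_chord_le.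
rewrite -mulr_sumr telescope_sumr //; apply: ler_piMr; last by rewrite lerBlDr (le_trans t1) // lerDl.
by apply: mulr_ge0; [exact: ltW|rewrite mulrn_wge0 ?pi_ge0].
Qed.

End Circle.

(** * Length minimization and Wulff crystals *)

Section WulffPhi.
Context {R : realType}.
Notation TR := (measurableTypeR R).
Notation mu2 := ((@lebesgue_measure R) \x (@lebesgue_measure R))%E.

Lemma len_le (rho rho' : R * R -> R) (c : R) (gam : R -> R * R) : 0 <= c -> (forall x, rho x <= c * rho' x) ->
  (len_rho rho gam <= c%:E * len_rho rho' gam)%E.
Proof.
move=> c0 h; apply: ge_ereal_sup => _ [N [t [t0 tm t1 ->]]].
pose S := \sum_(0 <= i < N) rho' (sub2 (gam (t i.+1)) (gam (t i))).
apply: (@le_trans _ _ (c%:E * S%:E)%E); first by rewrite lee_fin /S mulr_sumr; apply: ler_sum.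
by apply: lee_wpmul2l; rewrite ?lee_fin //; apply: ereal_sup_ubound; exists N, t.
Qed.

Variables (beta : R * R -> R) (a b : R).
Hypothesis a0 : 0 < a.
Hypothesis ab : a <= b.
Hypothesis beta_ge : forall x, a * eucl x <= beta x.
Hypothesis beta_le : forall x, beta x <= b * eucl x.

Let b0 : 0 < b := lt_le_trans a0 ab.

Lemma phi_ge : ((a * (2 * Num.sqrt pi))%:E <= phi beta)%E.
Proof.
apply: le_ereal_inf_tmp => _ [gam [[gc _] gU] <-].
have h : (len_rho (@eucl R) gam <= (a^-1)%:E * len_rho beta gam)%E.
  by apply: len_le; [rewrite invr_ge0 ltW|move=> x; rewrite mulrC ler_pdivlMr // mulrC].
have := le_trans (isoperimetric gc gU) h.
move/(lee_wpmul2l (_ : (0 <= a%:E)%E)); rewrite lee_fin muleA -!EFinM => /(_ (ltW a0)).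
by rewrite mulfV ?gt_eqF // mul1e.
Qed.

Lemma phi_le : (phi beta <= (b * (2 * Num.sqrt pi))%:E)%E.
Proof.
have sp : 0 < Num.sqrt pi :> R by rewrite sqrtr_gt0 pi_gt0.
(* The radius for which the disc has area 1. *)
pose r : R := (Num.sqrt pi)^-1; have r0 : 0 < r by rewrite invr_gt0.
apply: (@le_trans _ _ (len_rho beta (circ r))).
  apply: ereal_inf_lbound; exists (circ r) => //; split; first exact: circ_jordan.
  rewrite circ_int // leb2_disc //; congr EFin.
  by rewrite /r exprVn sqr_sqrtr ?pi_ge0 // mulfV // gt_eqF // pi_gt0.
apply: le_trans (len_le _ (ltW b0) beta_le) _.
apply: (@le_trans _ _ (b%:E * (r * (pi *+ 2))%:E)%E).
  by apply: lee_wpmul2l; [rewrite lee_fin ltW|exact: circ_len].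
rewrite -EFinM lee_fin ler_pM2l // /r -[X in X *+ 2](@sqr_sqrtr R) ?pi_ge0 //.
by rewrite le_eqVlt; apply/orP; left; apply/eqP; field; rewrite gt_eqF.
Qed.

Lemma disk_sub_wulff : disk a `<=` wulff beta.
Proof.
move=> x xa u u1; apply: le_trans (dot_le u x) _; rewrite u1 mul1r.
by apply: le_trans xa _; have := beta_ge u; rewrite u1 mulr1.
Qed.

Lemma wulff_sub_disk : wulff beta `<=` disk b.
Proof.
move=> x xW; rewrite /disk /=; case: (eqVneq (eucl x) 0) => [->|x0]; first exact: ltW.
have xp : 0 < eucl x by rewrite lt_def x0 eucl_ge0.
pose u := scal2 (eucl x)^-1 x.
have u1 : eucl u = 1 by rewrite eucl_scal ?invr_ge0 ?eucl_ge0 // mulVf.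
have := xW u u1; move/le_trans/(_ (beta_le u)); rewrite u1 mulr1; apply: le_trans.
by rewrite /u /= -!mulrA -mulrDr -!expr2 -eucl_sqr expr2 mulKf.
Qed.

Lemma measurable_wulff : measurable (wulff beta : set (TR * TR)).
Proof.
rewrite -[wulff beta]setCK; apply: measurableC; apply: eopen_measurable => x nx.
have [u [u1 hu]] : exists u, eucl u = 1 /\ beta u < u.1 * x.1 + u.2 * x.2.
  apply: contrapT => h; apply: nx => u u1; rewrite leNgt; apply/negP => hu; apply: h.
  by exists u.
exists (u.1 * x.1 + u.2 * x.2 - beta u); first by rewrite subr_gt0.
move=> y; rewrite eucl_sym => xy yW; have := yW u u1; have := dot_le u (sub2 x y).
by rewrite u1 /=; move: xy; lra.
Qed.

Lemma measurable_disk (r : R) : 0 <= r -> measurable (disk r : set (TR * TR)).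
Proof.
move=> r0; rewrite -[disk r]setCK; apply: measurableC; apply: eopen_measurable => x /negP.
rewrite -ltNge => rx; exists (eucl x - r); first by rewrite subr_gt0.
move=> y; rewrite eucl_sym => xy /= yr.
have := eucl_tri y x (0, 0); rewrite {1 3}/sub2 /= !subr0 -!surjective_pairing.
by move: yr; rewrite /disk /=; lra.
Qed.

Lemma wulff_scale : exists2 s : R, 0 < s & [/\ wulff_hat beta = scal2 s^-1 @` wulff beta,
  Num.sqrt pi * a <= s & s <= Num.sqrt pi * b].
Proof.
have h1 : ((pi * a ^+ 2)%:E <= leb2 (wulff beta))%E.
  rewrite -leb2_disk //; apply: (le_measure mu2); last exact: disk_sub_wulff.
    by apply: mem_set; apply: measurable_disk; exact: ltW.
  by apply: mem_set; exact: measurable_wulff.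
have h2 : (leb2 (wulff beta) <= (pi * b ^+ 2)%:E)%E.
  rewrite -leb2_disk //; apply: (le_measure mu2); last exact: wulff_sub_disk.
    by apply: mem_set; exact: measurable_wulff.
  by apply: mem_set; apply: measurable_disk; exact: ltW.
have sq (c : R) : 0 < c -> Num.sqrt pi * c = Num.sqrt (pi * c ^+ 2).
  by move=> c0; rewrite sqrtrM ?pi_ge0 // sqrtr_sqr gtr0_norm.
case E : (leb2 (wulff beta)) h1 h2 => [l| |] //; rewrite !lee_fin => h1 h2.
exists (Num.sqrt l).
  by rewrite sqrtr_gt0; apply: lt_le_trans h1; rewrite mulr_gt0 ?pi_gt0 ?exprn_gt0.
by rewrite /wulff_hat E !sq // !ler_wsqrtr.
Qed.

(** Contraction by a / b maps each of the two sets into the other, and moves a point of norm at most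
    (b/a) / sqrt pi by at most (1 - a/b) times that bound. *)
Lemma hausdorff_le : (hausdorff (wulff_hat beta) (disk (Num.sqrt pi)^-1) <= ((Num.sqrt pi)^-1 * (b / a - 1))%:E)%E.
Proof.
have [s s0 [-> sa sb]] := wulff_scale; set rho := (Num.sqrt pi)^-1.
have sp : 0 < Num.sqrt pi :> R by rewrite sqrtr_gt0 pi_gt0.
have rho0 : 0 < rho by rewrite invr_gt0.
have k0 : 0 <= a / b by rewrite divr_ge0 ?ltW.
have k1 : a / b <= 1 by rewrite ler_pdivrMr // mul1r.
have dist x M : eucl x <= M -> linf (sub2 x (scal2 (a / b) x)) <= (1 - a / b) * M /\
    linf (sub2 (scal2 (a / b) x) x) <= (1 - a / b) * M.
  move=> xM; have h : (1 - a / b) * eucl x <= (1 - a / b) * M by apply: ler_wpM2l; rewrite ?subr_ge0.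
  have e1 : sub2 x (scal2 (a / b) x) = scal2 (1 - a / b) x.
    by rewrite /sub2 /scal2 /=; congr pair; ring.
  split; apply: le_trans (linf_le_eucl _) _; rewrite ?[eucl (sub2 (scal2 _ _) _)]eucl_sym e1 eucl_scal ?subr_ge0 //.
have an : a != 0 by rewrite gt_eqF.
have bn : b != 0 by rewrite gt_eqF.
have k2 : 1 - a / b <= b / a - 1.
  rewrite -subr_ge0; have -> : b / a - 1 - (1 - a / b) = (b - a) ^+ 2 / (a * b) by field; rewrite an bn.
  by rewrite divr_ge0 ?sqr_ge0 // mulr_ge0 ?ltW.
rewrite /hausdorff ge_max; apply/andP; split; apply: ge_ereal_sup => _ [x xS <-].
  have xM : eucl x <= rho * (b / a).
    case: xS => w wW <-; rewrite eucl_scal ?invr_ge0 ?(ltW s0) // mulrC ler_pdivrMr //.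
    apply: le_trans (wulff_sub_disk wW) _.
    rewrite [leLHS](_ : b = rho * (b / a) * (Num.sqrt pi * a)); last by rewrite /rho; field; rewrite an gt_eqF.
    by rewrite ler_pM2l // mulr_gt0 ?divr_gt0.
  apply: (@le_trans _ _ (linf (sub2 x (scal2 (a / b) x)))%:E).
    apply: ereal_inf_lbound; exists (scal2 (a / b) x) => //.
    rewrite /disk /= eucl_scal //; apply: le_trans (ler_wpM2l k0 xM) _.
    by rewrite le_eqVlt; apply/orP; left; apply/eqP; field; rewrite an bn.
  rewrite lee_fin; apply: le_trans (dist x _ xM).1 _.
  by rewrite le_eqVlt; apply/orP; left; apply/eqP; field; rewrite an bn.
apply: (@le_trans _ _ (linf (sub2 (scal2 (a / b) x) x))%:E).
  apply: ereal_inf_lbound; exists (scal2 (a / b) x) => //.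
  exists (scal2 s (scal2 (a / b) x)); last first.
    by rewrite /scal2 /= !mulKf ?gt_eqF.
  apply: disk_sub_wulff; rewrite /disk /= !eucl_scal ?(ltW s0) //.
  apply: (@le_trans _ _ (Num.sqrt pi * b * (a / b * rho))).
    by apply: ler_pM => //; [exact: ltW|rewrite mulr_ge0 ?eucl_ge0|apply: ler_wpM2l].
  by rewrite le_eqVlt; apply/orP; left; apply/eqP; rewrite /rho; field; rewrite bn gt_eqF.
rewrite lee_fin; apply: le_trans (dist x _ xS).2 _.
by rewrite mulrC ler_pM2l.
Qed.

Lemma hausdorff_ge0 : (0 <= hausdorff (wulff_hat beta) (disk (Num.sqrt pi)^-1))%E.
Proof.
have linf0 (x : R * R) : 0 <= linf x by rewrite /linf le_max normr_ge0.
rewrite /hausdorff le_max; apply/orP; right.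
have d0 : disk (Num.sqrt pi)^-1 ((0, 0) : R * R).
  by rewrite /disk /= /eucl /= expr0n addr0 sqrtr0 invr_ge0 sqrtr_ge0.
apply: ereal_sup_ge; exists (ereal_inf [set (linf (sub2 x (0, 0)))%:E | x in wulff_hat beta]).
  by exists (0, 0).
by apply: le_ereal_inf_tmp => _ [x _ <-]; rewrite lee_fin.
Qed.

End WulffPhi.

Section MainLemmas.
Context {R : realType}.

Lemma cvge_right (f : R -> \bar R) (x l : R) :
  (forall e : R, 0 < e -> exists2 d, 0 < d & forall p, x < p < x + d -> ((l - e)%:E <= f p <= (l + e)%:E)%E) ->
  f @ x^'+ --> l%:E.
Proof.
move=> h; have nearR d : 0 < d -> \forall p \near x^'+, x < p < x + d.
  move=> d0; near=> p; apply/andP; split; near: p; [exact: nbhs_right_gt|apply: nbhs_right_lt; rewrite ltrDl //].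
apply/fine_cvgP; split.
  have [d d0 hd] := h 1 ltr01; apply: filterS (nearR d d0) => p /hd /andP[h1 h2].
  by rewrite fin_real // (lt_le_trans _ h1) ?ltNyr //= (le_lt_trans h2) ?ltry.
apply/cvgrPdist_le => e e0; have [d d0 hd] := h e e0; apply: filterS (nearR d d0) => p /hd.
case E : (f p) => [r| |]; rewrite ?leye_eq ?leeNy_eq ?andbF // !lee_fin => /andP[h1 h2].
by rewrite /= E /= distrC ler_norml; apply/andP; split; lra.
Unshelve. all: by end_near.
Qed.

Lemma Lcorr_ge0 {d : measure_display} {Om : measurableType d} (P : R -> probability Om R) (X : Om -> V -> bool)
  (eps0 p : R) : 0 <= Lcorr P X eps0 p.
Proof.
rewrite /Lcorr; set S := [set _ | _ in _]; case: (pselect (S !=set0)) => hS.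
  by apply: lb_le_inf => // _ [n _ <-].
by rewrite (_ : S = set0) ?inf0 //; apply/eqP/negPn/negP => /set0P.
Qed.

Lemma homog_bounds (rho : R * R -> R) (a b : R) : rho (0, 0) = 0 ->
  (forall (c : R) z, 0 < c -> rho (scal2 c z) = c * rho z) ->
  (forall z, eucl z = 1 -> a <= rho z <= b) -> forall z, a * eucl z <= rho z <= b * eucl z.
Proof.
move=> h0 hs hu z; have [u u1 ->] := homog_polar h0 hs z.
case: (eqVneq (eucl z) 0) => [->|ez]; first by rewrite !mulr0 mul0r lexx.
have /andP[h1 h2] := hu u (u1 ez).
by rewrite ![_ * eucl z]mulrC !ler_wpM2l ?eucl_ge0.
Qed.

End MainLemmas.

Theorem theorem1p3 (R : realType) (d : measure_display) (Om : measurableType d)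
  (X : Om -> V -> bool) (P : R -> probability Om R) (eps0 : R)
  (mu : R -> R * R -> R) (nu : R) (beta : R -> R * R -> R) :
  (forall p : R, 0 <= p <= 1 -> site_percolation (P p) X p) ->
  0 < eps0 < 1 / 2 ->
  (* mu p is the time constant *)
  (forall p : R, 1 / 2 < p <= 1 -> forall z : R * R,
     {ae P p, forall om, (fun n : nat => Tpt (X om) ((0, 0) : R * R) (scal2 n%:R z) / n%:R)
                          @ \oo --> mu p z}) ->
  (* nu > 0 is the constant with L(p) mu_p(z) -> nu uniformly in |z| = 1 *)
  0 < nu ->
  (forall e : R, 0 < e -> exists2 delta : R, 0 < delta &
     forall p : R, 1 / 2 < p < 1 / 2 + delta -> forall z : R * R, eucl z = 1 ->
       `| Lcorr P X eps0 p * mu p z - nu | < e) ->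
  (* beta p is the boundary norm *)
  (forall p : R, 1 / 2 < p <= 1 -> forall x : R * R,
     {ae P p, forall om, (fun n : nat =>
        bdist R (X om) (tildeC (X om) ((0, 0) : R * R)) (tildeC (X om) (scal2 n%:R x)) / n%:R)
        @ \oo --> beta p x}) ->
  ((fun p : R => ((Lcorr P X eps0 p)%:E * phi (beta p))%E)
      @ (1 / 2 : R)^'+ --> ((2 * Num.sqrt pi * nu)%:E : \bar R)) /\
  ((fun p : R => hausdorff (wulff_hat (beta p)) (disk (Num.sqrt pi)^-1))
      @ (1 / 2 : R)^'+ --> (0 : \bar R)).
Proof.
move=> perc _ hmu nu0 hL hbeta; pose L p := Lcorr P X eps0 p.
(* The condition e < nu keeps the lower bound on mu positive, as the equality of [beta] and [mu]
   requires. *)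
have key (e : R) : 0 < e < nu -> exists2 delta, 0 < delta & forall p, 1 / 2 < p < 1 / 2 + delta ->
    0 < L p /\ forall x, (nu - e) / L p * eucl x <= beta p x <= (nu + e) / L p * eucl x.
  move=> /andP[e0 en]; have [dl dl0 hd] := hL e e0.
  exists (Num.min dl (1 / 2)); first by rewrite lt_min dl0 divr_gt0.
  move=> p /andP[p1 p2].
  have pd : p < 1 / 2 + dl by apply: lt_le_trans p2 _; rewrite lerD2l ge_min lexx.
  have ph : p <= 1.
    by apply/ltW/(lt_le_trans p2); rewrite [leRHS](splitr 1) lerD2l ge_min lexx orbT.
  have hz z : eucl z = 1 -> `|L p * mu p z - nu| < e by apply: hd; rewrite p1 pd.
  have e10 : eucl ((1, 0) : R * R) = 1 by rewrite /eucl /= expr1n expr0n addr0 sqrtr1.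
  (* The infimum of an empty set is 0 by convention; L p = 0 would put L p * mu at distance nu > e
     from nu. *)
  have L0 : 0 < L p.
    rewrite lt_def Lcorr_ge0 andbT; apply/eqP => L0; have := hz _ e10.
    by rewrite L0 mul0r sub0r normrN gtr0_norm // ltNge ltW.
  have p12 : 1 / 2 < p <= 1 by rewrite p1 ph.
  have hu z : eucl z = 1 -> (nu - e) / L p <= mu p z <= (nu + e) / L p.
    move=> /hz; rewrite ltr_norml => /andP[h1 h2].
    by rewrite ler_pdivrMr // ler_pdivlMr // mulrC; apply/andP; split; lra.
  have c0 : 0 < (nu - e) / L p by rewrite divr_gt0 // subr_gt0.
  have p0 : 0 < p by apply: lt_trans p1; rewrite divr_gt0.
  have perc_p : site_percolation (P p) X p by apply: perc; rewrite ltW.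
  split=> // x; rewrite (beta_eq_mu (hmu p p12) c0 _ p0 perc_p (hbeta p p12)).
    by apply: homog_bounds (mu0 (hmu p p12)) (mu_scale (hmu p p12)) hu x.
  by move=> z /hu/andP[].
have sp : 0 < Num.sqrt pi :> R by rewrite sqrtr_gt0 pi_gt0.
have half e : 0 < e -> 0 < Num.min e (nu / 2) < nu.
  move=> e0; rewrite lt_min e0 divr_gt0 //= gt_min; apply/orP; right; lra.
split; apply: cvge_right => e e0.
  have e1 : 0 < e / (2 * Num.sqrt pi) by rewrite divr_gt0 // mulr_gt0.
  have [dl dl0 hd] := key _ (half _ e1); exists dl => // p /hd [L0 hb].
  set e' := Num.min _ _ in hb; have /andP[e'0 e'n] := half _ e1.
  have he : e' * (2 * Num.sqrt pi) <= e by rewrite -ler_pdivlMr ?mulr_gt0 // ge_min lexx.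
  have a0 : 0 < (nu - e') / L p by rewrite divr_gt0 // subr_gt0.
  have ab : (nu - e') / L p <= (nu + e') / L p by rewrite ler_pM2r ?invr_gt0 //; move: e'0; rewrite -/e'; lra.
  have h1 := phi_ge a0 (fun x => (andP (hb x)).1).
  have h2 := phi_le a0 ab (fun x => (andP (hb x)).2).
  have Ln : L p != 0 by rewrite gt_eqF.
  have LE : (0 <= (L p)%:E)%E by rewrite lee_fin ltW.
  apply/andP; split.
    apply: le_trans (lee_wpmul2l LE h1); rewrite -EFinM lee_fin.
    rewrite (_ : L p * _ = (nu - e') * (2 * Num.sqrt pi)); last by field.
    by rewrite mulrBl [nu * _]mulrC; lra.
  apply: le_trans (lee_wpmul2l LE h2) _; rewrite -EFinM lee_fin.
  rewrite (_ : L p * _ = (nu + e') * (2 * Num.sqrt pi)); last by field.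
  by rewrite mulrDl [nu * _]mulrC; lra.
(* As e' <= nu / 2, the Hausdorff bound 2 e' / ((nu - e') sqrt pi) is at most 4 e' / (nu sqrt
   pi). *)
have e1 : 0 < e * nu * Num.sqrt pi / 4 by rewrite divr_gt0 // !mulr_gt0.
have [dl dl0 hd] := key _ (half _ e1); exists dl => // p /hd [L0 hb].
set e' := Num.min _ _ in hb; have /andP[e'0 e'n] := half _ e1; rewrite -/e' in e'0 e'n.
have a0 : 0 < (nu - e') / L p by rewrite divr_gt0 // subr_gt0.
have ab : (nu - e') / L p <= (nu + e') / L p by rewrite ler_pM2r ?invr_gt0 //; lra.
have h1 := hausdorff_le a0 ab (fun x => (andP (hb x)).1) (fun x => (andP (hb x)).2).
have h0 := @hausdorff_ge0 R (beta p).
apply/andP; split; first by apply: le_trans h0; rewrite lee_fin sub0r oppr_le0 ltW.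
apply: le_trans h1 _; rewrite lee_fin add0r.
have ne : nu - e' != 0 by rewrite gt_eqF // subr_gt0.
have -> : (nu + e') / L p / ((nu - e') / L p) - 1 = 2 * e' / (nu - e').
  by field; rewrite ne gt_eqF.
rewrite mulrC ler_pdivrMr // ler_pdivrMr ?subr_gt0 //.
have h2 : e' <= e * nu * Num.sqrt pi / 4 by rewrite ge_min lexx.
have h3 : e' <= nu / 2 by rewrite ge_min lexx orbT.
have h4 : e * Num.sqrt pi * (nu / 2) <= e * Num.sqrt pi * (nu - e').
  by apply: ler_wpM2l; [rewrite mulr_ge0 ?ltW|lra].
lra.
Qed.
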